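(* Suppose that the dependent (panel) sampling scheme described in the context is applied at stages 1 and 2, and assume that one of the following is satisfied: (i) $X_{01},\dots,X_{0m}$ is an i.i.d. sample with common distribution function $F_0(x)=F(x-\Delta)$ and Assumption Q holds; (ii) Assumption Q' is satisfied. Then $$\begin{pmatrix}\overline{X}_1^*\\ \overline{X}_2^*\end{pmatrix}\stackrel{d}{\to}N\left(\begin{pmatrix}0\\0\end{pmatrix},\Sigma\right),\qquad \Sigma=\begin{pmatrix}1&\rho\\ \rho&1\end{pmatrix},$$ as $\min(n_1,n_2)\to\infty$ with $n_1/n_2\to\lambda$, where $\rho=\sqrt{\lambda}\,\operatorname{Cor}(X_1,X_2)$.
   Context: Distributional model. $F$ is a distribution function with finite fourth moment, mean $\mu$ and variance $\sigma^2\in(0,\infty)$, and $F(x)=G((x-\mu)/\sigma)$, where $G$ is a fixed unknown distribution function with $\int x\,dG(x)=0$ and $\int x^2\,dG(x)=1$. Quantile functions are denoted $F^{-1}$, $G^{-1}$, $F_0^{-1}$. Samples. The additional sample $X_{01},\dots,X_{0m}$ (time $t_0$) has marginal distribution function $F_0(x)=F(x-\Delta)$ for some constant $\Delta\in\mathbb{R}$ and is independent of the observations taken at later times. The control sample $X_{11},\dots,X_{1n_1}$ (time $t_1$) is i.i.d. with distribution function $F$. The inspection sample $X_{21},\dots,X_{2n_2}$ (time $t_2$) is i.i.d. with distribution function $F$. (Inspection measurements are in general distributed as $dX$ with $X\sim F$ and a known degradation constant $d\in(0,\infty)$; the convention is that they have already been multiplied by $D=1/d$.) Dependent (panel) sampling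 scheme. - If $n_2<n_1$, a subsample of $n_2$ of the items drawn at time $t_1$ is remeasured at time $t_2$, giving pairs $(X_{1i},X_{2i})$, $i=1,\dots,n_2$. - If $n_2>n_1$, all $n_1$ items drawn at time $t_1$ are remeasured, giving pairs $(X_{1i},X_{2i})$, $i=1,\dots,n_1$, and $n_2-n_1$ additional new items are drawn from the lot and measured at time $t_2$. The two measurements $X_{1i},X_{2i}$ of the same item are dependent; the pairs are identically distributed as $(X_1,X_2)$, with $\operatorname{Cor}(X_1,X_2)\neq0$. Measurements of different items are independent. The sample sizes satisfy $\lim n_1/n_2=\lambda$. Statistics. For $i=1,2$, $\overline{X}_i=\frac1{n_i}\sum_{j=1}^{n_i}X_{ij}$ and $\overline{X}_i^*=\sqrt{n_i}\,(\overline{X}_i-\mu)/\sigma$. Assumption Q: one of the following holds, for estimators calculated from the additional sample. (i) $G_m^{-1}(p)$ is an estimator of $G^{-1}(p)$ with $\sqrt{m}\,(G_m^{-1}(p)-G^{-1}(p))\stackrel{d}{\to}V$ as $m\to\infty$ for some random variable $V$. (ii) $F_m^{-1}(p)$ is an estimator of $F_0^{-1}(p)$ with $\sqrt{m}\,(F_m^{-1}(p)-F_0^{-1}(p))\stackrel{d}{\to}U$ as $m\to\infty$ for some random variable $U$. Assumption Q': $F_m^{-1}(p)$ is an estimator of the quantile function $F_0^{-1}(p)$, $0<p<1$, calculated from the additional sample, with $\sqrt{m}\,(F_m^{-1}(p)-F_0^{-1}(p))\stackrel{d}{\to}\mathcal{F}(p)$ as $m\to\infty$ for some random process $\{\mathcal{F}(p):0<p<1\}$,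 in the sense of weak convergence of stochastic processes indexed by $p\in(0,1)$.
   Formalization: For λ > 1 the limit correlation is Cor(X_1,X_2)/√λ instead of the printed √λ·Cor(X_1,X_2), which is false there (e.g. X_1 = X_2, n_1 = 4n_2 gives ρ = 2, so Σ is not a covariance matrix); for λ ≤ 1 the formula is as printed. *)

(* Defs.v *)
(* MathComp-Analysis. *)
From HB Require Import structures.
From mathcomp Require Import all_boot all_order all_algebra finmap.
From mathcomp Require Import all_classical all_reals all_analysis.

Set Implicit Arguments.
Unset Strict Implicit.
Unset Printing Implicit Defensive.

Import Order.TTheory GRing.Theory Num.Theory.
Import numFieldNormedType.Exports.

Local Open Scope classical_set_scope.
Local Open Scope ring_scope.

Definition has_cdf (R : realType) d (T : measurableType d)
    (P : probability T R) (X : {RV P >-> R}) (F : R -> R) : Prop :=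
  forall x : R, cdf X x = (F x)%:E.

Definition quantile (R : realType) (F : R -> R) (p : R) : R :=
  inf [set x | p <= F x].

Definition correlation (R : realType) d (T : measurableType d)
    (P : probability T R) (X Y : T -> R) : R :=
  fine (covariance P X Y)
    / (Num.sqrt (fine 'V_P[X]%E) * Num.sqrt (fine 'V_P[Y]%E)).

Definition bounded_continuous (R : realType) (S : topologicalType)
    (f : S -> R) : Prop :=
  continuous f /\ exists M : R, forall s, `|f s| <= M.

(* The intended use is for measurable X and Y; see [cvg_in_dist_outer] for maps
   into spaces where measurability is an issue. *)
Definition cvg_in_dist (R : realType) (S : topologicalType)
    d (T : measurableType d) (P : probability T R) (X : nat -> T -> S)
    d' (T' : measurableType d') (P' : probability T' R) (Y : T' -> S) : Prop :=
  forall f : S -> R, bounded_continuous f ->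
    'E_P[f \o X n]%E @[n --> \oo] --> 'E_P'[f \o Y]%E.

(* For bounded h; then 'E_P[g] is well defined, possibly +oo. *)
Definition outer_expectation (R : realType) d (T : measurableType d)
    (P : probability T R) (h : T -> R) : \bar R :=
  ereal_inf [set z | exists g : {RV P >-> R},
                       (forall w, h w <= g w) /\ z = 'E_P[g]%E].

(* Weak convergence in the sense of Hoffmann-Jorgensen: X n need not be Borel
   measurable, whereas the limit Y must be. *)
Definition cvg_in_dist_outer (R : realType) (S : topologicalType)
    d (T : measurableType d) (P : probability T R) (X : nat -> T -> S)
    d' (T' : measurableType d') (P' : probability T' R) (Y : T' -> S) : Prop :=
  forall f : S -> R, bounded_continuous f ->
    measurable_fun setT (f \o Y) /\
    outer_expectation P (f \o X n) @[n --> \oo] --> 'E_P'[f \o Y]%E.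

(* Functions on ]0, 1[ with uniform convergence on compact subsets. The values
   outside ]0, 1[ are ignored by the topology, hence by continuous functionals. *)
Definition unit_path (R : realType) :=
  {family [set K : set R | compact K /\ K `<=` `]0, 1[], R -> R}.

(* N(m, v) is parameterised by its variance v >= 0. The case v = 0 is separate
   because [normal_prob m 0] is not the point mass at m. *)
Definition normal_law (R : realType) (m v : R) (A : set R) : \bar R :=
  if v == 0 then \d_m A else normal_prob m (Num.sqrt v) A.

(* nu = N(m, S), possibly degenerate, on R^2: all linear functionals are
   univariate normal, with mean and variance given by m and S. *)
Definition is_binormal (R : realType) (nu : probability (R * R)%type R)
    (m : R * R) (S : 'M[R]_2) : Prop :=
  S^T = S /\
  forall u : 'rV[R]_2,
    let v := (u *m S *m u^T) 0 0 in
    0 <= v /\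
    forall A : set R, measurable A ->
      nu [set z | A (u 0 0 * z.1 + u 0 1 * z.2)] =
        normal_law (u 0 0 * m.1 + u 0 1 * m.2) v A.

Definition sigma_of (R : realType) d (T : measurableType d)
    (Y : set (T -> R)) : set (set T) :=
  <<s \bigcup_(f in Y) preimage_set_system setT f measurable >>.

Definition independent2 (R : realType) d (T : measurableType d)
    (P : probability T R) (H K : set (set T)) : Prop :=
  forall A B, H A -> K B -> P (A `&` B) = (P A * P B)%E.

Definition mutually_independent (R : realType) d (T : measurableType d)
    (P : probability T R) (I : choiceType) (H : I -> set (set T)) : Prop :=
  forall (J : {fset I}) (E : I -> set T),
    (forall i, i \in J -> H i (E i)) ->
    P (\bigcap_(i in [set` J]) E i) = (\prod_(i <- J) P (E i))%E.

(* The measurements actually taken on item i when n1 items are measured at the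
   first stage and n2 at the second. Items are numbered so that those measured
   twice come first: items i < min(n1, n2) carry two measurements, the others
   only one. *)
Definition item_measurements (R : realType) d (T : measurableType d)
    (n1 n2 : nat) (X1 X2 : nat -> T -> R) (i : nat) : set (T -> R) :=
  [set f | (i < n1)%N /\ f = X1 i \/ (i < n2)%N /\ f = X2 i].

Record panel_scheme (R : realType) d (T : measurableType d)
    (P : probability T R) (F : R -> R) (Y1 Y2 : {RV P >-> R})
    (n1 n2 : nat) (X1 X2 : nat -> {RV P >-> R}) : Prop := {
  panel_cdf1 : forall i, (i < n1)%N -> has_cdf (X1 i) F ;
  panel_cdf2 : forall i, (i < n2)%N -> has_cdf (X2 i) F ;
  panel_pairs : forall i, (i < minn n1 n2)%N ->
    forall A : set (R * R), measurable A ->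
      P [set w | A (X1 i w, X2 i w)] = P [set w | A (Y1 w, Y2 w)] ;
  panel_items : mutually_independent P
    (fun i => sigma_of (item_measurements n1 n2 X1 X2 i)) }.

(* The additional sample X0 0, X0 1, ... and the panel measurements. *)
Definition indep_of_panel (R : realType) d (T : measurableType d)
    (P : probability T R) (X0 : nat -> {RV P >-> R})
    (n1 n2 : nat) (X1 X2 : nat -> {RV P >-> R}) : Prop :=
  independent2 P
    (sigma_of [set f : T -> R | exists j, f = X0 j])
    (sigma_of (\bigcup_i item_measurements n1 n2 X1 X2 i)).

Definition std_mean (R : realType) d (T : measurableType d)
    (mu sigma : R) (n : nat) (X : nat -> T -> R) (w : T) : R :=
  Num.sqrt n%:R * ((\sum_(j < n) X j w) / n%:R - mu) / sigma.

Definition sample (R : realType) d (T : measurableType d)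
    (X0 : nat -> T -> R) (m : nat) (w : T) : m.-tuple R :=
  [tuple X0 i w | i < m].

(* [q m x p] estimates a quantile of order p from the sample x of size m. *)
Definition quantile_estimator (R : realType) := forall m, m.-tuple R -> R -> R.

Definition estimation_error (R : realType) d (T : measurableType d)
    (X0 : nat -> T -> R) (q : quantile_estimator R) (H : R -> R)
    (m : nat) (w : T) (p : R) : R :=
  Num.sqrt m%:R * (q m (sample X0 m w) p - quantile H p).

Definition quantile_clt (R : realType) d (T : measurableType d)
    (P : probability T R) (X0 : nat -> {RV P >-> R})
    (q : quantile_estimator R) (H : R -> R) (p : R) : Prop :=
  (forall m, measurable_fun setT (fun x : m.-tuple R => q m x p)) /\
  exists d' (T' : measurableType d') (P' : probability T' R)
         (V : {RV P' >-> R}),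
    cvg_in_dist P (fun m w => estimation_error X0 q H m w p) P' V.

Definition assumption_Q (R : realType) d (T : measurableType d)
    (P : probability T R) (G F0 : R -> R) (X0 : nat -> {RV P >-> R})
    (Gm Fm : quantile_estimator R) (p : R) : Prop :=
  quantile_clt X0 Gm G p \/ quantile_clt X0 Fm F0 p.

Definition assumption_Q' (R : realType) d (T : measurableType d)
    (P : probability T R) (F0 : R -> R) (X0 : nat -> {RV P >-> R})
    (Fm : quantile_estimator R) : Prop :=
  (forall m p, 0 < p < 1 ->
     measurable_fun setT (fun x : m.-tuple R => Fm m x p)) /\
  exists d' (T' : measurableType d') (P' : probability T' R)
         (Z : T' -> unit_path R),
    (forall p, 0 < p < 1 -> measurable_fun setT (fun w => Z w p)) /\
    cvg_in_dist_outer P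
      (fun m w => estimation_error X0 Fm F0 m w : unit_path R) P' Z.

Definition iid_sample (R : realType) d (T : measurableType d)
    (P : probability T R) (F : R -> R) (X : nat -> {RV P >-> R}) : Prop :=
  (forall j, has_cdf (X j) F) /\
  mutually_independent P (fun j => sigma_of [set X j : T -> R]).

(* Main.v *)
(* A bounded continuous function on the plane is approximated, up to
   e (1 + x^2 + y^2), by trigonometric polynomials (discrete Fejer sums), so for
   variables with bounded second moments it suffices to show
   E cos(a Z1 + b Z2 + c) -> E cos(a N1 + b N2 + c). Now a Z1 + b Z2 is a sum of
   max(n1, n2) independent contributions, one per item, and Lindeberg's
   replacement argument applies: fourth moments bound the error of replacing
   each contribution by a centred normal variable of the same variance. The
   variances add up to a^2 + b^2 + 2 a b r sqrt(min(n1, n2) / max(n1, n2)) with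
   r = Cor(Y1, Y2), since exactly min(n1, n2) items are measured twice. *)

Require Import Defs.
From HB Require Import structures.
From mathcomp Require Import all_boot all_order all_algebra finmap.
From mathcomp Require Import all_classical all_reals all_analysis.
From mathcomp Require Import measurable_realfun ring lra zify.

Set Implicit Arguments.
Unset Strict Implicit.
Unset Printing Implicit Defensive.

Import Order.TTheory GRing.Theory Num.Theory.
Import numFieldNormedType.Exports.

Local Open Scope classical_set_scope.
Local Open Scope ring_scope.

(** * Trigonometric approximation *)

Section fejer.
Context {R : realType}.
Implicit Types (a b t x : R).

(** Cosines with a free phase replace complex characteristic functions. A shift of the phase turns
    sines into cosines, so one real family of test functions has a span closed under products and
    under the addition formula. Thus the independence of a partial sum from the next item is used
    only through expectations of such cosines, never as a statement about sigma-algebras. On the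
    Gaussian side stands [gauss_cf s], the expectation of cos (sqrt s N). Its closed form exp (-s/2)
    is not computed. The proof uses its bound by 1, its expansion 1 - s/2 + O(s^2), and its
    multiplicativity, which comes from the rotation invariance of a pair of independent normal
    variables. The error made in one row is at most a constant over sqrt (min (n1, n2)), with a
    constant that does not depend on the row. The Gaussian variance is that of the row itself; the
    limit of n1/n2 enters only at the end, through the continuity of [gauss_cf]. *)

Lemma cosDz2pi x (m : int) : cos (x + m%:~R * (pi *+ 2)) = cos x.
Proof.
wlog: m x / exists n, m = Posz n.
  move=> H; case: m => n; first by apply: H; exists n.
  rewrite -(H n.+1 (x + (Negz n)%:~R * (pi *+ 2))); last by exists n.+1.
  by congr cos; rewrite NegzE; ring.
by case=> n ->; rewrite -(periodicn (@cosD2pi R) n x) -[in RHS]mulr_natl.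
Qed.

Lemma sinDz2pi x (m : int) : sin (x + m%:~R * (pi *+ 2)) = sin x.
Proof.
by rewrite -!cosBpihalf -[RHS](cosDz2pi _ m); congr cos; ring.
Qed.

Lemma cosMcos a b : cos a * cos b = (cos (a + b) + cos (a - b)) / 2.
Proof. by rewrite cosB cosD; field. Qed.

(** The angle has absolute value strictly between 0 and pi. It is half the step between the angles
    of [sum_cos_equispaced], where the telescoping argument divides by its sine. *)
Lemma sin_pi_frac_neq0 (M : nat) (m : int) : m != 0 -> (`|m| < M)%N ->
  sin (m%:~R * (pi / M%:R)) != 0 :> R.
Proof.
wlog: m / exists n, m = Posz n.
  move=> H; case: m => n m0 mM; first by apply: H => //; exists n.
  rewrite -oppr_eq0 -sinN (_ : - _ = n.+1%:~R * (pi / M%:R)); last first.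
    by rewrite NegzE; ring.
  by apply: H => //; exists n.+1.
case=> n -> n0 nM; rewrite gt_eqF// sin_gt0_pi//.
have M0 : 0 < M%:R :> R by rewrite ltr0n; apply: leq_ltn_trans nM.
have n1 : 0 < n%:R :> R by rewrite ltr0n lt0n.
have nM1 : n%:R < M%:R :> R by rewrite ltr_nat.
rewrite pmulrn mulr_gt0 ?divr_gt0 ?pi_gt0//=.
by rewrite mulrCA mulrC -subr_gt0 -[X in X - _]mul1r -mulrBl mulr_gt0 ?pi_gt0//
  subr_gt0 ltr_pdivrMr// mul1r.
Qed.

(** After multiplication by [2 * sin h] each cosine becomes sin (b + h) - sin (b - h), so the sum
    telescopes, and the two end angles differ by m full turns. *)
Lemma sum_cos_equispaced (M : nat) (m : int) a : m != 0 -> (`|m| < M)%N ->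
  \sum_(j < M) cos (a + m%:~R * (j%:R * (pi *+ 2 / M%:R))) = 0.
Proof.
move=> m0 mM.
have M0 : M%:R != 0 :> R by rewrite pnatr_eq0 -lt0n; apply: leq_ltn_trans mM.
set h : R := m%:~R * (pi / M%:R).
pose u j : R := sin (a + (j%:R *+ 2 - 1) * h).
have step j : 2 * sin h * cos (a + m%:~R * (j%:R * (pi *+ 2 / M%:R))) = u j.+1 - u j.
  set b := _ + _.
  have -> : u j.+1 = sin (b + h) by congr sin; rewrite /b/h -natr1; ring.
  have -> : u j = sin (b - h) by congr sin; rewrite /b/h; ring.
  by rewrite sinD sinB; ring.
apply: (mulfI (x := 2 * sin h)); first by rewrite mulf_neq0 ?pnatr_eq0// sin_pi_frac_neq0.
rewrite mulr0 mulr_sumr.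
under eq_bigr do rewrite step.
rewrite -(big_mkord xpredT (fun j => u j.+1 - u j)) telescope_sumr// /u.
rewrite (_ : a + (M%:R *+ 2 - 1) * h = a + (0%:R *+ 2 - 1) * h + m%:~R * (pi *+ 2)).
  by rewrite sinDz2pi subrr.
by rewrite /h; field.
Qed.

(** The Fejer kernel |sum_(k < n) exp (ikt)|^2 / n. The double sum exhibits a trigonometric
    polynomial with frequencies below n in modulus; the square gives the sign. *)
Definition fejer (n : nat) t : R :=
  n%:R^-1 * \sum_(k < n) \sum_(l < n) cos ((k%:Z - l%:Z)%:~R * t).

Lemma fejer_ge0 n t : 0 <= fejer n t.
Proof.
rewrite mulr_ge0// (_ : \sum_(k < n) _ =
  (\sum_(k < n) cos (k%:R * t)) ^+ 2 + (\sum_(k < n) sin (k%:R * t)) ^+ 2).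
  by rewrite addr_ge0 ?sqr_ge0.
rewrite !expr2 !mulr_suml -big_split/=; apply: eq_bigr => k _.
rewrite !mulr_sumr -big_split/=; apply: eq_bigr => l _.
by rewrite -cosB rmorphB/= mulrBl.
Qed.

(** Over n+1 equispaced nodes every nonzero frequency k - l sums to 0, so only the n diagonal terms
    remain. *)
Lemma sum_fejer n t : (0 < n)%N ->
  \sum_(j < n.+1) fejer n (t - j%:R * (pi *+ 2 / n.+1%:R)) = n.+1%:R.
Proof.
move=> n0; have n0R : n%:R != 0 :> R by rewrite pnatr_eq0 -lt0n.
rewrite /fejer -mulr_sumr exchange_big/=.
rewrite (eq_bigr (fun=> n.+1%:R)) ?sumr_const ?card_ord.
  by rewrite -[X in _ * X]mulr_natr mulrCA mulVf// mulr1.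
move=> k _; rewrite exchange_big/= (bigD1 k)//= [X in _ + X]big1 ?addr0.
  under eq_bigr do rewrite subrr mul0r cos0.
  by rewrite sumr_const card_ord.
move=> l lk.
rewrite (eq_bigr (fun j : 'I_n.+1 => cos ((l%:Z - k%:Z)%:~R * - t +
    (l%:Z - k%:Z)%:~R * (j%:R * (pi *+ 2 / n.+1%:R))))); last first.
  by move=> j _; congr cos; rewrite !rmorphB/=; ring.
apply: sum_cos_equispaced; first by rewrite subr_eq0.
by have := ltn_ord l; have := ltn_ord k; lia.
Qed.

(** Multiplication by the cosine shifts frequencies by 1, up to n in modulus, which is why there are
    n+1 nodes and not n. The 2(n-1) pairs with |k - l| = 1 survive, each with weight 1/2, so the
    cosine part sums to (n+1)(n-1)/n. *)
Lemma sum_fejer_cos n t : (0 < n)%N ->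
  \sum_(j < n.+1) fejer n (t - j%:R * (pi *+ 2 / n.+1%:R)) *
    (1 - cos (t - j%:R * (pi *+ 2 / n.+1%:R))) = n.+1%:R / n%:R.
Proof.
move=> n0; have n0R : n%:R != 0 :> R by rewrite pnatr_eq0 -lt0n.
under eq_bigr do rewrite mulrBr mulr1.
rewrite big_split/= sumrN sum_fejer//.
suff -> : \sum_(j < n.+1) fejer n (t - j%:R * (pi *+ 2 / n.+1%:R)) *
    cos (t - j%:R * (pi *+ 2 / n.+1%:R)) = n.+1%:R * n.-1%:R / n%:R.
  by rewrite -subn1 natrB//; field.
pose th (j : nat) := t - j%:R * (pi *+ 2 / n.+1%:R).
have mean (m : int) : (`|m| < n.+1)%N ->
    \sum_(j < n.+1) cos (m%:~R * th j) = n.+1%:R * (m == 0)%:R.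
  move=> mn; have [->|m0] := eqVneq m 0.
    by under eq_bigr do rewrite mul0r cos0; rewrite sumr_const card_ord mulr1.
  rewrite mulr0 -[RHS](@sum_cos_equispaced n.+1 (- m) (m%:~R * t)) ?oppr_eq0 ?abszN//.
  by apply: eq_bigr => j _; congr cos; rewrite /th; ring.
have -> : n.+1%:R * n.-1%:R / n%:R = n%:R^-1 * \sum_(k < n) \sum_(l < n)
    (n.+1%:R * (l == k.+1 :> nat)%:R + n.+1%:R * (k == l.+1 :> nat)%:R) / 2 :> R.
  have cnt : \sum_(k < n) \sum_(l < n) (l == k.+1 :> nat)%:R = n.-1%:R :> R.
    rewrite (eq_bigr (fun k : 'I_n => (k.+1 < n)%N%:R)); last first.
      move=> k _; have [kn|kn] := ltnP k.+1 n.
        rewrite (bigD1 (Ordinal kn))//= eqxx big1 ?addr0// => l.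
        by rewrite -val_eqE/= => /negbTE ->.
      by rewrite big1// => l _; case: eqP => // lk; have := ltn_ord l; rewrite lk ltnNge kn.
    case: n n0 {n0R th mean} => // n _; rewrite big_ord_recr/= ltnn addr0.
    rewrite (eq_bigr (fun=> 1)) ?sumr_const ?card_ord// => i _.
    by rewrite ltnS ltn_ord.
  under eq_bigr do rewrite -mulr_suml big_split/= -!mulr_sumr.
  rewrite -mulr_suml big_split/= -!mulr_sumr cnt.
  rewrite [X in _ + _ * X]exchange_big/= [X in _ + _ * X]cnt.
  by field.
rewrite /fejer; under eq_bigr do rewrite -mulrA mulr_suml.
rewrite -mulr_sumr; congr (_ * _).
rewrite exchange_big/=; apply: eq_bigr => k _.
under eq_bigr do rewrite mulr_suml.
rewrite exchange_big/=; apply: eq_bigr => l _.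
have kn := ltn_ord k; have ln := ltn_ord l.
rewrite (eq_bigr (fun j : 'I_n.+1 => (cos ((k%:Z - l%:Z + 1)%:~R * th j) +
    cos ((k%:Z - l%:Z - 1)%:~R * th j)) / 2)); last first.
  move=> j _; rewrite cosMcos; congr ((cos _ + cos _) / _);
    by rewrite ?(rmorphB, rmorphD)/= /th; ring.
rewrite -mulr_suml big_split/= !mean; [|by lia|by lia].
by congr ((_ * _ + _ * _) / _); congr (_%:R); apply/eqP/eqP; lia.
Qed.
End fejer.

(** Compactness enters as a near-covering property, with [dl] tending to 0 from the right as the
    parameter. The second point may leave the square, so the boundary needs no care. *)
Lemma square_uniform_continuity (R : realType) (f : R * R -> R) (L e : R) :
  continuous f -> 0 < e ->
  exists2 dl, 0 < dl & forall x y x' y' : R,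
    x \in `[- L, L] -> y \in `[- L, L] -> `|x - x'| < dl -> `|y - y'| < dl ->
    `|f (x, y) - f (x', y')| < e.
Proof.
move=> cf e0.
have cK : compact (`[- L, L]%classic `*` `[- L, L]%classic : set (R * R)).
  by apply: compact_setX; exact: segment_compact.
pose Q (dl : R) (z : R * R) := forall x' y', `|z.1 - x'| < dl -> `|z.2 - y'| < dl ->
  `|f z - f (x', y')| < e.
have /compact_near_coveringP/(_ R ((0 : R)^'+) Q) := cK.
have Qnear z : (`[- L, L]%classic `*` `[- L, L]%classic) z ->
    \forall z' \near z & i \near (0 : R)^'+, Q i z'.
  move=> _; have /cvgrPdist_lt/(_ (e / 2)) := cf z; rewrite divr_gt0// => /(_ isT).
  move=> /nbhs_ballP[r /= r0 Hr].
  have r20 : 0 < r / 2 by rewrite divr_gt0.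
  exists (ball z (r / 2), [set i : R | i < r / 2]) => /=.
    split; first exact: nbhsx_ballx.
    exact: nbhs_right_lt.
  move=> [[x y] i] /= [] [/= zx zy] ir x' y' /= xx' yy'.
  have {}zx : `|z.1 - x| < r / 2 by [].
  have {}zy : `|z.2 - y| < r / 2 by [].
  have h1 : `|f z - f (x, y)| < e / 2.
    apply: Hr; split; rewrite /ball/=.
      by apply: lt_trans zx _; lra.
    by apply: lt_trans zy _; lra.
  have h2 : `|f z - f (x', y')| < e / 2.
    apply: Hr; split; rewrite /ball/=.
      by apply: le_lt_trans (ler_distD x _ _) _; lra.
    by apply: le_lt_trans (ler_distD y _ _) _; lra.
  by apply: le_lt_trans (ler_distD (f z) _ _) _; rewrite distrC; lra.
move=> /(_ _ Qnear) Qall.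
have Qpos : \forall i \near (0 : R)^'+,
    (`[- L, L]%classic `*` `[- L, L]%classic `<=` Q i) /\ 0 < i.
  apply: filterI Qall _. exact: nbhs_right_gt.
have [dl] := @filter_ex _ _ (at_right_proper_filter (0 : R)) _ Qpos.
move=> [Qdl dl0].
exists dl => // x y x' y' xL yL xx' yy'.
by apply: (Qdl (x, y)) => //; split.
Qed.

(** The free phase [c] includes sines and constants, and makes the class closed under products by
    the product-to-sum formula. *)
Inductive trig_poly (R : realType) : (R * R -> R) -> Prop :=
| trig_poly_cos a b c : trig_poly (fun z => cos (a * z.1 + b * z.2 + c))
| trig_polyD f g : trig_poly f -> trig_poly g -> trig_poly (f \+ g)
| trig_polyZ k f : trig_poly f -> trig_poly (fun z => k * f z).

Section trig_poly_theory.
Context {R : realType}.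
Implicit Types f g : R * R -> R.

Lemma trig_poly_cst k : trig_poly (fun=> k : R).
Proof.
rewrite (_ : (fun=> k) = fun z : R * R => k * cos (0 * z.1 + 0 * z.2 + 0)).
  by apply: trig_polyZ; exact: trig_poly_cos.
by apply/funext => z; rewrite !mul0r !addr0 cos0 mulr1.
Qed.

Lemma trig_polyM f g : trig_poly f -> trig_poly g -> trig_poly (fun z => f z * g z).
Proof.
move=> tf; elim: tf g => {f} [a b c|f1 f2 _ IH1 _ IH2|k f _ IH] g tg; last 2 first.
- rewrite (_ : (fun _ => _) = (fun z => f1 z * g z) \+ (fun z => f2 z * g z)).
    by apply: trig_polyD; [exact: IH1|exact: IH2].
  by apply/funext => z /=; rewrite mulrDl.
- rewrite (_ : (fun _ => _) = (fun z => k * (f z * g z))).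
    by apply: trig_polyZ; exact: IH.
  by apply/funext => z /=; rewrite mulrA.
elim: tg => {g} [a' b' c'|g1 g2 _ IH1 _ IH2|k g _ IH]; last 2 first.
- rewrite (_ : (fun _ => _) = (fun z => cos (a * z.1 + b * z.2 + c) * g1 z) \+
      (fun z => cos (a * z.1 + b * z.2 + c) * g2 z)).
    exact: trig_polyD.
  by apply/funext => z /=; rewrite mulrDr.
- rewrite (_ : (fun _ => _) = (fun z => k * (cos (a * z.1 + b * z.2 + c) * g z))).
    exact: trig_polyZ.
  by apply/funext => z /=; rewrite mulrCA.
rewrite (_ : (fun _ => _) = (fun z => 2^-1 *
  (((fun z => cos ((a + a') * z.1 + (b + b') * z.2 + (c + c'))) \+
   (fun z => cos ((a - a') * z.1 + (b - b') * z.2 + (c - c')))) z))).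
  by apply: trig_polyZ; apply: trig_polyD; exact: trig_poly_cos.
apply/funext => z /=; rewrite cosMcos mulrC.
by congr (_ * (cos _ + cos _)); ring.
Qed.

Lemma trig_poly_sum n (F : 'I_n -> R * R -> R) :
  (forall i, trig_poly (F i)) -> trig_poly (fun z => \sum_(i < n) F i z).
Proof.
elim: n F => [|n IH] F tF.
  under eq_fun do rewrite big_ord0; exact: trig_poly_cst.
under eq_fun do rewrite big_ord_recr/=.
by apply: trig_polyD => //; exact: IH.
Qed.

Definition fejer_node (L : R) n (j : nat) : R := - L + (L *+ 2) * j%:R / n.+1%:R.

(** As functions of [x] these are nonnegative, have period 2L and sum to 1 over the nodes. They act
    as the probabilities of a random node close to [x] modulo 2L. *)
Definition fejer_weight (L : R) n (j : nat) (x : R) :=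
  n.+1%:R^-1 * fejer n (pi / L * (x - fejer_node L n j)).

Lemma fejer_weight_ge0 L n j x : 0 <= fejer_weight L n j x.
Proof. by rewrite mulr_ge0// fejer_ge0. Qed.

Lemma fejer_argE L n j x : L != 0 ->
  pi / L * (x - fejer_node L n j) =
  pi / L * (x + L) - j%:R * (pi *+ 2 / n.+1%:R).
Proof. by move=> L0; rewrite /fejer_node; field; rewrite L0 nat1r pnatr_eq0. Qed.

Lemma sum_fejer_weight L n x : L != 0 -> (0 < n)%N ->
  \sum_(j < n.+1) fejer_weight L n j x = 1.
Proof.
move=> L0 n0; rewrite -mulr_sumr.
under eq_bigr do rewrite fejer_argE//.
by rewrite sum_fejer// mulVf.
Qed.

(** Here 1 - cos plays the role of a squared distance to the random node, so this is its variance.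
    In [trig_poly_approx] it serves for a Chebyshev bound on the weight of distant nodes. *)
Lemma sum_fejer_weight_cos L n x : L != 0 -> (0 < n)%N ->
  \sum_(j < n.+1) fejer_weight L n j x *
    (1 - cos (pi / L * (x - fejer_node L n j))) = n%:R^-1.
Proof.
move=> L0 n0; rewrite /fejer_weight; under eq_bigr do rewrite fejer_argE// -mulrA.
rewrite -mulr_sumr sum_fejer_cos//; field.
by rewrite nat1r pnatr_eq0 -lt0n n0/=.
Qed.

Lemma fejer_node_itv L n j : 0 <= L -> (j < n.+1)%N ->
  fejer_node L n j \in `[- L, L].
Proof.
move=> L0 jn; rewrite in_itv/= /fejer_node lerDl -mulrA mulr_ge0 ?mulrn_wge0//=.
rewrite -lerBrDl opprK -mulr2n ler_piMr ?mulrn_wge0//.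
by rewrite ler_pdivrMr// mul1r ler_nat ltnW.
Qed.

Lemma trig_poly_fejer_weight1 L n j : trig_poly (fun z => fejer_weight L n j z.1).
Proof.
apply: trig_polyZ; apply: trig_polyZ.
apply: trig_poly_sum => k; apply: trig_poly_sum => l.
set m := _%:~R.
rewrite (_ : (fun _ => _) = fun z : R * R =>
    cos (m * (pi / L) * z.1 + 0 * z.2 - m * (pi / L) * fejer_node L n j)).
  exact: trig_poly_cos.
by apply/funext => z; congr cos; ring.
Qed.

Lemma trig_poly_fejer_weight2 L n j : trig_poly (fun z => fejer_weight L n j z.2).
Proof.
apply: trig_polyZ; apply: trig_polyZ.
apply: trig_poly_sum => k; apply: trig_poly_sum => l.
set m := _%:~R.
rewrite (_ : (fun _ => _) = fun z : R * R =>
    cos (0 * z.1 + m * (pi / L) * z.2 - m * (pi / L) * fejer_node L n j)).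
  exact: trig_poly_cos.
by apply/funext => z; congr cos; ring.
Qed.

(** Up to pi the cosine decreases, and from pi to 3pi/2 it is nonpositive while cos c is not. The
    upper limit 3pi/2 is what a point of [-L/2, L/2] and a node of [-L, L] can reach; the next
    period is never approached. *)
Lemma one_sub_cos_ge (c u : R) : 0 < c <= pi / 2 -> c <= `|u| <= 3 * (pi / 2) ->
  1 - cos c <= 1 - cos u.
Proof.
move=> /andP[c0 c1] /andP[cu u3]; rewrite -(cos_norm u) lerD2l lerN2.
have p0 := @pi_gt0 R.
have [upi|piu] := leP `|u| pi.
  move: cu; rewrite le_eqVlt => /predU1P[->//|cu].
  by rewrite ltW// ltr_cos// in_itv/=; lra.
apply: (@le_trans _ _ 0); last by apply: cos_ge0_pihalf; lra.
rewrite -(subrK pi `|u|) cosDpi oppr_le0 cos_ge0_pihalf//; lra.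
Qed.

(* Uniform density on compacts is not enough to test weak convergence; the
   weight 1 + x^2 + y^2 leaves the tails to second moments. *)
Lemma trig_poly_approx f (e : R) : bounded_continuous f -> 0 < e ->
  exists2 q, trig_poly q &
    forall z, `|f z - q z| <= e * (1 + z.1 ^+ 2 + z.2 ^+ 2).
Proof.
move=> [cf [M' fM']] e0.
pose M := Num.max 1 M'.
have M0 : 0 < M by rewrite lt_max ltr01.
have fM s : `|f s| <= M by rewrite (le_trans (fM' s))// le_max lexx orbT.
(* Large enough for [8 * M <= e * L ^+ 2]: once a coordinate t exceeds L/2 in modulus, e t^2 is at
   least 2M, the trivial bound on a difference of values of [f]. *)
pose L := 1 + 8 * M / e.
have Me0 : 0 < 8 * M / e by rewrite divr_gt0// mulr_gt0.
have L0 : 0 < L by rewrite /L; lra.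
have Lneq0 : L != 0 by rewrite gt_eqF.
have p0 := @pi_gt0 R.
have LM : 8 * M <= e * L ^+ 2.
  rewrite -ler_pdivrMl// mulrC expr2 /L.
  by nra.
have e20 : 0 < e / 2 by lra.
have [dl0 dl00 ucf] := square_uniform_continuity L cf e20.
(* The cap L/2 keeps the angle [c] below pi/2, as [one_sub_cos_ge] requires. *)
pose dl := Num.min dl0 (L / 2).
have dlgt0 : 0 < dl by rewrite lt_min dl00 divr_gt0.
pose c := pi / L * dl.
have c0 : 0 < c by rewrite !mulr_gt0// invr_gt0.
have c1 : c <= pi / 2.
  rewrite /c (_ : pi / 2 = pi / L * (L / 2)); last by field.
  by rewrite ler_wpM2l ?divr_ge0 ?(ltW p0) ?(ltW L0)// ge_min lexx orbT.
pose eta := 1 - cos c.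
have eta0 : 0 < eta.
  rewrite subr_gt0 -[ltRHS]cos0 ltr_cos// in_itv/= ?lexx ?ltW//=; lra.
(* The two coordinates together contribute 2M/eta (1/n + 1/n) to the Chebyshev term. *)
have [n n0 nP] : exists2 n, (0 < n)%N & 4 * M / eta / n%:R <= e / 2.
  pose x := 4 * M / eta / (e / 2).
  have x0 : 0 <= x by rewrite !divr_ge0 ?mulr_ge0 ?(ltW M0) ?(ltW eta0)// ltW.
  exists (Num.bound x) => //.
  rewrite ler_pdivrMr; last by rewrite (le_lt_trans x0)// archi_boundP.
  by rewrite -ler_pdivrMl// mulrC ltW// archi_boundP.
pose nd := fejer_node L n; pose w := fejer_weight L n.
pose q (z : R * R) := \sum_(j < n.+1) \sum_(l < n.+1) f (nd j, nd l) * (w j z.1 * w l z.2).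
have w0 j x : 0 <= w j x by exact: fejer_weight_ge0.
have w1 x : \sum_(j < n.+1) w j x = 1 by exact: sum_fejer_weight.
have ww1 (x y : R) : \sum_(j < n.+1) \sum_(l < n.+1) w j x * w l y = 1.
  by under eq_bigr do rewrite -mulr_sumr w1 mulr1; rewrite w1.
exists q.
  apply: trig_poly_sum => j; apply: trig_poly_sum => l; apply: trig_polyZ.
  apply: trig_polyM; [exact: trig_poly_fejer_weight1|exact: trig_poly_fejer_weight2].
move=> [x y]; rewrite /q/=.
have -> : f (x, y) - \sum_(j < n.+1) \sum_(l < n.+1) f (nd j, nd l) * (w j x * w l y) =
    \sum_(j < n.+1) \sum_(l < n.+1) (f (x, y) - f (nd j, nd l)) * (w j x * w l y).
  under [RHS]eq_bigr do under eq_bigr do rewrite mulrBl.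
  under [RHS]eq_bigr do rewrite sumrB -mulr_sumr.
  by rewrite sumrB -mulr_sumr ww1 mulr1.
(* Each summand of [B] covers one case: uniform continuity when the node is within [dl] in both
   coordinates; the 1 - cos terms, one of them at least [eta], when it is not; the quadratic term
   when (x, y) is far from the origin. *)
pose B (j l : nat) := e / 2 +
  2 * M / eta * ((1 - cos (pi / L * (x - nd j))) +
    (1 - cos (pi / L * (y - nd l)))) + e * (x ^+ 2 + y ^+ 2).
have cB t : 0 <= 1 - cos t :> R by rewrite subr_ge0 cos_le1.
have Me : 0 < 2 * M / eta by rewrite divr_gt0// mulr_gt0.
have fB (j l : 'I_n.+1) : `|f (x, y) - f (nd j, nd l)| <= B j l.
  have f2 : `|f (x, y) - f (nd j, nd l)| <= 2 * M.
    by rewrite (le_trans (ler_normB _ _))//; have := fM (x, y); have := fM (nd j, nd l); lra.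
  have x2 : 0 <= x ^+ 2 by exact: sqr_ge0.
  have y2 : 0 <= y ^+ 2 by exact: sqr_ge0.
  have exy : 0 <= e * (x ^+ 2 + y ^+ 2) by rewrite mulr_ge0 ?(ltW e0)// addr_ge0.
  have ex2 : 0 <= e * x ^+ 2 by rewrite mulr_ge0// ltW.
  have ey2 : 0 <= e * y ^+ 2 by rewrite mulr_ge0// ltW.
  have C0 : 0 <= 2 * M / eta * ((1 - cos (pi / L * (x - nd j))) + (1 - cos (pi / L * (y - nd l)))).
    by rewrite mulr_ge0 ?(ltW Me)// addr_ge0.
  have far t : L / 2 < `|t| -> 2 * M <= e * t ^+ 2.
    move=> tL; rewrite -real_normK ?num_real//.
    have : (L / 2) ^+ 2 <= `|t| ^+ 2 by rewrite ler_sqr ?nnegrE ?divr_ge0 ?(ltW L0)// ltW.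
    by move=> H; have := ler_wpM2l (ltW e0) H; rewrite expr_div_n; lra.
  have [xL|/far xL] := leP `|x| (L / 2); last by rewrite /B; lra.
  have [yL|/far yL] := leP `|y| (L / 2); last by rewrite /B; lra.
  have ndL (k : 'I_n.+1) : `|nd k| <= L.
    by have := fejer_node_itv (ltW L0) (ltn_ord k); rewrite in_itv/= ler_norml.
  have apart (t : R) (k : 'I_n.+1) : `|t| <= L / 2 -> dl <= `|t - nd k| ->
      eta <= 1 - cos (pi / L * (t - nd k)).
    move=> tL tk; apply: one_sub_cos_ge; first by rewrite c0 c1.
    have pL : 0 < pi / L by rewrite divr_gt0.
    rewrite normrM (gtr0_norm pL) /c ler_pM2l// tk/=.
    rewrite (_ : 3 * (pi / 2) = pi / L * (3 * (L / 2))); last by field.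
    rewrite ler_pM2l// (le_trans (ler_normB _ _))//.
    by have := ndL k; lra.
  have etaB (u v : R) : 0 <= u -> 0 <= v -> (eta <= u) || (eta <= v) ->
      2 * M <= 2 * M / eta * (u + v).
    move=> u0 v0 uv; rewrite -[leLHS](divfK (lt0r_neq0 eta0)) ler_pM2l//.
    by case/orP: uv; lra.
  have [xk|xk] := leP dl `|x - nd j|.
    have := etaB _ _ (cB (pi / L * (x - nd j))) (cB (pi / L * (y - nd l))).
    by rewrite apart// => /(_ isT); rewrite /B; lra.
  have [yk|yk] := leP dl `|y - nd l|.
    have := etaB _ _ (cB (pi / L * (x - nd j))) (cB (pi / L * (y - nd l))).
    by rewrite (apart y)// orbT => /(_ isT); rewrite /B; lra.
  have : `|f (x, y) - f (nd j, nd l)| < e / 2.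
    apply: ucf.
    - by move: xL; rewrite in_itv/= ler_norml; lra.
    - by move: yL; rewrite in_itv/= ler_norml; lra.
    - by rewrite (lt_le_trans xk)// ge_min lexx.
    - by rewrite (lt_le_trans yk)// ge_min lexx.
  by rewrite /B; lra.
apply: (@le_trans _ _ (\sum_(j < n.+1) \sum_(l < n.+1) B j l * (w j x * w l y))).
  apply: le_trans (ler_norm_sum _ _ _) _; apply: ler_sum => j _.
  apply: le_trans (ler_norm_sum _ _ _) _; apply: ler_sum => l _.
  by rewrite normrM (ger0_norm (mulr_ge0 _ _))// ler_wpM2r// mulr_ge0.
have c1x (t : R) : \sum_(j < n.+1) w j t * (1 - cos (pi / L * (t - nd j))) = n%:R^-1.
  exact: sum_fejer_weight_cos.
have -> : \sum_(j < n.+1) \sum_(l < n.+1) B j l * (w j x * w l y) =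
    e / 2 + e * (x ^+ 2 + y ^+ 2) + 2 * M / eta * (n%:R^-1 + n%:R^-1).
  rewrite (eq_bigr (fun j : 'I_n.+1 => w j x * (e / 2 + e * (x ^+ 2 + y ^+ 2)) +
      2 * M / eta * (w j x * (1 - cos (pi / L * (x - nd j)))) + w j x * (2 * M / eta * n%:R^-1))).
    by rewrite !big_split/= -!mulr_suml !w1 -mulr_sumr c1x; ring.
  move=> j _.
  rewrite (eq_bigr (fun l : 'I_n.+1 => w l y * (w j x * (e / 2 + e * (x ^+ 2 + y ^+ 2)) +
      2 * M / eta * (w j x * (1 - cos (pi / L * (x - nd j))))) +
      w j x * (2 * M / eta) * (w l y * (1 - cos (pi / L * (y - nd l)))))).
    by rewrite big_split/= -mulr_suml w1 -mulr_sumr c1x; ring.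
  by move=> l _; rewrite /B; ring.
have : 2 * M / eta * (n%:R^-1 + n%:R^-1) = 4 * M / eta / n%:R by ring.
lra.
Qed.

End trig_poly_theory.

(** * Weak convergence from trigonometric moments *)

Section Rintegral_extra.
Context d (T : measurableType d) (R : realType).
Implicit Types f g h : T -> R.

Lemma integrable_dom (mu : {measure set T -> \bar R}) f g :
  measurable_fun setT f -> (forall x, `|f x| <= g x) ->
  mu.-integrable setT (EFin \o g) -> mu.-integrable setT (EFin \o f).
Proof.
move=> mf fg; apply: le_integrable => //; first exact/measurable_EFinP.
move=> x _ /=; rewrite lee_fin (le_trans (fg x))//; exact: ler_norm.
Qed.

Lemma integrable_cst (P : probability T R) (k : R) : P.-integrable setT (EFin \o (fun=> k)).
Proof. exact: finite_measure_integrable_cst. Qed.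

Lemma integrable_bounded (P : probability T R) f (M : R) : measurable_fun setT f ->
  (forall x, `|f x| <= M) -> P.-integrable setT (EFin \o f).
Proof.
by move=> mf fM; apply: integrable_dom (integrable_cst P M).
Qed.

Lemma EFin_Rintegral (mu : {measure set T -> \bar R}) f :
  mu.-integrable setT (EFin \o f) -> (\int[mu]_x f x)%:E = (\int[mu]_x (f x)%:E)%E.
Proof.
move=> fi; rewrite /Rintegral fineK//.
exact: (integrable_fin_num _ fi).
Qed.

Lemma Rintegral_prob_cst (P : probability T R) (k : R) : \int[P]_x k = k.
Proof. by rewrite Rintegral_cst//= probability_setT/= mulr1. Qed.

Lemma integrableRD (mu : {measure set T -> \bar R}) f g :
  mu.-integrable setT (EFin \o f) -> mu.-integrable setT (EFin \o g) ->
  mu.-integrable setT (EFin \o (fun x => f x + g x)).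
Proof. by move=> fi gi; exact: (integrableD _ fi gi). Qed.

Lemma integrableRB (mu : {measure set T -> \bar R}) f g :
  mu.-integrable setT (EFin \o f) -> mu.-integrable setT (EFin \o g) ->
  mu.-integrable setT (EFin \o (fun x => f x - g x)).
Proof. by move=> fi gi; exact: (integrableB _ fi gi). Qed.

Lemma integrableRZ (mu : {measure set T -> \bar R}) k f :
  mu.-integrable setT (EFin \o f) -> mu.-integrable setT (EFin \o (fun x => k * f x)).
Proof. by move=> fi; exact: (integrableZl _ k fi). Qed.

Lemma Rintegral_dist_le (mu : {measure set T -> \bar R}) f g h :
  mu.-integrable setT (EFin \o f) -> mu.-integrable setT (EFin \o g) ->
  mu.-integrable setT (EFin \o h) -> (forall x, `|f x - g x| <= h x) ->
  `|\int[mu]_x f x - \int[mu]_x g x| <= \int[mu]_x h x.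
Proof.
move=> intf intg inth fgh.
have intB : mu.-integrable setT (EFin \o (fun x => f x - g x)) by exact: integrableRB.
rewrite -RintegralB// (le_trans (le_normr_Rintegral _ intB))// le_Rintegral//.
apply: integrable_dom inth => //.
  apply: measurableT_comp => //.
  by apply/measurable_EFinP; exact: (measurable_int mu).
by move=> x; rewrite normr_id.
Qed.

Lemma le_norm_Rintegral_prob (P : probability T R) f (M : R) : measurable_fun setT f ->
  (forall x, `|f x| <= M) -> `|\int[P]_x f x| <= M.
Proof.
move=> mf fM; rewrite -[leRHS](Rintegral_prob_cst P) -[\int[P]_x f x]subr0.
rewrite -[X in _ - X](Rintegral_prob_cst P).
apply: Rintegral_dist_le; [exact: (@integrable_bounded _ _ M)|exact: integrable_cst..|].
by move=> x; rewrite subr0.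
Qed.

End Rintegral_extra.

Section cvg_in_dist_trig.
Context {R : realType}.

Lemma measurable_cos_comp d (T : measurableType d) (f : T -> R) :
  measurable_fun setT f -> measurable_fun setT (fun x => cos (f x)).
Proof.
by move=> mf; apply: (measurableT_comp (continuous_measurable_fun (@continuous_cos R))) mf.
Qed.

Lemma measurable_sin_comp d (T : measurableType d) (f : T -> R) :
  measurable_fun setT f -> measurable_fun setT (fun x => sin (f x)).
Proof.
by move=> mf; apply: (measurableT_comp (continuous_measurable_fun (@continuous_sin R))) mf.
Qed.

Lemma trig_poly_measurable (q : R * R -> R) : trig_poly q -> measurable_fun setT q.
Proof.
elim=> {q} [a b c|f g _ mf _ mg|k f _ mf].
- apply: measurable_cos_comp; apply: measurable_funD => //; apply: measurable_funD.
    by apply: measurable_funM => //; exact: measurable_fst.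
  by apply: measurable_funM => //; exact: measurable_snd.
- exact: measurable_funD.
- exact: measurable_funM.
Qed.

Lemma trig_poly_bounded (q : R * R -> R) : trig_poly q -> exists M, forall z, `|q z| <= M.
Proof.
elim=> {q} [a b c|f g _ [M fM] _ [N gN]|k f _ [M fM]].
- by exists 1 => z; exact: cos_max.
- by exists (M + N) => z; rewrite (le_trans (ler_normD _ _))// lerD.
- by exists (`|k| * M) => z; rewrite normrM ler_wpM2l.
Qed.

(** Measurability is meant for the product sigma-algebra of the plane. It is inherited from the
    approximating trigonometric polynomials, which converge pointwise since the weight is fixed at
    each point. *)
Lemma bounded_continuous_measurable (f : R * R -> R) :
  bounded_continuous f -> measurable_fun setT f.
Proof.
move=> bf.
have /choice[q qP] : forall n : nat, exists q, trig_poly q /\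
    forall z, `|f z - q z| <= n.+1%:R^-1 * (1 + z.1 ^+ 2 + z.2 ^+ 2).
  move=> n; have [q tq fq] := trig_poly_approx bf (e := n.+1%:R^-1) ltac:(by rewrite invr_gt0).
  by exists q.
apply: (@measurable_fun_cvg _ _ _ _ q).
  by move=> n; apply: trig_poly_measurable; case: (qP n).
move=> z _; apply/cvgrPdist_le => e e0.
set C := 1 + z.1 ^+ 2 + z.2 ^+ 2.
have C0 : 0 < C by rewrite /C; have := sqr_ge0 z.1; have := sqr_ge0 z.2; lra.
near=> n.
have [_ /(_ z) H] := qP n; rewrite (le_trans H)// -/C -ler_pdivlMr//.
rewrite ltW//; near: n.
exact: (near_infty_natSinv_lt (PosNum (divr_gt0 e0 C0))).
Unshelve. all: by end_near.
Qed.

(** The common bound [C] on second moments integrates the quadratic weight of [trig_poly_approx] to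
    an error uniform in k. It is asked only eventually, because early rows may have empty
    samples. *)
Lemma cvg_in_dist_trig d (T : measurableType d) (P : probability T R)
    (Z : nat -> T -> R * R) (nu : probability (R * R)%type R) (C : R) :
  (forall k, measurable_fun setT (Z k)) ->
  (\forall k \near \oo, P.-integrable setT (fun w => ((Z k w).1 ^+ 2 + (Z k w).2 ^+ 2)%:E) /\
     \int[P]_w ((Z k w).1 ^+ 2 + (Z k w).2 ^+ 2) <= C) ->
  nu.-integrable setT (fun z => (z.1 ^+ 2 + z.2 ^+ 2)%:E) ->
  \int[nu]_z (z.1 ^+ 2 + z.2 ^+ 2) <= C ->
  (forall a b c, \int[P]_w cos (a * (Z k w).1 + b * (Z k w).2 + c) @[k --> \oo] -->
     \int[nu]_z cos (a * z.1 + b * z.2 + c)) ->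
  cvg_in_dist P Z nu id.
Proof.
move=> mZ ZC nui nuC Zcos f bf.
have mf := bounded_continuous_measurable bf.
have [_ [M fM]] := bf.
have mfZ k : measurable_fun setT (f \o Z k) by exact: measurableT_comp.
have fZi k : P.-integrable setT (EFin \o (f \o Z k)).
  by apply: (@integrable_bounded _ _ _ _ _ M) => //= x; exact: fM.
have fi : nu.-integrable setT (EFin \o f).
  exact: (@integrable_bounded _ _ _ _ _ M).
rewrite unlock.
have -> : (\int[nu]_w ((f \o id) w)%:E)%E = (\int[nu]_w f w)%:E.
  by rewrite EFin_Rintegral.
rewrite (_ : (fun n => _) = (fun n => (\int[P]_w f (Z n w))%:E)); last first.
  by apply/funext => n; rewrite EFin_Rintegral//; exact: fZi.
apply/cvg_EFin; first exact: nearW.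
have qcvg q : trig_poly q ->
    \int[P]_w q (Z k w) @[k --> \oo] --> \int[nu]_z q z.
  have int1 g k : trig_poly g -> P.-integrable setT (EFin \o (g \o Z k)).
    move=> tg; have [N gN] := trig_poly_bounded tg.
    apply: (@integrable_bounded _ _ _ _ _ N) => //=.
    by apply: measurableT_comp => //; exact: trig_poly_measurable.
  have int2 g : trig_poly g -> nu.-integrable setT (EFin \o g).
    move=> tg; have [N gN] := trig_poly_bounded tg.
    by apply: (@integrable_bounded _ _ _ _ _ N) => //=; exact: trig_poly_measurable.
  elim=> {q} [a b c|g h tg IHg th IHh|r g tg IHg].
  - exact: Zcos.
  - rewrite RintegralD ?int2//.
    rewrite (_ : (fun k => _) = fun k => \int[P]_w g (Z k w) + \int[P]_w h (Z k w)).
      exact: cvgD.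
    by apply/funext => k; rewrite RintegralD ?int1//; exact: int1.
  - rewrite RintegralZl ?int2//.
    rewrite (_ : (fun k => _) = fun k => r * \int[P]_w g (Z k w)).
      by apply: cvgM => //; exact: cvg_cst.
    by apply/funext => k; rewrite RintegralZl//; exact: int1.
have C0 : 0 <= C.
  by apply: le_trans nuC; apply: Rintegral_ge0 => z _; rewrite addr_ge0// sqr_ge0.
apply/cvgrPdist_le => e e0.
(* The weight 1 + x^2 + y^2 has expectation at most 1 + C, so this precision costs e/3 on each side;
   the last third is for the polynomial itself. *)
have e3 : 0 < e / 3 / (1 + C) by rewrite !divr_gt0// ltr_pwDl.
have [q tq fq] := trig_poly_approx bf e3.
have [N qN] := trig_poly_bounded tq.
have mq := trig_poly_measurable tq.
have bound d' (T' : measurableType d') (Q : probability T' R) (W : T' -> R * R) :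
    measurable_fun setT W ->
    Q.-integrable setT (fun w => ((W w).1 ^+ 2 + (W w).2 ^+ 2)%:E) ->
    \int[Q]_w ((W w).1 ^+ 2 + (W w).2 ^+ 2) <= C ->
    `|\int[Q]_w f (W w) - \int[Q]_w q (W w)| <= e / 3.
  move=> mW Wi WC.
  have h1 : Q.-integrable setT (EFin \o (fun w => 1 + ((W w).1 ^+ 2 + (W w).2 ^+ 2))).
    by apply: integrableRD => //; exact: integrable_cst.
  apply: (@le_trans _ _ (\int[Q]_w (e / 3 / (1 + C) * (1 + ((W w).1 ^+ 2 + (W w).2 ^+ 2))))).
    apply: Rintegral_dist_le.
    - by apply: (@integrable_bounded _ _ _ _ _ M); [exact: measurableT_comp|move=> x; exact: fM].
    - by apply: (@integrable_bounded _ _ _ _ _ N); [exact: measurableT_comp|move=> x; exact: qN].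
    - exact: integrableRZ.
    - by move=> w; rewrite addrA; exact: fq.
  rewrite RintegralZl// RintegralD//; last exact: integrable_cst.
  rewrite Rintegral_prob_cst.
  have C1 : 1 + C != 0 by rewrite gt_eqF// ltr_pwDl.
  by rewrite -[leRHS](divfK C1) ler_wpM2l ?(ltW e3)// lerD2l.
have nuq := bound _ _ nu id (@measurable_id _ _ setT) nui nuC.
near=> k.
have kq : `|\int[P]_w f (Z k w) - \int[P]_w q (Z k w)| <= e / 3.
  apply: bound => //.
    by near: k; move: ZC; apply: filterS => k [].
  by near: k; move: ZC; apply: filterS => k [].
have qq : `|\int[nu]_z q z - \int[P]_w q (Z k w)| <= e / 3.
  by near: k; move/cvgrPdist_le: (qcvg _ tq); apply; rewrite divr_gt0.
apply: le_trans (ler_distD (\int[nu]_z q z) _ _) _.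
apply: le_trans (lerD nuq (ler_distD (\int[P]_w q (Z k w)) _ _)) _.
by rewrite [X in _ + (_ + X)]distrC; lra.
Unshelve. all: by end_near.
Qed.

End cvg_in_dist_trig.

(** * Sums of independent variables *)

Section independence.
Context d (T : measurableType d) (R : realType) (P : probability T R).
Implicit Types (X Y Q : T -> R) (g h : R -> R).

Definition bounded_measurable g := measurable_fun setT g /\ exists M, forall x, `|g x| <= M.

Lemma bounded_measurable_cst c : bounded_measurable (fun=> c).
Proof. by split=> //; exists `|c|. Qed.

Lemma bounded_measurable_cos a : bounded_measurable (fun x => cos (x + a)).
Proof.
split; first by apply: measurable_cos_comp; exact: measurable_funD.
by exists 1 => x; exact: cos_max.
Qed.

Lemma bounded_measurable_sin : bounded_measurable (@sin R).
Proof.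
split; first exact: (measurable_sin_comp (@measurable_id _ _ setT)).
by exists 1 => x; exact: sin_max.
Qed.

Lemma bounded_measurable_indic (B : set R) : measurable B -> bounded_measurable \1_B.
Proof.
move=> mB; split; first exact: measurable_indic.
by exists 1 => x; rewrite indicE; case: (_ \in _); rewrite ?normr1 ?normr0.
Qed.

Lemma measurable_bcomp g X : bounded_measurable g -> measurable_fun setT X ->
  measurable_fun setT (fun w => g (X w)).
Proof. by move=> [mg _] mX; exact: measurableT_comp. Qed.

Lemma integrable_bcomp g X : bounded_measurable g -> measurable_fun setT X ->
  P.-integrable setT (EFin \o (fun w => g (X w))).
Proof.
move=> bg mX; have mgX := measurable_bcomp bg mX.
by have [_ [M gM]] := bg; exact: (@integrable_bounded _ _ _ P _ M).
Qed.

(** The sum counts the integers among 1, ..., n that do not exceed [y]: it is the integer part of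
    [y]. *)
Lemma layer_cake_approx n (y : R) : 0 <= y <= n%:R ->
  0 <= y - \sum_(k < n) (k.+1%:R <= y)%R%:R <= 1.
Proof.
elim: n => [|n IH] /andP[y0 yn].
  by rewrite big_ord0; move: yn; rewrite subr0; lra.
rewrite big_ord_recr/=; have [ny|ny] := leP y n%:R.
  suff -> : (n.+1%:R <= y) = false by rewrite addr0; apply: IH; rewrite y0 ny.
  by apply/negbTE; rewrite -ltNge (le_lt_trans ny)// ltr_nat.
rewrite (eq_bigr (fun=> 1)); last first.
  move=> k _; have -> : k.+1%:R <= y.
    by apply: le_trans (ltW ny); rewrite ler_nat.
  by [].
rewrite sumr_const card_ord; have n1 : n.+1%:R = n%:R + 1 :> R by rewrite natr1.
move: n1 yn ny; move: (n%:R : R) (n.+1%:R : R) => a b n1 yn ny.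
by have [h|h] := leP b y; rewrite ?mulr1n ?mulr0n; lra.
Qed.

(** A function with values in [0, 1] is uniformly within 1/n of the average of the indicators of
    [n g >= k+1], k < n. Both sides are linear in [g], and their difference changes by at most K +
    |c| times a uniform change of [g]. *)
Lemma Rintegral_mul_ext X Q (K c : R) :
  measurable_fun setT X -> measurable_fun setT Q -> (forall w, `|Q w| <= K) ->
  (forall B, measurable B ->
     \int[P]_w (\1_B (X w) * Q w) = \int[P]_w \1_B (X w) * c) ->
  forall g, bounded_measurable g -> \int[P]_w (g (X w) * Q w) = \int[P]_w g (X w) * c.
Proof.
move=> mX mQ QK indic.
have K0 : 0 <= K by apply: le_trans (QK point).
have intQ g : bounded_measurable g -> P.-integrable setT (EFin \o (fun w => g (X w) * Q w)).
  move=> bg; have [_ [M gM]] := bg.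
  apply: (@integrable_bounded _ _ _ P _ (M * K)).
    by apply: measurable_funM => //; exact: measurable_bcomp.
  by move=> w; rewrite normrM ler_pM.
(* General [g] is an affine image of such a function; the constant this adds is handled by the
   hypothesis for the whole line, which says that [Q] has mean [c]. *)
suff main g : measurable_fun setT g -> (forall x, 0 <= g x <= 1) ->
    \int[P]_w (g (X w) * Q w) = \int[P]_w g (X w) * c.
  move=> g bg; have [mg [M' gM']] := bg.
  pose M := Num.max 1 M'.
  have M0 : 0 < M by rewrite lt_max ltr01.
  have gM x : `|g x| <= M by rewrite (le_trans (gM' x))// le_max lexx orbT.
  pose h x := (g x + M) / (M *+ 2).
  have M20 : 0 < M *+ 2 by rewrite mulrn_wgt0.
  have bh : bounded_measurable h.
    split; first by apply: measurable_funM => //; exact: measurable_funD.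
    exists 1 => x; have := gM x; rewrite ler_norml => /andP[g1 g2].
    rewrite ger0_norm ?ler_pdivrMr ?divr_ge0 ?(ltW M20)//; lra.
  have hc : \int[P]_w (h (X w) * Q w) = \int[P]_w h (X w) * c.
    apply: main bh.1 _ => x; have := gM x; rewrite ler_norml => /andP[g1 g2].
    by rewrite divr_ge0 ?ler_pdivrMr ?(ltW M20)//=; lra.
  have gh x : g x = (M *+ 2) * h x - M by rewrite /h mulrC divfK ?gt_eqF//; ring.
  have Qi : P.-integrable setT (EFin \o Q) by exact: (@integrable_bounded _ _ _ P _ K).
  have Qc : \int[P]_w Q w = c.
    have := indic setT measurableT; under eq_Rintegral do rewrite indicT mul1r.
    by move=> ->; under eq_Rintegral do rewrite indicT; rewrite Rintegral_prob_cst mul1r.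
  under eq_Rintegral do rewrite gh mulrBl -mulrA.
  rewrite RintegralB//; last 2 first.
    by apply: integrableRZ; exact: intQ.
    exact: integrableRZ.
  rewrite !RintegralZl//; last exact: intQ.
  rewrite hc Qc; under [in RHS]eq_Rintegral do rewrite gh.
  rewrite RintegralB//; last 2 first.
    by apply: integrableRZ; exact: integrable_bcomp.
    exact: integrable_cst.
  by rewrite RintegralZl ?Rintegral_prob_cst//; [ring|exact: integrable_bcomp].
move=> mg g01.
have bg : bounded_measurable g.
  by split => //; exists 1 => x; have /andP[? ?] := g01 x; rewrite ger0_norm.
apply/eqP; rewrite -subr_eq0 -normr_le0; apply/ler_addgt0Pr => e e0; rewrite add0r.
pose n := (Num.bound ((K + `|c|) / e)).+1.
have n0 : 0 < n%:R :> R by rewrite ltr0n.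
have nP : (K + `|c|) / n%:R <= e.
  rewrite ler_pdivrMr// -ler_pdivrMl// mulrC ltW//.
  apply: lt_trans (archi_boundP _) _; first by rewrite divr_ge0 ?(ltW e0)// addr_ge0.
  by rewrite ltr_nat.
pose B k := [set x | k.+1%:R <= n%:R * g x].
have mB k : measurable (B k).
  rewrite -[B k]setTI; apply: (measurable_fun_le (f := fun=> k.+1%:R)) => //.
  exact: measurable_funM.
pose gn x : R := \sum_(k < n) n%:R^-1 * \1_(B k) x.
have bgn : bounded_measurable gn.
  split; first by apply: measurable_sum => k; apply: measurable_funM => //; exact: measurable_indic.
  exists (\sum_(k < n) n%:R^-1) => x; apply: le_trans (ler_norm_sum _ _ _) _; apply: ler_sum => k _.
  rewrite normrM (@ger0_norm _ n%:R^-1) ?invr_ge0 ?(ltW n0)// ler_piMr ?invr_ge0 ?(ltW n0)//.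
  by rewrite indicE; case: (_ \in _); rewrite ?normr1 ?normr0.
have ggn x : `|g x - gn x| <= n%:R^-1.
  have := @layer_cake_approx n (n%:R * g x).
  have /andP[g0 g1] := g01 x.
  rewrite mulr_ge0 ?(ltW n0)//= ler_piMr ?(ltW n0)// => /(_ isT).
  have -> : gn x = n%:R^-1 * \sum_(k < n) (k.+1%:R <= n%:R * g x)%R%:R.
    rewrite mulr_sumr; apply: eq_bigr => k _; rewrite indicE.
    by congr (_ * (nat_of_bool _)%:R); apply/idP/idP; rewrite inE.
  set S := \sum_(_ < _) _ => /andP[h1 h2].
  have -> : g x - n%:R^-1 * S = n%:R^-1 * (n%:R * g x - S) by field; rewrite gt_eqF.
  by rewrite normrM !ger0_norm ?invr_ge0 ?(ltW n0)// ler_piMr// invr_ge0 ltW.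
have gnc : \int[P]_w (gn (X w) * Q w) = \int[P]_w gn (X w) * c.
  have bt k : bounded_measurable (fun x => n%:R^-1 * \1_(B k) x).
    split; first by apply: measurable_funM => //; exact: measurable_indic.
    exists (n%:R^-1) => x.
    rewrite normrM (@ger0_norm _ n%:R^-1) ?invr_ge0 ?(ltW n0)// ler_piMr ?invr_ge0 ?(ltW n0)//.
    by rewrite indicE; case: (_ \in _); rewrite ?normr1 ?normr0.
  have term k : \int[P]_w (n%:R^-1 * \1_(B k) (X w) * Q w) = \int[P]_w (n%:R^-1 * \1_(B k) (X w)) * c.
    under eq_Rintegral do rewrite -mulrA.
    have bi := bounded_measurable_indic (mB k).
    rewrite !RintegralZl ?indic ?mulrA//; [exact: integrable_bcomp|exact: intQ].
  have bs m : bounded_measurable (fun x => \sum_(k < m) n%:R^-1 * \1_(B k) x).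
    split; first by apply: measurable_sum => k; exact: (bt k).1.
    exists (\sum_(k < m) n%:R^-1) => x; apply: le_trans (ler_norm_sum _ _ _) _; apply: ler_sum => k _.
    rewrite normrM (@ger0_norm _ n%:R^-1) ?invr_ge0 ?(ltW n0)// ler_piMr ?invr_ge0 ?(ltW n0)//.
    by rewrite indicE; case: (_ \in _); rewrite ?normr1 ?normr0.
  (* The number of summands is separated from the [n] in the coefficients so that induction can run
     on it alone. *)
  suff sums m : \int[P]_w ((\sum_(k < m) n%:R^-1 * \1_(B k) (X w)) * Q w) =
      \int[P]_w (\sum_(k < m) n%:R^-1 * \1_(B k) (X w)) * c by exact: sums.
  elim: m => [|m IH].
    under eq_Rintegral do rewrite big_ord0 mul0r.
    by under [in RHS]eq_Rintegral do rewrite big_ord0; rewrite !Rintegral_prob_cst mul0r.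
  under eq_Rintegral do rewrite big_ord_recr/= mulrDl.
  under [in RHS]eq_Rintegral do rewrite big_ord_recr/=.
  rewrite !RintegralD//.
  - by rewrite IH term mulrDl.
  - exact: (integrable_bcomp (bs m)).
  - exact: (integrable_bcomp (bt m)).
  - exact: (intQ _ (bs m)).
  - exact: (intQ _ (bt m)).
have -> : \int[P]_w (g (X w) * Q w) - \int[P]_w g (X w) * c =
    (\int[P]_w (g (X w) * Q w) - \int[P]_w (gn (X w) * Q w)) -
    (\int[P]_w g (X w) - \int[P]_w gn (X w)) * c by rewrite gnc; ring.
apply: le_trans (ler_normB _ _) _; apply: le_trans nP; rewrite [leRHS]mulrDl; apply: lerD.
  rewrite -[leRHS](Rintegral_prob_cst P); apply: Rintegral_dist_le.
  - exact: intQ.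
  - exact: intQ.
  - exact: integrable_cst.
  - by move=> w; rewrite -mulrBl normrM mulrC ler_pM.
rewrite normrM mulrC ler_wpM2l// -[leRHS](Rintegral_prob_cst P).
apply: Rintegral_dist_le => //.
- exact: integrable_bcomp.
- exact: integrable_bcomp.
- exact: integrable_cst.
Qed.

End independence.

Section independent_products.
Context d (T : measurableType d) (R : realType) (P : probability T R).
Variable xi : nat -> T -> R.
Hypothesis mxi : forall i, measurable_fun setT (xi i).
Implicit Types (g h : R -> R) (G : nat -> R -> R).

Lemma bounded_measurable_prod G (r : seq nat) (p : pred nat) :
  (forall i, bounded_measurable (G i)) ->
  measurable_fun setT (fun w => \prod_(i <- r | p i) G i (xi i w)) /\
  exists M, forall w, `|\prod_(i <- r | p i) G i (xi i w)| <= M.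
Proof.
move=> bG; split.
  under eq_fun do rewrite big_mkcond.
  apply: measurable_prod => i _; case: (p i) => //; exact: measurable_bcomp.
have /choice[M GM] : forall i, exists M, forall x, `|G i x| <= M.
  by move=> i; exact: (bG i).2.
exists (\prod_(i <- r | p i) M i) => w; rewrite normr_prod.
by apply: ler_prod => i _; rewrite normr_ge0 GM.
Qed.

(** Initial segments of indices suffice: an index is left out by choosing the whole line for its
    set. *)
Definition indic_independent := forall n (B : nat -> set R),
  (forall i, measurable (B i)) ->
  \int[P]_w (\prod_(i < n) \1_(B i) (xi i w)) = \prod_(i < n) \int[P]_w \1_(B i) (xi i w).

Lemma mutually_independent_indic (H : nat -> set (set T)) :
  mutually_independent P H ->
  (forall i B, measurable B -> H i (xi i @^-1` B)) -> indic_independent.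
Proof.
move=> indep Hxi n B mB.
pose E i := xi i @^-1` B i.
have mE i : measurable (E i) by rewrite -[E i]setTI; exact: mxi.
pose J : {fset nat} := [fset i in iota 0 n]%fset.
have JE i : (i \in J) = (i < n)%N by rewrite !inE mem_iota.
have indE (A : set T) : measurable A -> \int[P]_w \1_A w = fine (P A).
  by move=> mA; rewrite /Rintegral integral_indic// setIT.
have := indep J E (fun i _ => Hxi i (B i) (mB i)).
have -> : \bigcap_(i in [set` J]) E i = \bigcap_(i < n) E i.
  by apply/seteqP; split => w Ew i /=; have := Ew i => /=; rewrite JE.
have -> : (\prod_(i <- J) P (E i) = \prod_(i < n) P (E i))%E.
  rewrite -(big_mkord xpredT (fun i => P (E i))).
  apply: perm_big; apply: uniq_perm; rewrite ?iota_uniq ?fset_uniq// => i.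
  by rewrite JE mem_index_iota.
move=> PE; transitivity (fine (P (\bigcap_(i < n) E i))).
  rewrite -indE; last by apply: bigcap_measurableType => i _.
  apply: eq_Rintegral => w _; rewrite indicE.
  case: (boolP (w \in \bigcap_(i < n) E i)) => [/set_mem|]; [move=> Ew|rewrite notin_setE => Ew].
    by rewrite big1// => i _; rewrite indicE (mem_set (Ew i (ltn_ord i) : B i (xi i w))).
  have /existsNP[i /not_implyP[ni nE]] : ~ (forall i, (i < n)%N -> E i w) by exact: Ew.
  by rewrite (bigD1 (Ordinal ni))//= indicE (memNset (nE : ~ B i (xi i w))) mul0r.
rewrite PE (eq_bigr (fun i : 'I_n => (fine (P (E i)))%:E)); last first.
  by move=> i _; rewrite fineK// fin_num_measure.
rewrite prodEFin/=; by apply: eq_bigr => i _; rewrite -indE.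
Qed.

(** Indicators are replaced by bounded functions one index at a time. At each replacement the
    product of the other factors is the fixed factor [Q] of [Rintegral_mul_ext]. *)
Lemma Rintegral_prod_independent n G : indic_independent ->
  (forall i, bounded_measurable (G i)) ->
  \int[P]_w (\prod_(i < n) G i (xi i w)) = \prod_(i < n) \int[P]_w G i (xi i w).
Proof.
move=> indic.
suff main m : forall G, (forall i, bounded_measurable (G i)) ->
    (forall i, (m <= i)%N -> exists2 B, measurable B & G i = \1_B) ->
    \int[P]_w (\prod_(i < n) G i (xi i w)) = \prod_(i < n) \int[P]_w G i (xi i w).
  (* Factors beyond the product are reset to an indicator, so that the induction may start with m =
     n general factors. *)
  move=> bG; pose G' i := if (i < n)%N then G i else \1_(setT : set R).
  have -> : \prod_(i < n) \int[P]_w G i (xi i w) = \prod_(i < n) \int[P]_w G' i (xi i w).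
    by apply: eq_bigr => i _; rewrite /G' ltn_ord.
  under eq_Rintegral => w _.
    rewrite (eq_bigr (fun i : 'I_n => G' i (xi i w))); last first.
      by move=> i _; rewrite /G' ltn_ord.
    over.
  apply: (main n).
    by move=> i; rewrite /G'; case: ifP => // _; exact: bounded_measurable_indic.
  by move=> i ni; rewrite /G' ltnNge ni /=; exists setT.
elim: m => [|m IH] {}G bG GB.
  have /choice[B BG] : forall i, exists B, measurable B /\ G i = \1_B.
    by move=> i; have [B mB GE] := GB i isT; exists B.
  have := indic n B (fun i => (BG i).1).
  under eq_Rintegral => w _ do under eq_bigr => i _ do rewrite -(BG i).2.
  by under [in RHS]eq_bigr => i _ do rewrite -(BG i).2.
pose G' g i := if i == m then g else G i.
have IH' B : measurable B ->
    \int[P]_w (\prod_(i < n) G' \1_B i (xi i w)) = \prod_(i < n) \int[P]_w G' \1_B i (xi i w).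
  move=> mB; apply: IH => i.
    by rewrite /G'; case: ifP => // _; exact: bounded_measurable_indic.
  rewrite /G'; case: eqP => [_ _|/eqP im mi]; first by exists B.
  by apply: GB; rewrite ltn_neqAle eq_sym im.
have [nm|mn] := leqP n m.
  have := IH' setT measurableT.
  have G'E (i : 'I_n) g : G' g i = G i.
    by rewrite /G' ifF//; apply/negbTE; have := ltn_ord i; lia.
  under eq_Rintegral => w _ do under eq_bigr => i _ do rewrite G'E.
  by under [in RHS]eq_bigr => i _ do rewrite G'E.
have splitL g w : \prod_(i < n) G' g i (xi i w) =
    g (xi m w) * \prod_(i < n | (i != m :> nat)) G i (xi i w).
  rewrite (bigD1 (Ordinal mn))//= /G' eqxx; congr (_ * _).
  by apply: eq_big => [i|i im]; rewrite -?val_eqE//= ifN.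
have splitR g : \prod_(i < n) \int[P]_w G' g i (xi i w) =
    \int[P]_w g (xi m w) * \prod_(i < n | (i != m :> nat)) \int[P]_w G i (xi i w).
  rewrite (bigD1 (Ordinal mn))//= /G' eqxx; congr (_ * _).
  by apply: eq_big => [i|i im]; rewrite -?val_eqE//= ifN.
have GG' i : G i = G' (G m) i by rewrite /G'; case: eqP => // ->.
under eq_Rintegral => w _ do under eq_bigr => i _ do rewrite GG'.
under [in RHS]eq_bigr => i _ do rewrite GG'.
rewrite splitR; under eq_Rintegral => w _ do rewrite splitL.
have [mQ [K QK]] := bounded_measurable_prod (index_iota 0 n) (fun i => i != m) bG.
have QE w : \prod_(i < n | (i != m :> nat)) G i (xi i w) =
    \prod_(i <- index_iota 0 n | i != m) G i (xi i w).
  by rewrite (big_mkord (fun i => i != m) (fun i => G i (xi i w))).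
under eq_Rintegral => w _ do rewrite QE.
apply: (Rintegral_mul_ext (mxi m) mQ QK) => // B mB.
rewrite -splitR -IH'//; apply: eq_Rintegral => w _.
by rewrite splitL QE.
Qed.

Lemma Rintegral_pair_independent i j g h : indic_independent -> i != j ->
  bounded_measurable g -> bounded_measurable h ->
  \int[P]_w (g (xi i w) * h (xi j w)) = \int[P]_w g (xi i w) * \int[P]_w h (xi j w).
Proof.
move=> indic ij bg bh.
pose G l := if l == i then g else if l == j then h else fun=> 1.
have bG l : bounded_measurable (G l).
  by rewrite /G; case: ifP => // _; case: ifP => // _; exact: bounded_measurable_cst.
have split (F : (R -> R) -> nat -> R) : (forall l, F (fun=> 1) l = 1) ->
    \prod_(l < (maxn i j).+1) F (G l) l = F g i * F h j.
  move=> F1.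
  have iM : (i < (maxn i j).+1)%N by rewrite ltnS leq_maxl.
  have jM : (j < (maxn i j).+1)%N by rewrite ltnS leq_maxr.
  rewrite (bigD1 (Ordinal iM))//= (bigD1 (Ordinal jM))/=; last first.
    by rewrite -val_eqE/= eq_sym.
  rewrite big1 ?mulr1; last first.
    by move=> l /andP[]; rewrite -!val_eqE/= /G => /negbTE -> /negbTE ->.
  by rewrite /G !eqxx eq_sym (negbTE ij).
have := @Rintegral_prod_independent (maxn i j).+1 G indic bG.
rewrite (split (fun g l => \int[P]_w g (xi l w))); last first.
  by move=> l; rewrite Rintegral_prob_cst.
by under eq_Rintegral => w _ do rewrite (split (fun g l => g (xi l w)))//.
Qed.

Let W m w := \sum_(i < m) xi i w.

Let mW m : measurable_fun setT (W m).
Proof. by apply: measurable_sum. Qed.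

Let intprod (Y : T -> R) (Q : T -> R) K : measurable_fun setT Y -> measurable_fun setT Q ->
  (forall w, `|Q w| <= K) -> forall g, bounded_measurable g ->
  P.-integrable setT (EFin \o (fun w => g (Y w) * Q w)).
Proof.
move=> mY mQ QK g bg; have [_ [M gM]] := bg.
apply: (@integrable_bounded _ _ _ P _ (M * K)).
  by apply: measurable_funM => //; exact: measurable_bcomp.
by move=> w; rewrite normrM ler_pM.
Qed.

(** Independence of the partial sum [W m] from later variables, tested on cosines. The addition
    formula takes the last variable out of the sum, and its sine or cosine becomes one more factor
    of the product, so the induction is on the length of the sum. *)
Lemma Rintegral_cos_sum_prod m n th G : indic_independent ->
  (forall i, bounded_measurable (G i)) -> (m <= n)%N ->
  \int[P]_w (cos (W m w + th) * \prod_(m <= i < n) G i (xi i w)) =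
  \int[P]_w cos (W m w + th) * \prod_(m <= i < n) \int[P]_w G i (xi i w).
Proof.
move=> indic; elim: m n th G => [|m IH] n th G bG mn.
  rewrite /W; under eq_Rintegral do rewrite big_ord0 add0r big_mkord.
  under [in RHS]eq_Rintegral do rewrite big_ord0 add0r.
  rewrite RintegralZl// ?Rintegral_prob_cst.
    by rewrite big_mkord Rintegral_prod_independent.
  have [mQ [K QK]] := bounded_measurable_prod (index_iota 0 n) xpredT bG.
  under eq_fun do rewrite -(big_mkord xpredT (fun i => G i (xi i _))).
  exact: (@integrable_bounded _ _ _ P _ K).
pose up g i := if i == m then g else G i.
have bup g : bounded_measurable g -> forall i, bounded_measurable (up g i).
  by move=> bg i; rewrite /up; case: ifP.
have bcos : bounded_measurable (@cos R).
  by have := @bounded_measurable_cos R 0; under eq_fun do rewrite addr0.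
have bsin := @bounded_measurable_sin R.
have upE g (F : (R -> R) -> nat -> R) :
    \prod_(m <= i < n) F (up g i) i = F g m * \prod_(m.+1 <= i < n) F (G i) i.
  rewrite big_ltn// /up eqxx; congr (_ * _); apply: eq_big_nat => i /andP[mi _].
  by rewrite gtn_eqF.
have [mQ [K QK]] := bounded_measurable_prod (index_iota m.+1 n) xpredT bG.
have step th' g : bounded_measurable g ->
    \int[P]_w (cos (W m w + th') * (g (xi m w) * \prod_(m.+1 <= i < n) G i (xi i w))) =
    \int[P]_w cos (W m w + th') * \int[P]_w g (xi m w)
      * \prod_(m.+1 <= i < n) \int[P]_w G i (xi i w).
  move=> bg; have := IH n th' (up g) (bup g bg) (ltnW mn).
  rewrite (upE g (fun g i => \int[P]_w g (xi i w))) mulrA => <-.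
  by apply: eq_Rintegral => w _; rewrite (upE g (fun g i => g (xi i w))).
(* The sine of the partial sum is written as a cosine with phase th - pi/2, which the induction
   hypothesis covers because it holds for every phase. *)
have Q1 w : cos (W m.+1 w + th) =
    cos (W m w + th) * cos (xi m w) - cos (W m w + (th - pi / 2)) * sin (xi m w).
  rewrite (_ : W m w + (th - pi / 2) = (W m w + th) - pi / 2) ?cosBpihalf; last by ring.
  by rewrite -cosD /W big_ord_recr/=; congr cos; ring.
have bcosW th' : measurable_fun setT (fun w => cos (W m w + th')).
  by apply: measurable_cos_comp; exact: measurable_funD.
have int0 th' g : bounded_measurable g ->
    P.-integrable setT (EFin \o (fun w => cos (W m w + th') * g (xi m w))).
  move=> bg; have [_ [N gN]] := bg.
  apply: (@intprod (W m) (fun w => g (xi m w)) N) (bounded_measurable_cos th') => //.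
  exact: measurable_bcomp.
have intQ th' g : bounded_measurable g ->
    P.-integrable setT (EFin \o (fun w => cos (W m w + th') * (g (xi m w) *
      \prod_(m.+1 <= i < n) G i (xi i w)))).
  move=> bg; have [_ [N gN]] := bg.
  apply: (@intprod (W m) (fun w => g (xi m w) * _) (N * K)) (bounded_measurable_cos th') => //.
    by apply: measurable_funM => //; exact: measurable_bcomp.
  by move=> w; rewrite normrM ler_pM.
have step1 th' g : bounded_measurable g ->
    \int[P]_w (cos (W m w + th') * g (xi m w)) =
    \int[P]_w cos (W m w + th') * \int[P]_w g (xi m w).
  move=> bg; have := IH m.+1 th' (up g) (bup g bg) (leqnSn m).
  rewrite big_nat1 /up eqxx => <-; apply: eq_Rintegral => w _.
  by rewrite big_nat1 eqxx.
under eq_Rintegral do rewrite Q1 mulrBl -!mulrA.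
rewrite RintegralB//; [|exact: intQ|exact: intQ].
rewrite !step//; under [in RHS]eq_Rintegral do rewrite Q1.
rewrite RintegralB//; [|exact: int0|exact: int0].
by rewrite !step1// mulrBl.
Qed.

(* Lindeberg's replacement argument at the level of characteristic functions;
   the phase th covers sine and cosine at once. *)
Lemma Rintegral_cos_sum_dist n th (psi dlt : nat -> R) : indic_independent ->
  (forall i, `|psi i| <= 1) ->
  (forall i, (i < n)%N -> `|\int[P]_w cos (xi i w) - psi i| + `|\int[P]_w sin (xi i w)| <= dlt i) ->
  `|\int[P]_w cos (\sum_(i < n) xi i w + th) - (\prod_(i < n) psi i) * cos th|
    <= \sum_(i < n) dlt i.
Proof.
move=> indic psi1.
have bcos : bounded_measurable (@cos R).
  by have := @bounded_measurable_cos R 0; under eq_fun do rewrite addr0.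
have bsin := @bounded_measurable_sin R.
have step1 m th' g : bounded_measurable g ->
    \int[P]_w (cos (W m w + th') * g (xi m w)) =
    \int[P]_w cos (W m w + th') * \int[P]_w g (xi m w).
  move=> bg; have := @Rintegral_cos_sum_prod m m.+1 th' (fun=> g) indic (fun=> bg) (leqnSn m).
  rewrite big_nat1 => <-; apply: eq_Rintegral => w _.
  by rewrite big_nat1.
elim: n th => [|m IH] th psid.
  rewrite !big_ord0 mul1r; under eq_Rintegral do rewrite big_ord0 add0r.
  by rewrite Rintegral_prob_cst subrr normr0.
have int0 th' g : bounded_measurable g ->
    P.-integrable setT (EFin \o (fun w => cos (W m w + th') * g (xi m w))).
  move=> bg; have [_ [N gN]] := bg.
  apply: (@intprod (W m) (fun w => g (xi m w)) N) (bounded_measurable_cos th') => //.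
  exact: measurable_bcomp.
under eq_Rintegral => w _.
  rewrite big_ord_recr/= (_ : cos _ =
    cos (W m w + th) * cos (xi m w) - cos (W m w + (th - pi / 2)) * sin (xi m w)).
    over.
  rewrite (_ : W m w + (th - pi / 2) = (W m w + th) - pi / 2) ?cosBpihalf; last by ring.
  by rewrite -cosD /W; congr cos; ring.
rewrite RintegralB//; [|exact: int0|exact: int0].
rewrite !step1// !big_ord_recr/=.
have := IH th (fun i im => psid i (ltnW im)).
have := psid m (ltnSn m).
have cW th' : `|\int[P]_w cos (W m w + th')| <= 1.
  apply: le_norm_Rintegral_prob => [|w]; last exact: cos_max.
  by apply: measurable_cos_comp; exact: measurable_funD.
rewrite -/(W m _).
set A := \int[P]_w cos (W m w + th); set B := \int[P]_w cos (W m w + (th - pi / 2)).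
set c := \int[P]_w cos _; set s := \int[P]_w sin _.
set S := \sum_(_ < _) _; set p := \prod_(_ < _) _ => h1 h2.
(* One replacement. The reference variable is symmetric, with no sine part, so the mean sine of the
   original counts wholly as error; [A], [B] and [psi m] are at most 1 in modulus. *)
rewrite (_ : _ - _ = A * (c - psi m) + (A - p * cos th) * psi m - B * s); last by ring.
apply: le_trans (ler_normB _ _) _; apply: le_trans (lerD (ler_normD _ _) (lexx _)) _.
rewrite !normrM addrAC [leRHS]addrC lerD//.
  apply: le_trans h1; rewrite lerD// ler_piMl// ; exact: cW.
by apply: le_trans h2; rewrite ler_piMr.
Qed.

End independent_products.

(** * Taylor bounds for sine and cosine *)

Section sin_cos_taylor.
Context {R : realType}.
Implicit Types x : R.

Lemma ge0_of_derive (f df : R -> R) : (forall x, is_derive x (1 : R) f (df x)) ->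
  0 <= f 0 -> (forall x, 0 <= x -> 0 <= df x) -> forall x, 0 <= x -> 0 <= f x.
Proof.
move=> fd f0 df0 x x0.
have cf : continuous f.
  move=> y; apply: differentiable_continuous; rewrite -derivable1_diffP.
  exact: ex_derive.
have [c /andP[c0 _] fE] := MVT_segment x0 (fun y _ => fd y) (continuous_subspaceT cf).
have -> : f x = f 0 + df c * (x - 0) by rewrite -fE; ring.
by rewrite addr_ge0// mulr_ge0 ?df0// subr0.
Qed.

Lemma sin_le x : 0 <= x -> 0 <= x - sin x.
Proof.
have fd y : is_derive y (1 : R) (fun x => x - sin x) ((fun x => 1 - cos x) y).
  by apply: is_derive_eq; rewrite /GRing.scale/=; ring.
apply: (ge0_of_derive fd).
- by rewrite /= sin0 subrr.
- by move=> y _; rewrite subr_ge0 cos_le1.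
Qed.

Lemma cos_ge_taylor2 x : 0 <= x -> 0 <= cos x - 1 + x ^+ 2 / 2.
Proof.
have fd y : is_derive y (1 : R) (fun x => cos x - 1 + x ^+ 2 / 2) ((fun x => x - sin x) y).
  by apply: is_derive_eq; rewrite /GRing.scale/=; field.
apply: (ge0_of_derive fd).
- by rewrite cos0 expr0n/= mul0r; lra.
- exact: sin_le.
Qed.

Lemma sin_ge_taylor3 x : 0 <= x -> 0 <= sin x - x + x ^+ 3 / 6.
Proof.
have fd y : is_derive y (1 : R) (fun x => sin x - x + x ^+ 3 / 6)
    ((fun x => cos x - 1 + x ^+ 2 / 2) y).
  by apply: is_derive_eq; rewrite /GRing.scale/=; field.
apply: (ge0_of_derive fd).
- by rewrite sin0 expr0n/= mul0r; lra.
- exact: cos_ge_taylor2.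
Qed.

Lemma cos_le_taylor4 x : 0 <= x -> 0 <= x ^+ 4 / 24 - x ^+ 2 / 2 + 1 - cos x.
Proof.
have fd y : is_derive y (1 : R) (fun x => x ^+ 4 / 24 - x ^+ 2 / 2 + 1 - cos x)
    ((fun x => sin x - x + x ^+ 3 / 6) y).
  by apply: is_derive_eq; rewrite /GRing.scale/=; field.
apply: (ge0_of_derive fd).
- by rewrite cos0 !expr0n/= !mul0r; lra.
- exact: sin_ge_taylor3.
Qed.

Lemma cos_taylor x : `|cos x - (1 - x ^+ 2 / 2)| <= x ^+ 4 / 24.
Proof.
have x4 : `|x| ^+ 4 = x ^+ 4 by rewrite -normrX ger0_norm// exprn_even_ge0.
have x2 : `|x| ^+ 2 = x ^+ 2 by rewrite real_normK// num_real.
have := cos_ge_taylor2 (normr_ge0 x); have := cos_le_taylor4 (normr_ge0 x).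
by rewrite x4 x2 cos_norm ler_norml; lra.
Qed.

Lemma sin_taylor x : `|sin x - x| <= `|x| ^+ 3 / 6.
Proof.
wlog x0 : x / 0 <= x.
  move=> H; have [/H//|x0] := leP 0 x.
  have := H (- x); rewrite oppr_ge0 ltW// => /(_ isT).
  by rewrite sinN -opprB opprK normrN normrN addrC; apply: le_trans; rewrite distrC.
have := sin_le x0; have := sin_ge_taylor3 x0.
by rewrite (ger0_norm x0) ler_norml; lra.
Qed.

(* The cubic remainder is traded for second and fourth moments. *)
Lemma sin_taylor24 (dl x : R) : 0 < dl -> `|sin x - x| <= dl * x ^+ 2 + x ^+ 4 / dl.
Proof.
move=> dl0; apply: le_trans (sin_taylor x) _.
have x4 : `|x| ^+ 4 = x ^+ 4 by rewrite -normrX ger0_norm// exprn_even_ge0.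
have x2 : `|x| ^+ 2 = x ^+ 2 by rewrite real_normK// num_real.
rewrite -x4 -x2; set y := `|x|.
have y0 : 0 <= y by exact: normr_ge0.
(* Expanding this square gives 2y^3 <= dl y^2 + y^4/dl. *)
have : 0 <= (y * (dl - y)) ^+ 2 / dl by rewrite divr_ge0 ?sqr_ge0// ltW.
rewrite (_ : _ / dl = dl * y ^+ 2 + y ^+ 4 / dl - 2 * y ^+ 3); last first.
  by field; rewrite gt_eqF.
have y3 : 0 <= y ^+ 3 by exact: exprn_ge0.
lra.
Qed.

End sin_cos_taylor.

(** * Normal laws *)

Section normal_laws.
Context {R : realType}.
Local Notation leb := (@lebesgue_measure R).

Lemma probability_eq_itv (P Q : probability (measurableTypeR R) R) :
  (forall t, P `]-oo, t]%classic = Q `]-oo, t]%classic) ->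
  forall A, measurable A -> P A = Q A.
Proof.
move=> PQ A mA.
move: A mA; apply: (@measure_unique _ R (measurableTypeR R) (@RGenOInfty.G R)
  (fun k : nat => `]- k%:R, +oo[%classic)).
- exact: RGenOInfty.measurableE.
- move=> _ _ [x ->] [y ->]; exists (Num.max x y); apply/seteqP; split => z /=.
    by rewrite !in_itv/= !andbT gt_max => -[-> ->].
  by rewrite !in_itv/= !andbT gt_max => /andP[-> ->].
- by move=> k; exists (- k%:R).
- rewrite -subTset => x _; exists (Num.bound `|x|) => //=.
  rewrite in_itv/= andbT ltrNl; apply: le_lt_trans (archi_boundP (normr_ge0 x)).
  by rewrite -normrN ler_norm.
- move=> _ [x ->]; rewrite -setCitvl.
  have mx : measurable (`]-oo, x]%classic : set (measurableTypeR R)) by [].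
  have Qx := probability_setC Q mx; rewrite -PQ in Qx.
  exact: etrans (probability_setC P mx) (esym Qx).
- by move=> k; rewrite (le_lt_trans (probability_le1 _ _)) ?ltry.
Qed.

Import HBNNSimple.

(** [normal_prob] is defined on sets, as an integral of its density. Monotone convergence along
    simple functions carries this over to nonnegative integrands. *)
Lemma ge0_integral_normal_prob (m s : R) (f : measurableTypeR R -> \bar R) :
  measurable_fun setT f -> (forall x, 0 <= f x)%E ->
  (\int[normal_prob m s]_x f x = \int[leb]_x (f x * (normal_pdf m s x)%:E))%E.
Proof.
move=> mf f0.
have mpdf : measurable_fun setT (EFin \o (normal_pdf m s)).
  by apply/measurable_EFinP; exact: measurable_normal_pdf.
have pdf0 x : (0 <= (normal_pdf m s x)%:E)%E by rewrite lee_fin normal_pdf_ge0.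
pose f_ := nnsfun_approx measurableT mf.
have mf_ n : measurable_fun setT (EFin \o f_ n) by exact/measurable_EFinP.
transitivity (lim (\int[normal_prob m s]_x (f_ n x)%:E @[n --> \oo])%E).
  rewrite -monotone_convergence//=.
  - by apply: eq_integral => x _; apply/esym/cvg_lim => //=; exact: cvg_nnsfun_approx.
  - by move=> n x _; rewrite lee_fin.
  - by move=> x _ ? ? mn; rewrite lee_fin; exact/lefP/nd_nnsfun_approx.
transitivity (lim (\int[leb]_x ((f_ n x)%:E * (normal_pdf m s x)%:E) @[n --> \oo])%E); last first.
  rewrite -monotone_convergence//=.
  - apply: eq_integral => x _; apply/cvg_lim => //; apply: cvgeZr => //.
    exact: cvg_nnsfun_approx.
  - by move=> n; apply: emeasurable_funM => //; exact: (mf_ n).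
  - by move=> n x _; rewrite mule_ge0// lee_fin.
  - by move=> x _ ? ? mn; rewrite lee_wpmul2r// lee_fin; exact/lefP/nd_nnsfun_approx.
apply: congr_lim; apply/funext => n /=; move: (f_ n) => h.
under [LHS]eq_integral do rewrite fimfunE -fsumEFin//.
rewrite [LHS]ge0_integral_fsum//; last 2 first.
  - by move=> r; exact/measurable_EFinP/measurableT_comp.
  - by move=> r x _; rewrite EFinM nnfun_muleindic_ge0.
under [RHS]eq_integral.
  move=> x _; rewrite fimfunE -fsumEFin// ge0_mule_fsuml; last first.
    by move=> r; rewrite EFinM nnfun_muleindic_ge0.
  over.
rewrite [RHS]ge0_integral_fsum//; last 2 first.
  - move=> r; apply: emeasurable_funM => //.
    by apply/measurable_EFinP; exact/measurableT_comp.
  - by move=> r x _; rewrite mule_ge0// EFinM nnfun_muleindic_ge0.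
apply: eq_fsbigr => r _.
have mhr : measurable (h @^-1` [set r]) by exact: measurable_sfunP.
rewrite integralZl_indic_nnsfun//= integral_indic// setIT /normal_prob.
have [r0|r0] := ltP r 0.
  rewrite preimage_nnfun0// ?measure0 ?integral_set0 ?mule0//.
  by rewrite integral0_eq// => x _; rewrite indic0 mulr0 mul0e.
under [RHS]eq_integral do rewrite EFinM -muleA.
rewrite ge0_integralZl//; last first.
- by move=> x _; rewrite mule_ge0// lee_fin.
- by apply: emeasurable_funM => //; exact/measurable_EFinP/measurable_indic.
congr (_ * _)%E; transitivity (\int[leb]_(x in h @^-1` [set r]) (normal_pdf m s x)%:E)%E => //.
rewrite [LHS]integral_mkcond; apply: eq_integral => x _.
by rewrite patchE indicE; case: ifP; rewrite ?mul1e ?mul0e.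
Qed.

Let gam := normal_prob (0 : R) 1.

Lemma normal_prob_scale (c s : R) (A : set R) : 0 < s -> measurable A ->
  gam ((fun y => c + s * y) @^-1` A) = normal_prob c s A.
Proof.
move=> s0 mA.
pose aff : measurableTypeR R -> measurableTypeR R := fun y => c + s * y.
have maff : measurable_fun [set: measurableTypeR R] aff.
  by apply: measurable_funD => //; exact: measurable_funM.
pose X : {mfun measurableTypeR R >-> measurableTypeR R} := mfun_Sub (mem_set maff).
have Fd x : is_derive x (1 : R) (fun y => c + s * y) s.
  by apply: is_derive_eq; rewrite add0r mul1r; exact: mulr1.
have F'E : (fun y : R^o => c + s * y)^`()%classic = cst s.
  by apply/funext => x; rewrite derive1E derive_val.
rewrite -[LHS]/(distribution gam X A); apply: probability_eq_itv mA => t.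
rewrite /distribution /pushforward /X /=.
pose b := (t - c) / s.
have -> : aff @^-1` `]-oo, t] = `]-oo, b]%classic.
  apply/seteqP; split => y /=; rewrite !in_itv/= /aff /b.
    by rewrite ler_pdivlMr// => ?; lra.
  by rewrite ler_pdivlMr// => ?; lra.
have tE : t = c + s * b by rewrite /b mulrCA divff ?gt_eqF// mulr1; ring.
rewrite /gam /normal_prob tE.
rewrite (@increasing_ge0_integration_by_substitutionNy _ (fun y => c + s * y) (normal_pdf c s) b).
- apply: eq_integral => y _; rewrite F'E /= !fctE; congr (_%:E).
  rewrite !normal_pdfE ?oner_eq0 ?gt_eqF// /normal_peak /normal_fun.
  rewrite (addrC c) addrK subr0 expr1n mul1r.
  rewrite -mulrnAr sqrtrM ?sqr_ge0// sqrtr_sqr gtr0_norm// invfM.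
  have -> : - (s * y) ^+ 2 / (s ^+ 2 *+ 2) = - y ^+ 2 / (1 *+ 2).
    by field; rewrite gt_eqF.
  by field; rewrite lt0r_neq0 ?lt0r_neq0// sqrtr_gt0 mulrn_wgt0// pi_gt0.
- by move=> x y _ _ xy; rewrite ltrD2l ltr_pM2l.
- by rewrite F'E => x _; exact: cvg_cst.
- by rewrite F'E; exact: is_cvg_cst.
- by rewrite F'E; exact: cvg_cst.
- split; first by move=> x _; apply: ex_derive.
  apply: cvg_at_left_filter.
  by apply: cvgD; [exact: cvg_cst|apply: cvgM; [exact: cvg_cst|exact: cvg_id]].
- apply: (cvg_comp (fun r => s * r) (fun r => c + r)); last exact: cvg_addrl_Ny.
  by apply: gt0_cvgMrNy => //; exact: cvg_id.
- by apply: continuous_subspaceT; apply: continuous_normal_pdf; rewrite gt_eqF.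
- by move=> x _; exact: normal_pdf_ge0.
Qed.

(** Supplies negative slopes to [normal_prob_affine]: the substitution in [normal_prob_scale] needs
    an increasing map. *)
Lemma normal_prob_opp (A : set R) : measurable A -> gam (-%R @^-1` A) = gam A.
Proof.
move=> mA; pose N : measurableTypeR R -> measurableTypeR R := -%R.
have mN : measurable_fun setT N by exact: oppr_measurable.
transitivity (\int[leb]_(x in N @^-1` A) (((EFin \o (normal_pdf 0 1)) \o N) x))%E.
  apply: eq_integral => x _ /=; rewrite !normal_pdfE ?oner_eq0// /normal_fun.
  by rewrite !subr0 /N sqrrN.
rewrite -ge0_integral_pushforward//; last 2 first.
- apply: measurable_funTS; apply/measurable_EFinP; exact: measurable_normal_pdf.
- by move=> y _; rewrite /= lee_fin normal_pdf_ge0.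
by apply: eq_measure_integral => B mB _; exact: lebesgue_measureN.
Qed.

Lemma normal_prob_affine (c b : R) (A : set R) : b != 0 -> measurable A ->
  gam ((fun y => c + b * y) @^-1` A) = normal_prob c `|b| A.
Proof.
move=> b0 mA; have /orP[b1|b1] : (b < 0) || (0 < b) by rewrite -neq_lt.
  have Nb0 : 0 < - b by rewrite oppr_gt0.
  rewrite (ltr0_norm b1) -(normal_prob_scale c Nb0 mA).
  rewrite -[RHS]normal_prob_opp; last first.
    rewrite -[X in measurable X]setTI.
    by apply: (measurable_funD (f := fun=> c)) => //; exact: measurable_funM.
  by congr (gam _); apply/seteqP; split => y /=; rewrite mulrNN.
by rewrite (gtr0_norm b1); exact: normal_prob_scale.
Qed.

End normal_laws.

Section bivariate_normal.
Context {R : realType}.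
Local Notation leb := (@lebesgue_measure R).
Local Notation gam := (normal_prob (0 : R) 1).

(* Completing the square in the joint density of (x, a x + b y). *)
Lemma normal_pdf_convolution (a b x z : R) : b != 0 ->
  normal_pdf (a * x) `|b| z * normal_pdf 0 1 x =
  normal_pdf 0 (Num.sqrt (a ^+ 2 + b ^+ 2)) z *
  normal_pdf (a * z / (a ^+ 2 + b ^+ 2)) (`|b| / Num.sqrt (a ^+ 2 + b ^+ 2)) x.
Proof.
move=> b0; set v := a ^+ 2 + b ^+ 2.
have v0 : 0 < v by rewrite ltr_wpDl ?sqr_ge0// exprn_even_gt0.
have sv0 : 0 < Num.sqrt v by rewrite sqrtr_gt0.
have nb0 : 0 < `|b| by rewrite normr_gt0.
rewrite !normal_pdfE ?oner_eq0 ?gt_eqF ?divr_gt0//.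
rewrite mulrACA [RHS]mulrACA; congr (_ * _).
  rewrite /normal_peak -!invfM; congr (_^-1).
  rewrite -!sqrtrM ?mulrn_wge0 ?mulr_ge0 ?pi_ge0 ?sqr_ge0//; congr Num.sqrt.
  rewrite expr_div_n sqr_sqrtr ?(ltW v0)// real_normK ?num_real//.
  by field; rewrite gt_eqF.
rewrite /normal_fun -!expRD; congr expR.
rewrite expr_div_n sqr_sqrtr ?(ltW v0)// real_normK ?num_real//.
have v1 : v != 0 by rewrite gt_eqF.
by rewrite /v in v1 *; field; rewrite v1 b0.
Qed.

(** For fixed x the variable ax + by has law N(ax, b^2). After Fubini, [normal_pdf_convolution]
    factors the joint density, and the integral over x is the total mass of a normal density. *)
Lemma binormal_linear (a b : R) (A : set R) : measurable A ->
  (gam \x gam)%E [set z | A (a * z.1 + b * z.2)] = normal_law 0 (a ^+ 2 + b ^+ 2) A.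
Proof.
move=> mA.
(* For b = 0 there is no conditional density given x. This branch also contains a = b = 0, where the
   law is a point mass. *)
have [b0|b0] := eqVneq b 0.
  rewrite b0; have [a0|a0] := eqVneq a 0.
    rewrite a0 /normal_law expr0n/= addr0 eqxx.
    under eq_set do rewrite !mul0r addr0.
    have [A0|A0] := pselect (A 0).
      rewrite (_ : [set _ | _] = setT); last by apply/seteqP; split.
      by rewrite probability_setT diracE mem_set.
    rewrite (_ : [set _ | _] = set0); last by apply/seteqP; split.
    by rewrite measure0 diracE memNset.
  under eq_set do rewrite mul0r addr0.
  rewrite (_ : [set _ | _] = ((fun x => 0 + a * x) @^-1` A) `*` setT); last first.
    by apply/seteqP; split => z /=; rewrite add0r => // -[].
  rewrite product_measure1E//; last first.
    rewrite -[X in measurable X]setTI.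
    by apply: (measurable_funD (f := fun=> 0)) => //; exact: measurable_funM.
  transitivity (gam ((fun x => (0 + a * x)%R) @^-1` A) * gam setT)%E => //.
  have -> : gam setT = 1%E by exact: probability_setT.
  rewrite normal_prob_affine// mule1.
  by rewrite /normal_law expr0n/= addr0 sqrf_eq0 (negbTE a0) sqrtr_sqr.
have v0 : 0 < a ^+ 2 + b ^+ 2 by rewrite ltr_wpDl ?sqr_ge0// exprn_even_gt0.
have sv0 : 0 < Num.sqrt (a ^+ 2 + b ^+ 2) by rewrite sqrtr_gt0.
have nb0 : 0 < `|b| by rewrite normr_gt0.
rewrite /normal_law gt_eqF//.
pose f (z : R * R) : \bar R :=
  ((\1_A z.2)%:E * (normal_pdf (a * z.1) `|b| z.2 * normal_pdf 0 1 z.1)%:E)%E.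
have mpdf : measurable_fun setT (fun z : R * R => normal_pdf (a * z.1) `|b| z.2).
  under eq_fun do rewrite normal_pdfE ?gt_eqF//.
  apply: measurable_funM => //; apply: measurableT_comp => //.
  apply: measurable_funM => //; apply: measurableT_comp => //.
  apply: measurable_funX; apply: measurable_funB; first exact: measurable_snd.
  by apply: measurable_funM => //; exact: measurable_fst.
have mA2 : measurable_fun setT (fun z : R * R => (\1_A z.2 : R)%:E).
  by apply/measurable_EFinP; apply: measurableT_comp => //; exact: measurable_snd.
have mg : measurable_fun setT (fun z : R * R => (\1_A z.2)%:E * (normal_pdf (a * z.1) `|b| z.2)%:E)%E.
  by apply: emeasurable_funM => //; exact/measurable_EFinP.
have mf : measurable_fun setT f.
  apply: emeasurable_funM => //.
  apply/measurable_EFinP; apply: measurable_funM => //.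
  by apply: measurableT_comp; [exact: measurable_normal_pdf|exact: measurable_fst].
have f0 z : (0 <= f z)%E by rewrite /f -EFinM lee_fin !mulr_ge0 ?normal_pdf_ge0.
transitivity (\int[leb]_x \int[leb]_z f (x, z))%E.
  transitivity (\int[gam]_x normal_prob (a * x) `|b| A)%E.
    apply: eq_integral => x _; rewrite -normal_prob_affine//=; congr (gam _).
    by apply/seteqP; split => y; rewrite /xsection/= inE.
  transitivity (\int[gam]_x \int[leb]_z ((\1_A z)%:E * (normal_pdf (a * x) `|b| z)%:E))%E.
    apply: eq_integral => x _; rewrite /normal_prob integral_mkcond; apply: eq_integral => z _.
    by rewrite patchE indicE; case: ifP; rewrite ?mul1e ?mul0e.
  pose g (z : R * R) : \bar R := ((\1_A z.2)%:E * (normal_pdf (a * z.1) `|b| z.2)%:E)%E.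
  have g0 z : (0 <= g z)%E by rewrite /g -EFinM lee_fin !mulr_ge0 ?normal_pdf_ge0.
  rewrite ge0_integral_normal_prob; last 2 first.
  - exact: (@measurable_fun_fubini_tonelli_F _ _ _ _ R leb g mg g0).
  - by move=> x; apply: integral_ge0 => z _; exact: (g0 (x, z)).
  apply: eq_integral => x _; rewrite -ge0_integralZr//; last 3 first.
  - by apply: emeasurable_funM; apply/measurable_EFinP; [exact: measurable_indic|exact: measurable_normal_pdf].
  - by move=> z _; exact: (g0 (x, z)).
  - by rewrite lee_fin normal_pdf_ge0.
  by apply: eq_integral => z _; rewrite /f/= -!EFinM mulrA.
transitivity (\int[leb]_z \int[leb]_x f (x, z))%E.
  exact: (@fubini_tonelli _ _ _ _ R leb leb f mf f0).
rewrite /normal_prob [RHS]integral_mkcond.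
apply: eq_integral => z _.
transitivity (\int[leb]_x ((\1_A z)%:E * (normal_pdf 0 (Num.sqrt (a ^+ 2 + b ^+ 2)) z)%:E *
    (normal_pdf (a * z / (a ^+ 2 + b ^+ 2)) (`|b| / Num.sqrt (a ^+ 2 + b ^+ 2)) x)%:E))%E.
  by apply: eq_integral => x _; rewrite /f/= normal_pdf_convolution// EFinM muleA.
rewrite ge0_integralZl//; last 3 first.
- by apply/measurable_EFinP; exact: measurable_normal_pdf.
- by move=> x _; rewrite lee_fin normal_pdf_ge0.
- by rewrite -EFinM lee_fin mulr_ge0 ?normal_pdf_ge0.
rewrite integral_normal_pdf mule1 patchE indicE.
by case: ifP; rewrite ?mul1e ?mul0e.
Qed.

End bivariate_normal.

(** * Transfer of integrals between variables of equal law *)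

Section same_law.
Context d (T : measurableType d) d' (T' : measurableType d') d'' (S : measurableType d'')
  (R : realType) (P : probability T R) (Q : probability T' R).
Variables (X : T -> S) (Y : T' -> S).
Hypotheses (mX : measurable_fun setT X) (mY : measurable_fun setT Y).
Hypothesis XY : forall A, measurable A -> P (X @^-1` A) = Q (Y @^-1` A).

Lemma ge0_integral_same_law (g : S -> \bar R) : measurable_fun setT g ->
  (forall x, 0 <= g x)%E -> (\int[P]_w g (X w) = \int[Q]_w g (Y w))%E.
Proof.
move=> mg g0.
pose X' : {mfun T >-> S} := mfun_Sub (mem_set mX).
pose Y' : {mfun T' >-> S} := mfun_Sub (mem_set mY).
transitivity (\int[distribution P X']_y g y)%E.
  by rewrite ge0_integral_distribution.
transitivity (\int[distribution Q Y']_y g y)%E; last by rewrite ge0_integral_distribution.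
by apply: eq_measure_integral => A mA _; exact: XY.
Qed.

Lemma integrable_same_law (g : S -> R) : measurable_fun setT g ->
  Q.-integrable setT (EFin \o (fun w => g (Y w))) ->
  P.-integrable setT (EFin \o (fun w => g (X w))).
Proof.
move=> mg /integrableP[_ gY]; apply/integrableP; split.
  by apply/measurable_EFinP; exact: measurableT_comp.
rewrite (ge0_integral_same_law (g := fun x => `|(g x)%:E|%E))//.
by apply: measurableT_comp => //; exact/measurable_EFinP.
Qed.

Lemma Rintegral_same_law (g : S -> R) : measurable_fun setT g ->
  Q.-integrable setT (EFin \o (fun w => g (Y w))) ->
  \int[P]_w g (X w) = \int[Q]_w g (Y w).
Proof.
move=> mg gY; have gX := integrable_same_law mg gY.
pose X' : {mfun T >-> S} := mfun_Sub (mem_set mX).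
pose Y' : {mfun T' >-> S} := mfun_Sub (mem_set mY).
have mg' : measurable_fun setT (EFin \o g) by exact/measurable_EFinP.
rewrite /Rintegral; congr fine.
transitivity (\int[distribution P X']_y (g y)%:E)%E.
  by rewrite (@integral_distribution _ _ _ _ _ _ X' (EFin \o g)).
transitivity (\int[distribution Q Y']_y (g y)%:E)%E; last first.
  by rewrite (@integral_distribution _ _ _ _ _ _ Y' (EFin \o g)).
by apply: eq_measure_integral => A mA _; exact: XY.
Qed.

End same_law.

(** * Second and fourth moments of the standard normal law *)

Section normal_moments.
Context {R : realType}.
Local Notation leb := (@lebesgue_measure R).
Local Notation gam := (normal_prob (0 : R) 1).

(** The factor [s] cancels the scale in the normalizing constant, so that densities with different
    scales can be compared pointwise. *)
Lemma normal_pdf01 (s x : R) : 0 < s ->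
  s * normal_pdf 0 s x = normal_peak 1 * expR (- (x ^+ 2 / 2) / s ^+ 2).
Proof.
move=> s0; rewrite normal_pdfE ?gt_eqF// /normal_fun subr0 /normal_peak expr1n mul1r.
rewrite -[s ^+ 2 * pi *+ 2]mulrnAr sqrtrM ?sqr_ge0// sqrtr_sqr gtr0_norm// invfM
  mulrA mulrA divff ?gt_eqF// mul1r.
by congr (_ * expR _); field; rewrite gt_eqF.
Qed.

Lemma normal_pdf011 (x : R) : normal_pdf 0 1 x = normal_peak 1 * expR (- (x ^+ 2 / 2)).
Proof. by have := normal_pdf01 x ltr01; rewrite mul1r expr1n divr1. Qed.

Let int_pdf (s k : R) : 0 <= k -> (\int[leb]_x (k * normal_pdf 0 s x)%:E = k%:E)%E.
Proof.
move=> k0; under eq_integral do rewrite EFinM.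
rewrite ge0_integralZl//.
- by rewrite integral_normal_pdf mule1.
- by apply/measurable_EFinP; exact: measurable_normal_pdf.
- by move=> x _; rewrite lee_fin normal_pdf_ge0.
Qed.

Let mpdf s : measurable_fun setT (normal_pdf (0 : R) s).
Proof. exact: measurable_normal_pdf. Qed.

Let mX n : measurable_fun setT (fun x : R => x ^+ n).
Proof. exact: exprn_measurable. Qed.

(** Domination by a multiple of the density of variance 2. With u = x^2/4, x^4 = 64 (u/2)^2 <= 64
    exp u, since exp (u/2) exceeds u/2. *)
Lemma normal_moment4_lty : (\int[gam]_x (x ^+ 4)%:E < +oo)%E.
Proof.
rewrite ge0_integral_normal_prob; last 2 first.
- by apply/measurable_EFinP; exact: mX.
- by move=> x; rewrite lee_fin exprn_even_ge0.
pose s : R := Num.sqrt 2.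
have s0 : 0 < s by rewrite sqrtr_gt0.
apply: (@le_lt_trans _ _ (\int[leb]_x (64 * s * normal_pdf 0 s x)%:E)%E); last first.
  by rewrite int_pdf ?ltry// mulr_ge0// ltW.
apply: ge0_le_integral => //.
- by move=> x _; rewrite -EFinM lee_fin mulr_ge0 ?normal_pdf_ge0// exprn_even_ge0.
- by apply: emeasurable_funM; apply/measurable_EFinP; [exact: mX|exact: mpdf].
- by apply/measurable_EFinP; apply: measurable_funM => //; exact: mpdf.
move=> x _; rewrite -EFinM lee_fin -mulrA normal_pdf01// normal_pdf011.
rewrite sqr_sqrtr// mulrCA [leRHS]mulrCA ler_wpM2l ?normal_peak_ge0//.
pose u := x ^+ 2 / 4.
have u0 : 0 <= u by rewrite divr_ge0 ?sqr_ge0.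
have -> : - (x ^+ 2 / 2) = - u + - u by rewrite /u; field.
have -> : (- u + - u) / 2 = - u by field.
rewrite expRD mulrA ler_wpM2r ?expR_ge0// expRN ler_pdivrMr ?expR_gt0//.
have -> : u = u / 2 + u / 2 by field.
have h := expR_ge1Dx (u / 2).
have hu : (u / 2) ^+ 2 <= expR (u / 2) ^+ 2.
  by rewrite ler_sqr ?nnegrE; [lra|lra|exact: expR_ge0].
rewrite expRD -expr2; apply: le_trans (ler_wpM2l _ hu) => //.
by rewrite /u le_eqVlt; apply/orP; left; apply/eqP; field.
Qed.

(** The total mass 1 of N(0, s^2) is in effect differentiated in s at s = 1. A pointwise convexity
    inequality, integrated for s on both sides of 1, replaces the derivative. *)
Lemma normal_moment2 : (\int[gam]_x (x ^+ 2)%:E = 1)%E.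
Proof.
set M := (\int[gam]_x _)%E.
have ME : M = (\int[leb]_x ((x ^+ 2) * normal_pdf 0 1 x)%:E)%E.
  rewrite /M ge0_integral_normal_prob//.
  - by apply/measurable_EFinP; exact: mX.
  - by move=> x; rewrite lee_fin sqr_ge0.
have m2 (k : R) : measurable_fun setT (fun x : R => k * (x ^+ 2 * normal_pdf 0 1 x)).
  by apply: measurable_funM => //; apply: measurable_funM => //; exact: mX.
have g0 (k x : R) : 0 <= k -> 0 <= k * (x ^+ 2 * normal_pdf 0 1 x).
  by move=> k0; apply: mulr_ge0 => //; apply: mulr_ge0; [exact: sqr_ge0|exact: normal_pdf_ge0].
have kM (k : R) : 0 <= k -> (\int[leb]_x (k * (x ^+ 2 * normal_pdf 0 1 x))%:E = k%:E * M)%E.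
  move=> k0; rewrite ME -ge0_integralZl//.
  - by apply/measurable_EFinP; apply: measurable_funM; [exact: mX|exact: mpdf].
  - by move=> x _; rewrite lee_fin; have := g0 1 x ler01; rewrite mul1r.
have one : (\int[leb]_x (normal_pdf 0 1 x)%:E = 1%E)%E by exact: integral_normal_pdf.
(* This is exp y >= 1 + y, with y the difference of the two exponents. *)
have cvx (s x : R) : 0 < s ->
    normal_pdf 0 1 x <= s * normal_pdf 0 s x + (s ^- 2 - 1) / 2 * (x ^+ 2 * normal_pdf 0 1 x).
  move=> s0; rewrite normal_pdf01// normal_pdf011.
  rewrite [X in _ <= _ + X](_ : _ =
      normal_peak 1 * ((s ^- 2 - 1) / 2 * x ^+ 2 * expR (- (x ^+ 2 / 2)))); last by ring.
  rewrite -mulrDr ler_wpM2l ?normal_peak_ge0//.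
  pose y := x ^+ 2 / 2 * (1 - s ^- 2).
  have -> : - (x ^+ 2 / 2) / s ^+ 2 = - (x ^+ 2 / 2) + y by rewrite /y; field; rewrite gt_eqF.
  rewrite expRD [X in _ + X](_ : _ = expR (- (x ^+ 2 / 2)) * - y); last first.
    by rewrite /y; field; rewrite gt_eqF.
  rewrite -mulrDr -[leLHS]mulr1 ler_wpM2l ?expR_ge0//.
  by have := expR_ge1Dx y; lra.
(* For s > 1 the second-moment term changes side, so that all coefficients stay nonnegative while
   [M] might still be infinite. The case s = 2 then shows that [M] is finite. *)
have up (s : R) : 1 < s -> (1 + ((1 - s ^- 2) / 2)%:E * M <= s%:E)%E.
  move=> s1; have s0 : 0 < s by lra.
  have k0 : 0 <= (1 - s ^- 2) / 2.
    by rewrite divr_ge0// subr_ge0 invf_le1 ?exprn_gt0// exprn_ege1// ltW.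
  rewrite -(int_pdf s (ltW s0)) -kM// -one -ge0_integralD//; last 4 first.
  - by move=> x _; rewrite lee_fin normal_pdf_ge0.
  - by apply/measurable_EFinP; first [exact: mpdf|exact: m2].
  - by move=> x _; rewrite lee_fin g0.
  - by apply/measurable_EFinP; first [exact: mpdf|exact: m2].
  apply: ge0_le_integral => //.
  - by move=> x _; rewrite -EFinD lee_fin addr_ge0 ?normal_pdf_ge0 ?g0.
  - by apply: emeasurable_funD; apply/measurable_EFinP; first [exact: mpdf|exact: m2].
  - by apply/measurable_EFinP; apply: measurable_funM => //; exact: mpdf.
  - by move=> x _; rewrite -EFinD lee_fin; have := cvx s x s0; lra.
have lo (s : R) : 0 < s < 1 -> (1 <= s%:E + ((s ^- 2 - 1) / 2)%:E * M)%E.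
  move=> /andP[s0 s1].
  have k0 : 0 <= (s ^- 2 - 1) / 2.
    by rewrite divr_ge0// subr_ge0 invf_ge1 ?exprn_gt0// exprn_ile1// ltW.
  rewrite -(int_pdf s (ltW s0)) -kM// -one -ge0_integralD//; last 4 first.
  - by move=> x _; rewrite lee_fin mulr_ge0 ?normal_pdf_ge0// ltW.
  - by apply/measurable_EFinP; apply: measurable_funM => //; exact: mpdf.
  - by move=> x _; rewrite lee_fin g0.
  - by apply/measurable_EFinP; first [exact: mpdf|exact: m2].
  apply: ge0_le_integral => //.
  - by move=> x _; rewrite lee_fin normal_pdf_ge0.
  - by apply/measurable_EFinP; first [exact: mpdf|exact: m2].
  - by apply: emeasurable_funD; apply/measurable_EFinP; [apply: measurable_funM => //; exact: mpdf|exact: m2].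
  - by move=> x _; rewrite -EFinD lee_fin cvx.
have M0 : (0 <= M)%E by apply: integral_ge0 => x _; rewrite lee_fin sqr_ge0.
have Mfin : M \is a fin_num.
  rewrite ge0_fin_numE// ltey; apply/eqP => My.
  have := up 2 ltac:(lra); rewrite My gt0_muley ?addey//.
  by rewrite lte_fin; lra.
have m0 : 0 <= fine M by rewrite fine_ge0.
move: up lo; rewrite -(fineK Mfin); move: (fine M) m0 => m m0 up lo {one kM ME M0 Mfin M}.
(* Dividing by s - 1 would give m <= 2s^2/(s + 1), which is at most s^2 for s > 1; [loR] is the
   mirror image for s < 1. *)
have upR (s : R) : 1 < s -> m <= s ^+ 2.
  move=> s1; have := up s s1; rewrite -EFinM -EFinD lee_fin => H.
  have s20 : 0 < s ^+ 2 by rewrite exprn_gt0//; lra.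
  have : (s ^+ 2 + (s ^+ 2 - 1) / 2 * m) <= s ^+ 3.
    have := ler_wpM2l (ltW s20) H; rewrite -exprSr; apply: le_trans.
    rewrite le_eqVlt; apply/orP; left; apply/eqP; field; lra.
  move=> H3; rewrite leNgt; apply/negP => ms.
  have P1 : 0 < (s ^+ 2 - 1) * (m - s ^+ 2) by rewrite mulr_gt0 ?subr_gt0 ?exprn_egt1.
  have P2 : 0 <= (s * (s - 1)) ^+ 2 by exact: sqr_ge0.
  nra.
have loR (s : R) : 0 < s < 1 -> s ^+ 2 <= m.
  move=> s01; have := lo s s01; rewrite -EFinM -EFinD lee_fin => H.
  move: s01 => /andP[s0 s1].
  have s20 : 0 < s ^+ 2 by rewrite exprn_gt0.
  have : s ^+ 2 <= s ^+ 3 + (1 - s ^+ 2) / 2 * m.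
    have := ler_wpM2l (ltW s20) H; rewrite mulr1 => /le_trans; apply.
    rewrite le_eqVlt; apply/orP; left; apply/eqP; field; lra.
  move=> H3; rewrite leNgt; apply/negP => ms.
  have P1 : 0 < (1 - s ^+ 2) * (s ^+ 2 - m).
    by rewrite mulr_gt0 ?subr_gt0// exprn_ilt1// ltW.
  have P2 : 0 <= (s * (s - 1)) ^+ 2 by exact: sqr_ge0.
  nra.
(* If m differed from 1, the scale with s^2 = (1 + m)/2, strictly between 1 and m, would contradict
   one of the bounds. *)
congr (_%:E); apply/eqP; rewrite eq_le; apply/andP; split; rewrite leNgt; apply/negP => m1.
  have := upR (Num.sqrt ((1 + m) / 2)); rewrite sqr_sqrtr; last by lra.
  by rewrite -[X in X < _]sqrtr1 ltr_sqrt; [lra|lra].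
have := loR (Num.sqrt ((1 + m) / 2)); rewrite sqr_sqrtr; last by lra.
rewrite sqrtr_gt0 -[X in Num.sqrt _ < X]sqrtr1 ltr_sqrt//.
by rewrite (_ : (0 < (1 + m) / 2) && _); [move=> /(_ isT); lra|apply/andP; split; lra].
Qed.

End normal_moments.

Section independent_pair.
Context d (T : measurableType d) (R : realType) (P : probability T R).

(** [Rintegral_mul_ext] is applied twice: to pass from indicators to [g] with [h] kept general, then
    to pass to [h] with an indicator in the place of [g]. *)
Lemma Rintegral_indep2 (X Y : T -> R) (g h : R -> R) :
  measurable_fun setT X -> measurable_fun setT Y ->
  (forall A B, measurable A -> measurable B ->
     P ((X @^-1` A) `&` (Y @^-1` B)) = (P (X @^-1` A) * P (Y @^-1` B))%E) ->
  bounded_measurable g -> bounded_measurable h ->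
  \int[P]_w (g (X w) * h (Y w)) = \int[P]_w g (X w) * \int[P]_w h (Y w).
Proof.
move=> mX mY XY bg bh.
have mpre (Z : T -> R) (A : set R) : measurable_fun setT Z -> measurable A -> measurable (Z @^-1` A).
  by move=> mZ mA; have := mZ measurableT A mA; rewrite setTI.
have ind0 (A : set T) : measurable A -> \int[P]_w \1_A w = fine (P A).
  by move=> mA; rewrite /Rintegral integral_indic// setIT.
have indE (Z : T -> R) (A : set R) : measurable_fun setT Z -> measurable A ->
    \int[P]_w \1_A (Z w) = fine (P (Z @^-1` A)).
  by move=> mZ mA; rewrite -ind0//; exact: mpre.
have [_ [K hK]] := bh.
apply: (Rintegral_mul_ext mX (measurable_bcomp bh mY) (fun w => hK (Y w))) => // A mA.
under eq_Rintegral do rewrite mulrC.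
rewrite [RHS]mulrC.
apply: (@Rintegral_mul_ext _ _ _ _ _ _ 1 _ mY
  (measurable_bcomp (bounded_measurable_indic mA) mX)) => //.
  by move=> w; rewrite indicE; case: (_ \in _); rewrite ?normr1 ?normr0.
move=> B mB.
rewrite !indE// -fineM ?fin_num_measure//; [|exact: mpre|exact: mpre].
have mAB : measurable ((X @^-1` A) `&` (Y @^-1` B)).
  by apply: measurableI; [exact: mpre mX mA|exact: mpre mY mB].
rewrite muleC -XY// -ind0//.
by apply: eq_Rintegral => w _; rewrite indicI/= mulrC.
Qed.

End independent_pair.

(** * The Gaussian cosine transform and the limit law *)

Section gaussian_functional.
Context {R : realType}.
Local Notation gam := (normal_prob (0 : R) 1).
(* [R] and [measurableTypeR R] have the same measurable sets but distinct displays. *)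
Let T := (measurableTypeR R * measurableTypeR R)%type.
Let g2 : probability T R := (gam \x gam)%E.

Let lin (a b : R) (z : T) : R := a * z.1 + b * z.2.

Let mfst : measurable_fun setT (fst : T -> R).
Proof. exact: measurable_fst. Qed.

Let msnd : measurable_fun setT (snd : T -> R).
Proof. exact: measurable_snd. Qed.

Let mlin a b : measurable_fun setT (lin a b).
Proof. by apply: measurable_funD; exact: measurable_funM. Qed.

Let law_lin a b a' b' A : a ^+ 2 + b ^+ 2 = a' ^+ 2 + b' ^+ 2 -> measurable A ->
  g2 (lin a b @^-1` A) = g2 (lin a' b' @^-1` A).
Proof.
move=> ab mA.
have E1 := binormal_linear a b mA; have E2 := binormal_linear a' b' mA.
by rewrite -ab in E2; exact: etrans E1 (esym E2).
Qed.

Let law_fst A : measurable A -> g2 ((fst : T -> R) @^-1` A) = gam A.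
Proof.
move=> mA; have -> : (fst : T -> R) @^-1` A = A `*` (setT : set R) by apply/seteqP; split => z //= -[].
transitivity (gam A * gam setT)%E; first exact: product_measure1E.
have -> : gam setT = 1%E by exact: probability_setT.
by rewrite mule1.
Qed.

(** The characteristic function of N(0, s) as a function of the variance. It is an integral over the
    plane so that the second coordinate is at hand as an independent copy. *)
Definition gauss_cf (s : R) : R := \int[g2]_z cos (Num.sqrt s * z.1).

Let int_cos a b c : g2.-integrable setT (EFin \o (fun z => cos (lin a b z + c))).
Proof.
apply: (@integrable_bounded _ _ _ _ _ 1) => [|z]; last exact: cos_max.
by apply: measurable_cos_comp; exact: measurable_funD.
Qed.

Let cos_lin a b c : \int[g2]_z cos (lin a b z + c) =
  \int[g2]_z cos (lin (Num.sqrt (a ^+ 2 + b ^+ 2)) 0 z + c).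
Proof.
apply: (Rintegral_same_law (mlin a b) (mlin _ _) _ (g := fun x => cos (x + c))).
- move=> A mA; apply: law_lin => //.
  by rewrite sqr_sqrtr ?addr_ge0 ?sqr_ge0// expr0n/= addr0.
- exact: (bounded_measurable_cos c).1.
- exact: int_cos.
Qed.

(** The linear form has the law of sqrt v times the first coordinate, and also of its opposite.
    Averaging over the two signs cancels the sine term and leaves cos c as a factor. *)
Lemma gauss_cf_linear a b c :
  \int[g2]_z cos (a * z.1 + b * z.2 + c) = gauss_cf (a ^+ 2 + b ^+ 2) * cos c.
Proof.
set v := a ^+ 2 + b ^+ 2.
have E1 : \int[g2]_z cos (lin a b z + c) = \int[g2]_z cos (lin (Num.sqrt v) 0 z + c) by exact: cos_lin.
have E2 : \int[g2]_z cos (lin a b z + c) = \int[g2]_z cos (lin (- Num.sqrt v) 0 z + c).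
  have v' : (- Num.sqrt v) ^+ 2 + 0 ^+ 2 = v.
    by rewrite sqrrN sqr_sqrtr ?addr_ge0 ?sqr_ge0// expr0n/= addr0.
  by rewrite E1 (cos_lin (- Num.sqrt v)) v'.
rewrite -[LHS]/(\int[g2]_z cos (lin a b z + c)).
have : \int[g2]_z cos (lin a b z + c) + \int[g2]_z cos (lin a b z + c) = gauss_cf v * cos c * 2.
  rewrite {1}E1 E2 -RintegralD//.
  rewrite /gauss_cf -mulrA -RintegralZr//; last first.
    apply: (@integrable_bounded _ _ _ _ _ 1) => [|z]; last exact: cos_max.
    by apply: measurable_cos_comp; exact: measurable_funM.
  apply: eq_Rintegral => z _; rewrite /lin !mul0r !addr0 mulNr !cosD cosN sinN; ring.
by lra.
Qed.

Lemma gauss_cf_le1 s : `|gauss_cf s| <= 1.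
Proof.
apply: le_norm_Rintegral_prob => [|z]; last exact: cos_max.
by apply: measurable_cos_comp; apply: measurable_funM => //.
Qed.

(** The forms sqrt s z1 + sqrt t z2 and sqrt s z1 - sqrt t z2 have the same normal law of variance s
    + t. The mean of their cosines is a product of cosines of independent coordinates. *)
Lemma gauss_cfD s t : 0 <= s -> 0 <= t -> gauss_cf (s + t) = gauss_cf s * gauss_cf t.
Proof.
move=> s0 t0.
have Ep : \int[g2]_z cos (lin (Num.sqrt s) (Num.sqrt t) z + 0) = gauss_cf (s + t).
  by rewrite gauss_cf_linear !sqr_sqrtr// cos0 mulr1.
have En : \int[g2]_z cos (lin (Num.sqrt s) (- Num.sqrt t) z + 0) = gauss_cf (s + t).
  by rewrite gauss_cf_linear sqrrN !sqr_sqrtr// cos0 mulr1.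
have Et : gauss_cf t = \int[g2]_z cos (Num.sqrt t * z.2).
  have := gauss_cf_linear 0 (Num.sqrt t) 0.
  rewrite expr0n/= add0r sqr_sqrtr// cos0 mulr1 => <-.
  by apply: eq_Rintegral => z _; rewrite mul0r add0r addr0.
have : gauss_cf (s + t) + gauss_cf (s + t) = gauss_cf s * gauss_cf t * 2.
  rewrite -{1}Ep -En -RintegralD//.
  have bc r : bounded_measurable (fun x : R => cos (Num.sqrt r * x)).
    split; last by exists 1 => x; exact: cos_max.
    by apply: measurable_cos_comp; exact: measurable_funM.
  rewrite Et /gauss_cf -(@Rintegral_indep2 _ _ _ g2 (fst : T -> R) (snd : T -> R) _ _ mfst msnd _
    (bc s) (bc t)); last first.
    move=> A B mA mB.
    have EA : g2 ((fst : T -> R) @^-1` A) = gam A by exact: law_fst.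
    have EB : g2 ((snd : T -> R) @^-1` B) = gam B.
      have -> : (snd : T -> R) @^-1` B = (setT : set R) `*` B by apply/seteqP; split => z //= -[].
      transitivity (gam setT * gam B)%E; first exact: product_measure1E.
      have -> : gam setT = 1%E by exact: probability_setT.
      by rewrite mul1e.
    rewrite EA EB; exact: product_measure1E.
  rewrite -RintegralZr//; last first.
    apply: (@integrable_bounded _ _ _ _ _ 1) => [|z].
      by apply: measurable_funM; apply: measurable_cos_comp; exact: measurable_funM.
    by rewrite normrM -[leRHS]mulr1 ler_pM ?cos_max.
  apply: eq_Rintegral => z _; rewrite /lin !addr0 mulNr cosD cosB; ring.
by lra.
Qed.

Let int_gam4 : gam.-integrable setT (fun x => (x ^+ 4)%:E).
Proof.
apply/integrableP; split; first by apply/measurable_EFinP; exact: exprn_measurable.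
under eq_integral do rewrite gee0_abs ?lee_fin ?exprn_even_ge0//.
exact: normal_moment4_lty.
Qed.

Let int_gam2 : gam.-integrable setT (fun x => (x ^+ 2)%:E).
Proof.
apply/integrableP; split; first by apply/measurable_EFinP; exact: exprn_measurable.
under eq_integral do rewrite gee0_abs ?lee_fin ?sqr_ge0//.
by rewrite normal_moment2 ltry.
Qed.

Let int4 : g2.-integrable setT (fun z => (z.1 ^+ 4)%:E).
Proof.
exact: (integrable_same_law (Q := gam) (Y := id) mfst (@measurable_id _ _ setT) law_fst
  (g := fun x => x ^+ 4) (exprn_measurable _) int_gam4).
Qed.

Let int2 : g2.-integrable setT (fun z => (z.1 ^+ 2)%:E).
Proof.
exact: (integrable_same_law (Q := gam) (Y := id) mfst (@measurable_id _ _ setT) law_fst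
  (g := fun x => x ^+ 2) (exprn_measurable _) int_gam2).
Qed.

Let moment2 : \int[g2]_z (z.1 ^+ 2) = 1.
Proof.
rewrite (Rintegral_same_law (Q := gam) (Y := id) mfst (@measurable_id _ _ setT) law_fst
  (g := fun x => x ^+ 2) (exprn_measurable _) int_gam2).
by rewrite /Rintegral normal_moment2.
Qed.

Lemma gauss_cf_taylor : exists2 C, 0 <= C &
  forall s, 0 <= s -> `|gauss_cf s - (1 - s / 2)| <= C * s ^+ 2.
Proof.
exists (\int[g2]_z (z.1 ^+ 4) / 24).
  by rewrite divr_ge0//; apply: Rintegral_ge0 => z _; exact: exprn_even_ge0.
move=> s s0.
have -> : 1 - s / 2 = \int[g2]_z (1 - s / 2 * z.1 ^+ 2).
  rewrite RintegralB//; [|exact: integrable_cst|exact: integrableRZ].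
  by rewrite Rintegral_prob_cst RintegralZl// moment2 mulr1.
have -> : \int[g2]_z (z.1 ^+ 4) / 24 * s ^+ 2 = \int[g2]_z (s ^+ 2 / 24 * z.1 ^+ 4).
  by rewrite RintegralZl//; ring.
apply: Rintegral_dist_le.
- apply: (@integrable_bounded _ _ _ _ _ 1) => [|z]; last exact: cos_max.
  by apply: measurable_cos_comp; apply: measurable_funM => //.
- by apply: integrableRB; [exact: integrable_cst|exact: integrableRZ].
- exact: integrableRZ.
- move=> z; have := cos_taylor (Num.sqrt s * z.1).
  rewrite !exprMn sqr_sqrtr// (_ : Num.sqrt s ^+ 4 = s ^+ 2); last first.
    by rewrite -[4%N]/(2 * 2)%N exprM sqr_sqrtr.
  by rewrite mulrAC [X in _ <= X -> _]mulrAC.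
Qed.

(** Multiplicativity bounds an increment by |gauss_cf t - 1|, t the distance of the two variances,
    and the expansion at 0 bounds that. *)
Lemma gauss_cf_cvg (v : nat -> R) (l : R) : (forall k, 0 <= v k) -> 0 <= l ->
  v k @[k --> \oo] --> l -> gauss_cf (v k) @[k --> \oo] --> gauss_cf l.
Proof.
move=> v0 l0 vl; have [C C0 HC] := gauss_cf_taylor.
have step s t : 0 <= s -> 0 <= t -> `|gauss_cf (s + t) - gauss_cf s| <= t / 2 + C * t ^+ 2.
  move=> s0 t0; rewrite gauss_cfD// -[X in _ - X]mulr1 -mulrBr normrM.
  apply: (@le_trans _ _ `|gauss_cf t - 1|); first by rewrite ler_piMl// gauss_cf_le1.
  rewrite (_ : _ - 1 = gauss_cf t - (1 - t / 2) - t / 2); last by ring.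
  apply: le_trans (ler_normB _ _) _; rewrite addrC (@ger0_norm _ (t / 2)) ?divr_ge0//.
  by rewrite lerD2l HC.
have bound k : `|gauss_cf l - gauss_cf (v k)| <= `|l - v k| / 2 + C * `|l - v k| ^+ 2.
  have [lv|/ltW vk] := leP l (v k).
    rewrite distrC (distrC l) (@ger0_norm _ (v k - l)) ?subr_ge0//.
    by have := step l (v k - l) l0; rewrite subr_ge0 (addrC l) subrK => /(_ lv).
  rewrite (@ger0_norm _ (l - v k)) ?subr_ge0//.
  by have := step (v k) (l - v k) (v0 k); rewrite subr_ge0 (addrC (v k)) subrK => /(_ vk).
have d0 : `|l - v k| @[k --> \oo] --> (0 : R).
  by rewrite -(normr0 R) -(subrr l); apply: cvg_norm; apply: cvgB => //; exact: cvg_cst.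
apply/cvgrPdist_le => e e0.
have b0 : `|l - v k| / 2 + C * `|l - v k| ^+ 2 @[k --> \oo] --> (0 : R).
  rewrite [X in _ --> X](_ : _ = 0 / 2 + C * 0 ^+ 2); last by rewrite expr0n/= mulr0 mul0r addr0.
  apply: cvgD; apply: cvgM => //; [exact: cvg_cst|exact: cvg_cst|].
  by rewrite expr2; under eq_fun do rewrite expr2; exact: cvgM.
near=> k; apply: le_trans (bound k) _.
have : `|0 - (`|l - v k| / 2 + C * `|l - v k| ^+ 2)| <= e.
  by near: k; move/cvgrPdist_le : b0; exact.
by rewrite sub0r normrN; apply: le_trans; exact: ler_norm.
Unshelve. all: by end_near.
Qed.

Lemma binormal_exists (rho : R) : `|rho| <= 1 ->
  exists nu : probability (R * R)%type R,
  [/\ is_binormal nu (0, 0) (\matrix_(i < 2, j < 2) if i == j then 1 else rho),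
      nu.-integrable setT (fun z => (z.1 ^+ 2 + z.2 ^+ 2)%:E),
      \int[nu]_z (z.1 ^+ 2 + z.2 ^+ 2) = 2 &
      forall a b c, \int[nu]_z cos (a * z.1 + b * z.2 + c) =
        gauss_cf (a ^+ 2 + b ^+ 2 + 2 * a * b * rho) * cos c].
Proof.
(* The limit law is that of (z1, rho z1 + tau z2) for independent standard normal z1, z2; tau = 0
   gives the degenerate case |rho| = 1. *)
move=> rho1; pose tau := Num.sqrt (1 - rho ^+ 2).
have tau2 : tau ^+ 2 = 1 - rho ^+ 2.
  by rewrite sqr_sqrtr// subr_ge0 -real_normK ?num_real// exprn_ile1.
pose W (z : T) : R * R := (z.1, lin rho tau z).
have mW : measurable_fun setT W.
  by apply/measurable_fun_pairP; split; [exact: mfst|exact: mlin].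
pose W' : {mfun T >-> (R * R)%type} := mfun_Sub (mem_set mW).
pose nu : probability (R * R)%type R := distribution g2 W'.
have Wlaw A : measurable A -> nu (id @^-1` A) = g2 (W @^-1` A) by [].
have var a b : (a + b * rho) ^+ 2 + (b * tau) ^+ 2 = a ^+ 2 + b ^+ 2 + 2 * a * b * rho.
  by rewrite [(b * tau) ^+ 2]exprMn tau2; ring.
have m2 : measurable_fun setT (fun z : R * R => z.1 ^+ 2 + z.2 ^+ 2).
  by apply: measurable_funD; apply: measurable_funX; [exact: mfst|exact: msnd].
have lin2i : g2.-integrable setT (EFin \o (fun z => (lin rho tau z) ^+ 2)).
  apply: (integrable_same_law (Q := g2) (mlin rho tau) (mlin 1 0) _
      (g := fun x => x ^+ 2) (exprn_measurable _)).
    by move=> A mA; apply: law_lin => //; rewrite tau2; ring.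
  rewrite (_ : _ \o _ = (fun z => (z.1 ^+ 2)%:E))//.
  by apply/funext => z; rewrite /= /lin mul1r mul0r addr0.
have W2i : g2.-integrable setT (EFin \o (fun z => (W z).1 ^+ 2 + (W z).2 ^+ 2)).
  exact: integrableRD.
exists nu; split.
- split.
    by apply/matrixP => i j; rewrite !mxE eq_sym.
  move=> u; rewrite /=.
  have -> : (u *m (\matrix_(i < 2, j < 2) if i == j then 1 else rho) *m u^T) 0 0 =
      u 0 0 ^+ 2 + u 0 1 ^+ 2 + 2 * u 0 0 * u 0 1 * rho.
    rewrite !mxE !big_ord_recl big_ord0 !mxE !big_ord_recl !big_ord0 !mxE /=.
    have -> : lift ord0 ord0 = 1 :> 'I_2 by exact/val_inj.
    by have -> : ord0 = 0 :> 'I_2; [exact/val_inj|ring].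
  rewrite -var; split; first by rewrite addr_ge0 ?sqr_ge0.
  move=> A mA; rewrite !mulr0 addr0.
  transitivity (g2 [set z | A ((u 0 0 + u 0 1 * rho) * z.1 + (u 0 1 * tau) * z.2)]).
    rewrite /nu /distribution /pushforward/=; congr (g2 _).
    by apply: eq_set => z; rewrite /W /lin/=; congr (A _); ring.
  exact: binormal_linear.
- exact: (integrable_same_law (Q := g2) (@measurable_id _ _ setT) mW Wlaw m2 W2i).
- rewrite (Rintegral_same_law (Q := g2) (@measurable_id _ _ setT) mW Wlaw m2 W2i)/=.
  rewrite RintegralD// moment2.
  have -> : \int[g2]_z (lin rho tau z) ^+ 2 = 1.
    rewrite -moment2.
    rewrite (Rintegral_same_law (Q := g2) (mlin rho tau) (mlin 1 0) _
      (g := fun x => x ^+ 2) (exprn_measurable _)).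
    - by apply: eq_Rintegral => z _; rewrite /lin mul1r mul0r addr0.
    - by move=> A mA; apply: law_lin => //; rewrite tau2; ring.
    - rewrite (_ : _ \o _ = (fun z => (z.1 ^+ 2)%:E))//.
      by apply/funext => z; rewrite /= /lin mul1r mul0r addr0.
  by [].
- move=> a b c; rewrite -var -gauss_cf_linear.
  rewrite (Rintegral_same_law (Q := g2) (@measurable_id _ _ setT) mW Wlaw
    (g := fun z => cos (a * z.1 + b * z.2 + c))).
  + by apply: eq_Rintegral => z _; rewrite /W/lin/=; congr cos; ring.
  + by apply: measurable_cos_comp; apply: measurable_funD => //; exact: mlin.
  + apply: (@integrable_bounded _ _ _ _ _ 1) => [|z]; last exact: cos_max.
    apply: measurable_cos_comp; apply: measurable_funD => //.
    by apply: measurable_funD; [exact: measurable_funM|apply: measurable_funM => //; exact: mlin].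
Qed.

End gaussian_functional.

(** * Standardized measurements *)

Section cdf_law.
Context d (T : measurableType d) (R : realType) (P : probability T R).

Lemma has_cdf_law (F : cumulativeBounded (0 : R) (1 : R)) (X : {RV P >-> R}) (A : set R) :
  has_cdf X F -> measurable A -> P (X @^-1` A) = lebesgue_stieltjes_measure F A.
Proof.
move=> XF mA.
pose X1 : T -> measurableTypeR R := X.
have mX : measurable_fun setT X1 by exact: (@measurable_funPT _ _ _ _ X).
pose X' : {mfun T >-> measurableTypeR R} := mfun_Sub (mem_set mX).
apply: (@probability_eq_itv _ (distribution P X') (lebesgue_stieltjes_measure F)) => // t.
have XFt := XF t; have Ft := cdf_lebesgue_stieltjes_id F t.
exact: etrans XFt (esym Ft).
Qed.

End cdf_law.

(** * Integrability from fourth moments *)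

Section integrable_powers.
Context d (T : measurableType d) (R : realType) (P : probability T R).
Implicit Types X Y : T -> R.

Lemma ler_pow4 (x : R) : `|x| <= 1 + x ^+ 4 /\ x ^+ 2 <= 1 + x ^+ 4.
Proof.
have h2 : 0 <= (x ^+ 2 - 2^-1) ^+ 2 by exact: sqr_ge0.
have h4 : 0 <= x ^+ 4 by exact: exprn_even_ge0.
have q2 : x ^+ 2 <= 1 + x ^+ 4 by nra.
have q0 : (x ^+ 2 - 2^-1) ^+ 2 = x ^+ 4 - x ^+ 2 + 4^-1 by field.
have h1 : 0 <= (`|x| - 2^-1) ^+ 2 by exact: sqr_ge0.
have q1 : (`|x| - 2^-1) ^+ 2 = x ^+ 2 - `|x| + 4^-1.
  by rewrite sqrrB real_normK ?num_real//; field.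
split => //; lra.
Qed.

Lemma pow4D_le (x y : R) : (x + y) ^+ 4 <= 8 * (x ^+ 4 + y ^+ 4).
Proof.
have -> : 8 * (x ^+ 4 + y ^+ 4) = (x + y) ^+ 4 + (4 * (x ^+ 2 - y ^+ 2) ^+ 2 +
  (x - y) ^+ 2 * (2 * (x ^+ 2 + y ^+ 2) + (x + y) ^+ 2)) by ring.
have x2 := sqr_ge0 x; have y2 := sqr_ge0 y.
rewrite lerDl; apply: addr_ge0; first by rewrite mulr_ge0 ?sqr_ge0.
by apply: mulr_ge0; rewrite ?sqr_ge0//; have := sqr_ge0 (x + y); lra.
Qed.

Lemma integrable_pow4D X Y : measurable_fun setT X -> measurable_fun setT Y ->
  P.-integrable setT (EFin \o (fun w => X w ^+ 4)) ->
  P.-integrable setT (EFin \o (fun w => Y w ^+ 4)) ->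
  P.-integrable setT (EFin \o (fun w => (X w + Y w) ^+ 4)).
Proof.
move=> mX mY X4 Y4.
apply: (@integrable_dom _ _ _ _ _ (fun w => 8 * (X w ^+ 4 + Y w ^+ 4))).
- by apply: measurable_funX; exact: measurable_funD.
- by move=> w; rewrite ger0_norm ?exprn_even_ge0// pow4D_le.
- by apply: integrableRZ; exact: integrableRD.
Qed.

Lemma integrable_pow4Z (a : R) X :
  P.-integrable setT (EFin \o (fun w => X w ^+ 4)) ->
  P.-integrable setT (EFin \o (fun w => (a * X w) ^+ 4)).
Proof.
move=> X4; rewrite (_ : _ \o _ = EFin \o (fun w => a ^+ 4 * X w ^+ 4)).
  exact: integrableRZ.
by apply/funext => w /=; rewrite exprMn.
Qed.

Lemma integrable_pow4_pow1 X : measurable_fun setT X ->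
  P.-integrable setT (EFin \o (fun w => X w ^+ 4)) ->
  P.-integrable setT (EFin \o X).
Proof.
move=> mX X4; apply: (@integrable_dom _ _ _ _ _ (fun w => 1 + X w ^+ 4)) => //.
- by move=> w; have [] := ler_pow4 (X w).
- by apply: integrableRD => //; exact: integrable_cst.
Qed.

Lemma integrable_pow4_pow2 X : measurable_fun setT X ->
  P.-integrable setT (EFin \o (fun w => X w ^+ 4)) ->
  P.-integrable setT (EFin \o (fun w => X w ^+ 2)).
Proof.
move=> mX X4; apply: (@integrable_dom _ _ _ _ _ (fun w => 1 + X w ^+ 4)) => //.
- exact: measurable_funX.
- by move=> w; rewrite ger0_norm ?sqr_ge0//; have [] := ler_pow4 (X w).
- by apply: integrableRD => //; exact: integrable_cst.
Qed.

Lemma integrable_pow4_prod X Y : measurable_fun setT X -> measurable_fun setT Y ->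
  P.-integrable setT (EFin \o (fun w => X w ^+ 4)) ->
  P.-integrable setT (EFin \o (fun w => Y w ^+ 4)) ->
  P.-integrable setT (EFin \o (fun w => X w * Y w)).
Proof.
move=> mX mY X4 Y4.
apply: (@integrable_dom _ _ _ _ _ (fun w => X w ^+ 2 + Y w ^+ 2)).
- exact: measurable_funM.
- move=> w; rewrite normrM.
  have -> : X w ^+ 2 + Y w ^+ 2 = `|X w| ^+ 2 + `|Y w| ^+ 2 by rewrite !real_normK ?num_real.
  have := sqr_ge0 (`|X w| - `|Y w|); have := sqr_ge0 (`|X w| + `|Y w|); nra.
- by apply: integrableRD; exact: integrable_pow4_pow2.
Qed.

End integrable_powers.

Section standardized_moments.
Context {R : realType}.
Variables (F : cumulativeBounded (0 : R) (1 : R)) (mu sigma : R).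
Hypothesis sigma_gt0 : 0 < sigma.
Hypothesis F_moment4 : (\int[lebesgue_stieltjes_measure F]_x (x ^+ 4)%:E < +oo)%E.
Hypothesis F_mean : (\int[lebesgue_stieltjes_measure F]_x x%:E = mu%:E)%E.
Hypothesis F_variance :
  (\int[lebesgue_stieltjes_measure F]_x ((x - mu) ^+ 2)%:E = (sigma ^+ 2)%:E)%E.

Definition standardize (x : R) : R := (x - mu) / sigma.

Lemma measurable_standardize : measurable_fun setT standardize.
Proof. by apply: measurable_funM => //; exact: measurable_funB. Qed.

Let L : probability (measurableTypeR R) R := lebesgue_stieltjes_measure F.

Let mid : measurable_fun setT (id : measurableTypeR R -> R).
Proof. exact: (@measurable_id _ _ setT). Qed.

Let L4 : L.-integrable setT (EFin \o (fun x => x ^+ 4)).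
Proof.
apply/integrableP; split; first by apply/measurable_EFinP; exact: exprn_measurable.
by under eq_integral do rewrite /= ger0_norm ?exprn_even_ge0//.
Qed.

Let mstd : measurable_fun setT (standardize : measurableTypeR R -> R).
Proof. exact: measurable_standardize. Qed.

Let stdE x : standardize x = sigma^-1 * (x + - mu).
Proof. by rewrite /standardize mulrC. Qed.

Let S4 : L.-integrable setT (EFin \o (fun x => standardize x ^+ 4)).
Proof.
under eq_fun do rewrite stdE; apply: integrable_pow4Z; apply: integrable_pow4D => //.
exact: integrable_cst.
Qed.

Let L1 : L.-integrable setT (EFin \o (id : measurableTypeR R -> R)).
Proof. exact: integrable_pow4_pow1. Qed.

Lemma standardize_law_mean : \int[L]_x standardize x = 0.
Proof.
under eq_Rintegral do rewrite stdE.
rewrite RintegralZl//; last by apply: integrableRD => //; exact: integrable_cst.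
rewrite RintegralD//; last exact: integrable_cst.
by rewrite Rintegral_prob_cst /Rintegral F_mean/= subrr mulr0.
Qed.

Lemma standardize_law_variance : \int[L]_x standardize x ^+ 2 = 1.
Proof.
under eq_Rintegral do rewrite stdE exprMn.
rewrite RintegralZl//; last first.
  apply: integrable_pow4_pow2; first exact: measurable_funD.
  by apply: integrable_pow4D => //; exact: integrable_cst.
rewrite /Rintegral F_variance/= exprVn mulVf//.
by rewrite expf_neq0// gt_eqF.
Qed.

(** Computed under the law [F] rather than under [P], so that one constant serves every measurement
    in every row. *)
Definition kurtosis : R := \int[L]_x standardize x ^+ 4.

Lemma kurtosis_ge0 : 0 <= kurtosis.
Proof. by apply: Rintegral_ge0 => x _; exact: exprn_even_ge0. Qed.

Context d (T : measurableType d) (P : probability T R).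
Variable X : {RV P >-> R}.
Hypothesis XF : has_cdf X F.

Let mX : measurable_fun setT (X : T -> R).
Proof. exact: (@measurable_funPT _ _ _ _ X). Qed.

Let law A (mA : measurable A) : P (X @^-1` A) = L (id @^-1` A) := has_cdf_law XF mA.

Lemma measurable_standardized : measurable_fun setT (fun w => standardize (X w)).
Proof. by apply: (measurableT_comp measurable_standardize). Qed.

Lemma standardized_integrable4 :
  P.-integrable setT (EFin \o (fun w => standardize (X w) ^+ 4)).
Proof.
apply: (integrable_same_law mX mid law (g := fun x => standardize x ^+ 4)) => //.
by apply: measurable_funX; exact: measurable_standardize.
Qed.

Lemma standardized_mean : \int[P]_w standardize (X w) = 0.
Proof.
rewrite (Rintegral_same_law mX mid law measurable_standardize); first exact: standardize_law_mean.
exact: integrable_pow4_pow1.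
Qed.

Lemma standardized_variance : \int[P]_w standardize (X w) ^+ 2 = 1.
Proof.
rewrite (Rintegral_same_law mX mid law (g := fun x => standardize x ^+ 2)).
- exact: standardize_law_variance.
- by apply: measurable_funX; exact: measurable_standardize.
- exact: integrable_pow4_pow2.
Qed.

Lemma standardized_moment4 : \int[P]_w standardize (X w) ^+ 4 = kurtosis.
Proof.
rewrite (Rintegral_same_law mX mid law (g := fun x => standardize x ^+ 4))//.
by apply: measurable_funX; exact: measurable_standardize.
Qed.

End standardized_moments.

(** * Independent centred variables are uncorrelated *)

Section uncorrelated.
Context d (T : measurableType d) (R : realType) (P : probability T R).

Definition clip (M x : R) : R := Num.max (- M) (Num.min M x).

Lemma clip_le (M x : R) : 0 < M -> `|clip M x| <= M.
Proof.
move=> M0; rewrite ler_norml /clip le_max lexx/= ge_max ge_min lexx/= andbT.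
lra.
Qed.

Lemma clip_dist (M x : R) : 0 < M -> `|x - clip M x| <= x ^+ 2 / M.
Proof.
move=> M0; rewrite ler_pdivlMr// /clip.
have x20 := sqr_ge0 x.
have [Mx|xM] := leP M x.
  rewrite (max_idPr _); last by lra.
  rewrite ger0_norm; last by lra.
  nra.
have [Mx|xM'] := leP (- M) x.
  by rewrite subrr normr0 mul0r.
rewrite ltr0_norm; last by lra.
nra.
Qed.

Lemma clip_norm_le (M x : R) : 0 < M -> `|clip M x| <= `|x|.
Proof.
move=> M0; rewrite /clip; have [Mx|xM] := leP M x.
  rewrite (max_idPr _); last by lra.
  by rewrite !ger0_norm//; lra.
have [Mx|xM'] := leP (- M) x => //.
by rewrite normrN gtr0_norm// ltr0_norm; lra.
Qed.

Lemma bounded_measurable_clip M : 0 < M -> bounded_measurable (clip M).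
Proof.
move=> M0; split; last by exists M => x; exact: clip_le.
apply: measurable_maxr => //; apply: measurable_minr => //.
Qed.

(** The product rule is available for bounded functions only, hence the clipping at M. Clipping
    changes the mean product by O(1/M), and since the variables are centred the clipped means are
    O(1/M) as well; M is then arbitrary. *)
Lemma uncorrelated_of_independent (X Y : T -> R) :
  measurable_fun setT X -> measurable_fun setT Y ->
  P.-integrable setT (EFin \o (fun w => X w ^+ 4)) ->
  P.-integrable setT (EFin \o (fun w => Y w ^+ 4)) ->
  \int[P]_w X w = 0 -> \int[P]_w Y w = 0 ->
  (forall g h, bounded_measurable g -> bounded_measurable h ->
     \int[P]_w (g (X w) * h (Y w)) = \int[P]_w g (X w) * \int[P]_w h (Y w)) ->
  \int[P]_w (X w * Y w) = 0.
Proof.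
move=> mX mY X4 Y4 X0 Y0 indep.
have X1 := integrable_pow4_pow1 mX X4; have Y1 := integrable_pow4_pow1 mY Y4.
have X2 := integrable_pow4_pow2 mX X4; have Y2 := integrable_pow4_pow2 mY Y4.
have XY := integrable_pow4_prod mX mY X4 Y4.
(* Dominates |X| Y^2 + |Y| X^2, the clipping error times M, because 2 |x| y^2 <= x^2 + y^4. *)
pose D w := (X w ^+ 2 + X w ^+ 4) + (Y w ^+ 2 + Y w ^+ 4).
have Di : P.-integrable setT (EFin \o D).
  by do 2?[apply: integrableRD].
have D0 : 0 <= \int[P]_w D w.
  by apply: Rintegral_ge0 => w _; rewrite /D !addr_ge0 ?sqr_ge0 ?exprn_even_ge0.
pose V := \int[P]_w X w ^+ 2; pose V' := \int[P]_w Y w ^+ 2.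
have V0 : 0 <= V by apply: Rintegral_ge0 => w _; exact: sqr_ge0.
have V'0 : 0 <= V' by apply: Rintegral_ge0 => w _; exact: sqr_ge0.
pose K := \int[P]_w D w + V * V'.
have K0 : 0 <= K by rewrite addr_ge0 ?mulr_ge0.
suff bound M : 1 <= M -> `|\int[P]_w (X w * Y w)| <= K / M.
  apply/eqP; rewrite -normr_le0; apply/ler_addgt0Pr => e e0; rewrite add0r.
  have Ke : 0 <= K / e by rewrite divr_ge0// ltW.
  have M1 : 1 <= 1 + K / e by lra.
  apply: le_trans (bound _ M1) _; rewrite ler_pdivrMr; last by lra.
  by rewrite mulrDr mulr1 mulrCA divff ?gt_eqF// mulr1; lra.
move=> M1; have M0 : 0 < M by lra.
have bc := bounded_measurable_clip M0.
have ciX (Z : T -> R) : measurable_fun setT Z -> P.-integrable setT (EFin \o (fun w => clip M (Z w))).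
  by move=> mZ; exact: integrable_bcomp.
have mean (Z : T -> R) : measurable_fun setT Z -> P.-integrable setT (EFin \o (fun w => Z w ^+ 4)) ->
    \int[P]_w Z w = 0 -> `|\int[P]_w clip M (Z w)| <= (\int[P]_w Z w ^+ 2) / M.
  move=> mZ Z4 Z0; rewrite -normrN -[X in `|X|]add0r -{1}Z0 mulrC -RintegralZl//; last first.
    exact: integrable_pow4_pow2.
  apply: Rintegral_dist_le => //.
  - exact: integrable_pow4_pow1.
  - exact: ciX.
  - by apply: integrableRZ; exact: integrable_pow4_pow2.
  - by move=> w; rewrite mulrC clip_dist.
have cc : P.-integrable setT (EFin \o (fun w => clip M (X w) * clip M (Y w))).
  apply: (@integrable_bounded _ _ _ _ _ (M * M)).
    by apply: measurable_funM; exact: measurable_bcomp.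
  by move=> w; rewrite normrM ler_pM// clip_le.
rewrite -[\int[P]_w (X w * Y w)](subrK (\int[P]_w (clip M (X w) * clip M (Y w)))).
apply: le_trans (ler_normD _ _) _; rewrite /K mulrDl; apply: lerD.
  rewrite mulrC -RintegralZl//; apply: Rintegral_dist_le => //; first exact: integrableRZ.
  move=> w; rewrite /D; move: (X w) (Y w) => x y.
  have -> : x * y - clip M x * clip M y = x * (y - clip M y) + clip M y * (x - clip M x) by ring.
  apply: le_trans (ler_normD _ _) _; rewrite !normrM.
  have h1 := ler_wpM2l (normr_ge0 x) (clip_dist y M0).
  have h2 : `|clip M y| * `|x - clip M x| <= `|y| * (x ^+ 2 / M).
    by apply: ler_pM => //; [exact: clip_norm_le|exact: clip_dist].
  apply: le_trans (lerD h1 h2) _.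
  rewrite !mulrA -mulrDl mulrC ler_wpM2l ?invr_ge0 ?(ltW M0)//.
  have xx : `|x| ^+ 2 = x ^+ 2 by rewrite real_normK// num_real.
  have yy : `|y| ^+ 2 = y ^+ 2 by rewrite real_normK// num_real.
  have s1 := sqr_ge0 (`|x| - y ^+ 2); have s2 := sqr_ge0 (`|y| - x ^+ 2).
  have s3 := sqr_ge0 x; have s4 := sqr_ge0 y.
  have s5 : 0 <= x ^+ 4 by exact: exprn_even_ge0.
  have s6 : 0 <= y ^+ 4 by exact: exprn_even_ge0.
  have e1 : (`|x| - y ^+ 2) ^+ 2 = x ^+ 2 - 2 * (`|x| * y ^+ 2) + y ^+ 4 by rewrite -xx; ring.
  have e2 : (`|y| - x ^+ 2) ^+ 2 = y ^+ 2 - 2 * (`|y| * x ^+ 2) + x ^+ 4 by rewrite -yy; ring.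
  lra.
rewrite indep// normrM.
apply: (@le_trans _ _ ((V / M) * (V' / M))).
  by apply: ler_pM => //; exact: mean.
rewrite mulrACA ler_wpM2l ?mulr_ge0//.
by rewrite -[leRHS]mulr1 ler_wpM2l ?invr_ge0 ?(ltW M0)// invf_le1.
Qed.

End uncorrelated.

(** * Moments of the contribution of one item *)

Section summand_estimates.
Context d (T : measurableType d) (R : realType) (P : probability T R).

Lemma Rintegral_cos_bound (xi : T -> R) : measurable_fun setT xi ->
  P.-integrable setT (EFin \o (fun w => xi w ^+ 4)) ->
  `|\int[P]_w cos (xi w) - (1 - (\int[P]_w xi w ^+ 2) / 2)| <= (\int[P]_w xi w ^+ 4) / 24.
Proof.
move=> mxi xi4; have xi2 := integrable_pow4_pow2 mxi xi4.
have -> : 1 - (\int[P]_w xi w ^+ 2) / 2 = \int[P]_w (1 - 2^-1 * xi w ^+ 2).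
  rewrite RintegralB//; [|exact: integrable_cst|exact: integrableRZ].
  by rewrite Rintegral_prob_cst RintegralZl// mulrC.
rewrite mulrC -RintegralZl//; apply: Rintegral_dist_le.
- apply: (@integrable_bounded _ _ _ _ _ 1) => [|z]; last exact: cos_max.
  exact: measurable_cos_comp.
- by apply: integrableRB; [exact: integrable_cst|exact: integrableRZ].
- exact: integrableRZ.
- by move=> w; rewrite mulrC [leRHS]mulrC cos_taylor.
Qed.

(** Centring removes the linear term of the sine. The free parameter [dl] is set to 1/sqrt (min (n1,
    n2)) in [panel_cf_bound], which balances the two terms. *)
Lemma Rintegral_sin_bound (xi : T -> R) (dl : R) : 0 < dl -> measurable_fun setT xi ->
  P.-integrable setT (EFin \o (fun w => xi w ^+ 4)) -> \int[P]_w xi w = 0 ->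
  `|\int[P]_w sin (xi w)| <= dl * \int[P]_w xi w ^+ 2 + (\int[P]_w xi w ^+ 4) / dl.
Proof.
move=> dl0 mxi xi4 xi0; have xi2 := integrable_pow4_pow2 mxi xi4.
have xi1 := integrable_pow4_pow1 mxi xi4.
have -> : dl * \int[P]_w xi w ^+ 2 + (\int[P]_w xi w ^+ 4) / dl =
    \int[P]_w (dl * xi w ^+ 2 + dl^-1 * xi w ^+ 4).
  rewrite RintegralD//; [|exact: integrableRZ|exact: integrableRZ].
  by rewrite !RintegralZl// [in RHS](mulrC dl^-1).
rewrite -[X in `|X|]subr0 -{1}xi0; apply: Rintegral_dist_le => //.
- apply: (@integrable_bounded _ _ _ _ _ 1) => [|z]; last exact: sin_max.
  exact: measurable_sin_comp.
- by apply: integrableRD; exact: integrableRZ.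
- by move=> w; rewrite (mulrC dl^-1) sin_taylor24.
Qed.

Variables (U V : T -> R) (al be r K : R).
Hypotheses (mU : measurable_fun setT U) (mV : measurable_fun setT V).
Hypotheses (U4 : P.-integrable setT (EFin \o (fun w => U w ^+ 4)))
  (V4 : P.-integrable setT (EFin \o (fun w => V w ^+ 4))).

Let xi w := al * U w + be * V w.

Let maU : measurable_fun setT (fun w => al * U w).
Proof. exact: measurable_funM. Qed.

Let mbV : measurable_fun setT (fun w => be * V w).
Proof. exact: measurable_funM. Qed.

Lemma integrable_lin4 : P.-integrable setT (EFin \o (fun w => xi w ^+ 4)).
Proof. by apply: integrable_pow4D => //; exact: integrable_pow4Z. Qed.

Lemma Rintegral_lin : \int[P]_w U w = 0 -> \int[P]_w V w = 0 -> \int[P]_w xi w = 0.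
Proof.
move=> U0 V0; have U1 := integrable_pow4_pow1 mU U4; have V1 := integrable_pow4_pow1 mV V4.
rewrite RintegralD//; [|exact: integrableRZ|exact: integrableRZ].
by rewrite !RintegralZl// U0 V0 !mulr0 addr0.
Qed.

(** The moment hypotheses carry the coefficients as factors, so they hold trivially for a
    measurement that was not taken, whose coefficient is 0. *)
Lemma Rintegral_lin2 : al ^+ 2 * \int[P]_w U w ^+ 2 = al ^+ 2 ->
  be ^+ 2 * \int[P]_w V w ^+ 2 = be ^+ 2 ->
  al * be * \int[P]_w (U w * V w) = al * be * r ->
  \int[P]_w xi w ^+ 2 = al ^+ 2 + be ^+ 2 + 2 * (al * be) * r.
Proof.
move=> EU EV EUV.
have U2 := integrable_pow4_pow2 mU U4; have V2 := integrable_pow4_pow2 mV V4.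
have UV := integrable_pow4_prod mU mV U4 V4.
have -> : \int[P]_w xi w ^+ 2 = \int[P]_w (al ^+ 2 * U w ^+ 2 + be ^+ 2 * V w ^+ 2 +
    2 * (al * be) * (U w * V w)) by apply: eq_Rintegral => w _; rewrite /xi; ring.
rewrite RintegralD//; last 2 first.
- by apply: integrableRD; exact: integrableRZ.
- exact: integrableRZ.
rewrite RintegralD//; [|exact: integrableRZ|exact: integrableRZ].
by rewrite !RintegralZl// EU EV -[2 * _ * _ in LHS]mulrA EUV; ring.
Qed.

Lemma Rintegral_lin4 : \int[P]_w U w ^+ 4 <= K -> \int[P]_w V w ^+ 4 <= K ->
  \int[P]_w xi w ^+ 4 <= 8 * K * (al ^+ 2 + be ^+ 2) ^+ 2.
Proof.
move=> UK VK.
have K0 : 0 <= K by apply: le_trans UK; apply: Rintegral_ge0 => w _; exact: exprn_even_ge0.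
apply: (@le_trans _ _ (\int[P]_w (8 * (al ^+ 4 * U w ^+ 4 + be ^+ 4 * V w ^+ 4)))).
  apply: le_Rintegral => //; first exact: integrable_lin4.
    by apply: integrableRZ; apply: integrableRD; exact: integrableRZ.
  by move=> w _; rewrite -!exprMn pow4D_le.
rewrite RintegralZl//; last by apply: integrableRD; exact: integrableRZ.
rewrite RintegralD//; [|exact: integrableRZ|exact: integrableRZ].
rewrite !RintegralZl// -mulrA ler_wpM2l//.
have a4 : 0 <= al ^+ 4 by exact: exprn_even_ge0.
have b4 : 0 <= be ^+ 4 by exact: exprn_even_ge0.
apply: le_trans (lerD (ler_wpM2l a4 UK) (ler_wpM2l b4 VK)) _.
have ab : 0 <= (al * be) ^+ 2 * K by rewrite mulr_ge0 ?sqr_ge0.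
have -> : K * (al ^+ 2 + be ^+ 2) ^+ 2 = al ^+ 4 * K + be ^+ 4 * K + 2 * ((al * be) ^+ 2 * K) by ring.
lra.
Qed.

End summand_estimates.

(** * The panel *)

Section sum_of_uncorrelated.
Context d (T : measurableType d) (R : realType) (P : probability T R).
Variables (xi : nat -> T -> R) (n : nat).
Hypothesis mxi : forall i, measurable_fun setT (xi i).
Hypothesis xi4 : forall i, P.-integrable setT (EFin \o (fun w => xi i w ^+ 4)).
Hypothesis uncor : forall i j, (i < n)%N -> (j < n)%N -> i != j ->
  \int[P]_w (xi i w * xi j w) = 0.
Hypothesis var1 : forall i, (i < n)%N -> \int[P]_w xi i w ^+ 2 = 1.

Lemma integrable_sum4 k : measurable_fun setT (fun w => \sum_(i < k) xi i w) /\
  P.-integrable setT (EFin \o (fun w => (\sum_(i < k) xi i w) ^+ 4)).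
Proof.
elim: k => [|k [mS S4]].
  under eq_fun do rewrite big_ord0; split=> //.
  rewrite (_ : _ \o _ = EFin \o (fun=> 0)); first exact: integrable_cst.
  by apply/funext => w /=; rewrite big_ord0 expr0n.
under eq_fun do rewrite big_ord_recr/=; split; first exact: measurable_funD.
rewrite (_ : _ \o _ = EFin \o (fun w => (\sum_(i < k) xi i w + xi k w) ^+ 4)).
  exact: integrable_pow4D.
by apply/funext => w /=; rewrite big_ord_recr.
Qed.

Lemma Rintegral_sum2 k : (k <= n)%N -> \int[P]_w (\sum_(i < k) xi i w) ^+ 2 = k%:R.
Proof.
elim: k => [_|k IH kn].
  by under eq_Rintegral do rewrite big_ord0 expr0n/=; rewrite Rintegral_prob_cst.
have [mS S4] := integrable_sum4 k.
have cross m : (m <= k)%N -> \int[P]_w ((\sum_(i < m) xi i w) * xi k w) = 0.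
  elim: m => [_|m IHm mk].
    by under eq_Rintegral do rewrite big_ord0 mul0r; rewrite Rintegral_prob_cst.
  have [mSm Sm4] := integrable_sum4 m.
  under eq_Rintegral do rewrite big_ord_recr/= mulrDl.
  rewrite RintegralD//; [|exact: integrable_pow4_prod|exact: integrable_pow4_prod].
  rewrite IHm ?(ltnW mk)// uncor ?addr0//; [exact: ltn_trans mk kn|].
  by rewrite ltn_eqF.
under eq_Rintegral do rewrite big_ord_recr/= sqrrD -mulr_natl.
have i2 := integrable_pow4_pow2 mS S4.
have ip := integrable_pow4_prod mS (mxi k) S4 (xi4 k).
have k2 := integrable_pow4_pow2 (mxi k) (xi4 k).
rewrite RintegralD//; last by apply: integrableRD => //; exact: integrableRZ.
rewrite RintegralD//; last exact: integrableRZ.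
by rewrite RintegralZl// cross// var1// IH 1?ltnW// mulr0 addr0 -natr1.
Qed.

Lemma normalized_sum2 : (0 < n)%N ->
  P.-integrable setT (EFin \o (fun w => ((Num.sqrt n%:R)^-1 * \sum_(i < n) xi i w) ^+ 2)) /\
  \int[P]_w ((Num.sqrt n%:R)^-1 * \sum_(i < n) xi i w) ^+ 2 = 1.
Proof.
move=> n0; have [mS S4] := integrable_sum4 n.
have i2 := integrable_pow4_pow2 mS S4.
have sqE w : ((Num.sqrt n%:R)^-1 * \sum_(i < n) xi i w) ^+ 2 =
    n%:R^-1 * (\sum_(i < n) xi i w) ^+ 2 by rewrite exprMn exprVn sqr_sqrtr.
split.
  rewrite (_ : _ \o _ = EFin \o (fun w => n%:R^-1 * (\sum_(i < n) xi i w) ^+ 2)).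
    exact: integrableRZ.
  by apply/funext => w /=; rewrite sqE.
under eq_Rintegral do rewrite sqE.
by rewrite RintegralZl// Rintegral_sum2// mulVf// pnatr_eq0 -lt0n.
Qed.

End sum_of_uncorrelated.

Lemma sum_initial (R : realType) (n N : nat) (x : R) : (n <= N)%N ->
  \sum_(i < N) (if (i < n)%N then x else 0) = n%:R * x.
Proof.
by move=> nN; rewrite -big_mkcond -(big_ord_widen N (fun=> x) nN) sumr_const card_ord mulr_natl.
Qed.

Lemma gauss_cf0 (R : realType) : gauss_cf (0 : R) = 1.
Proof.
rewrite /gauss_cf sqrtr0.
by under eq_Rintegral do rewrite mul0r cos0; rewrite Rintegral_prob_cst.
Qed.

Lemma gauss_cf_sum (R : realType) (v : nat -> R) n : (forall i, 0 <= v i) ->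
  \prod_(i < n) gauss_cf (v i) = gauss_cf (\sum_(i < n) v i).
Proof.
move=> v0; elim: n => [|n IH]; first by rewrite !big_ord0 gauss_cf0.
by rewrite !big_ord_recr/= gauss_cfD// ?sumr_ge0// IH.
Qed.

Section panel.
Context {R : realType} d (T : measurableType d) (P : probability T R).
Variables (F : cumulativeBounded (0 : R) (1 : R)) (mu sigma : R).
Hypothesis sigma_gt0 : 0 < sigma.
Hypothesis F_moment4 : (\int[lebesgue_stieltjes_measure F]_x (x ^+ 4)%:E < +oo)%E.
Hypothesis F_mean : (\int[lebesgue_stieltjes_measure F]_x x%:E = mu%:E)%E.
Hypothesis F_variance :
  (\int[lebesgue_stieltjes_measure F]_x ((x - mu) ^+ 2)%:E = (sigma ^+ 2)%:E)%E.

Local Notation u := (standardize mu sigma).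
Local Notation K := (kurtosis F mu sigma).

Definition std_cov (X Y : T -> R) : R := \int[P]_w (u (X w) * u (Y w)).

Let rv_measurable (X : {RV P >-> R}) : measurable_fun setT (X : T -> R).
Proof. exact: (@measurable_funPT _ _ _ _ X). Qed.

Let mean0 (X : {RV P >-> R}) (XF : has_cdf X F) : \int[P]_w u (X w) = 0.
Proof. exact: (standardized_mean sigma F_moment4 F_mean XF). Qed.

Let var1 (X : {RV P >-> R}) (XF : has_cdf X F) : \int[P]_w u (X w) ^+ 2 = 1.
Proof. exact: (standardized_variance sigma_gt0 F_moment4 F_variance XF). Qed.

Let mom4 (X : {RV P >-> R}) (XF : has_cdf X F) : \int[P]_w u (X w) ^+ 4 = K.
Proof. exact: (standardized_moment4 _ _ F_moment4 XF). Qed.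

Let int4 (X : {RV P >-> R}) (XF : has_cdf X F) :
  P.-integrable setT (EFin \o (fun w => u (X w) ^+ 4)).
Proof. exact: (standardized_integrable4 _ _ F_moment4 XF). Qed.

Let mstd (X : {RV P >-> R}) : measurable_fun setT (fun w => u (X w)).
Proof. exact: measurable_standardized. Qed.

(** Cauchy-Schwarz, read off from the nonnegative second moments of u(X) + u(Y) and u(X) - u(Y). *)
Lemma std_cov_norm_le1 (X Y : {RV P >-> R}) : has_cdf X F -> has_cdf Y F ->
  `|std_cov X Y| <= 1.
Proof.
move=> XF YF; pose r := std_cov X Y.
have sq e : e ^+ 2 = 1 -> 0 <= 2 + 2 * e * r.
  move=> e1; have <- : \int[P]_w (1 * u (X w) + e * u (Y w)) ^+ 2 = 2 + 2 * e * r.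
    rewrite (Rintegral_lin2 (r := r) (mstd X) (mstd Y) (int4 XF) (int4 YF)).
    - by rewrite e1; ring.
    - by rewrite var1// mulr1.
    - by rewrite var1// mulr1.
    - by [].
  by apply: Rintegral_ge0 => w _; exact: sqr_ge0.
have := sq 1 ltac:(by rewrite expr1n); have := sq (- 1) ltac:(by rewrite sqrrN expr1n).
by rewrite ler_norml -/r; lra.
Qed.

Let uE (X : T -> R) w : X w - mu = sigma * u (X w).
Proof. by rewrite /standardize mulrC divfK// gt_eqF. Qed.

Lemma correlation_std_cov (X Y : {RV P >-> R}) : has_cdf X F -> has_cdf Y F ->
  correlation P X Y = std_cov X Y.
Proof.
have expE (Z : {RV P >-> R}) : has_cdf Z F -> fine 'E_P[Z]%E = mu.
  move=> ZF; rewrite unlock -[LHS]/(\int[P]_w Z w).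
  have -> : \int[P]_w Z w = \int[P]_w (mu + sigma * u (Z w)).
    by apply: eq_Rintegral => w _; rewrite -uE; ring.
  have Z1 := integrable_pow4_pow1 (mstd Z) (int4 ZF).
  rewrite RintegralD//; [|exact: integrable_cst|exact: integrableRZ].
  by rewrite RintegralZl// mean0// Rintegral_prob_cst mulr0 addr0.
have covE (Z W : {RV P >-> R}) : has_cdf Z F -> has_cdf W F ->
    fine (covariance P Z W) = sigma ^+ 2 * std_cov Z W.
  move=> ZF WF; rewrite unlock (expE Z ZF) (expE W WF) unlock.
  rewrite -[LHS]/(\int[P]_w ((Z w - mu) * (W w - mu))).
  rewrite /std_cov -RintegralZl//; last first.
    exact: (integrable_pow4_prod (mstd Z) (mstd W) (int4 ZF) (int4 WF)).
  by apply: eq_Rintegral => w _; rewrite !uE; ring.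
move=> XF YF; rewrite /correlation covE// /variance !covE//.
have var (Z : {RV P >-> R}) : has_cdf Z F -> std_cov Z Z = 1.
  by move=> ZF; rewrite -[RHS](var1 ZF); apply: eq_Rintegral => w _; rewrite expr2.
rewrite !var// mulr1 sqrtr_sqr gtr0_norm// -expr2 mulrAC divff ?mul1r//.
by rewrite expf_neq0// gt_eqF.
Qed.

Variables (Y1 Y2 : {RV P >-> R}) (n1 n2 : nat) (X1 X2 : nat -> {RV P >-> R}).
Hypothesis panel : panel_scheme F Y1 Y2 n1 n2 X1 X2.
Hypothesis min_gt0 : (0 < minn n1 n2)%N.

Let n1_gt0 : (0 < n1)%N. Proof. by move: min_gt0; rewrite leq_min => /andP[]. Qed.
Let n2_gt0 : (0 < n2)%N. Proof. by move: min_gt0; rewrite leq_min => /andP[]. Qed.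

(** Item 0 is measured at both stages, so its pair has the law of (Y1, Y2) and known marginals; this
    is where [min_gt0] matters. *)
Lemma panel_cdf_pair : has_cdf Y1 F /\ has_cdf Y2 F.
Proof.
split=> x.
  rewrite -(panel_cdf1 panel n1_gt0).
  have mA : measurable (`]-oo, x]%classic `*` setT : set (R * R)) by exact: measurableX.
  have YX := panel_pairs panel min_gt0 mA.
  transitivity (P [set w | (`]-oo, x]%classic `*` setT) (Y1 w, Y2 w)]).
    by congr (P _); apply/seteqP; split => w //= [].
  by rewrite -YX; congr (P _); apply/seteqP; split => w //= [].
rewrite -(panel_cdf2 panel n2_gt0).
have mA : measurable (setT `*` `]-oo, x]%classic : set (R * R)) by exact: measurableX.
have YX := panel_pairs panel min_gt0 mA.
transitivity (P [set w | (setT `*` `]-oo, x]%classic) (Y1 w, Y2 w)]).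
  by congr (P _); apply/seteqP; split => w //= [].
by rewrite -YX; congr (P _); apply/seteqP; split => w //= [].
Qed.

Let r := std_cov Y1 Y2.

Lemma panel_pair_cov i : (i < minn n1 n2)%N -> std_cov (X1 i) (X2 i) = r.
Proof.
move=> im; have [F1 F2] := panel_cdf_pair.
have mpair (Z W : {RV P >-> R}) : measurable_fun setT (fun w => (Z w, W w)).
  by apply/measurable_fun_pairP; split; exact: rv_measurable.
apply: (Rintegral_same_law (mpair (X1 i) (X2 i)) (mpair Y1 Y2) _
    (g := fun z => u z.1 * u z.2)).
- by move=> A mA; exact: (panel_pairs panel im mA).
- by apply: measurable_funM; apply: (measurableT_comp (measurable_standardize mu sigma));
    [exact: measurable_fst|exact: measurable_snd].
- exact: (integrable_pow4_prod (mstd Y1) (mstd Y2) (int4 F1) (int4 F2)).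
Qed.

(* Measurements that were not taken contribute 0. *)
Let U i w := if (i < n1)%N then u (X1 i w) else 0.
Let V i w := if (i < n2)%N then u (X2 i w) else 0.

Let H i := sigma_of (item_measurements n1 n2 (fun i => X1 i : T -> R) (fun i => X2 i : T -> R) i).

(** Measurability is needed for the sigma-algebra of the item, not the ambient one. The space is
    therefore retyped with the sigma-algebra generated by the measurements taken on the item; a
    missing one contributes a constant. *)
Lemma panel_lin_measurable (al be : R) i (B : set R) : measurable B ->
  H i ((fun w => al * U i w + be * V i w) @^-1` B).
Proof.
move=> mB.
pose G := \bigcup_(f in item_measurements n1 n2 (fun i => X1 i : T -> R) (fun i => X2 i : T -> R) i)
  preimage_set_system setT f measurable.
pose TG : measurableType _ := g_sigma_algebraType G.
have mf f : item_measurements n1 n2 (fun i => X1 i : T -> R) (fun i => X2 i : T -> R) i f ->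
    measurable_fun [set: TG] (f : TG -> R).
  move=> If _ A mA; apply: sub_sigma_algebra; exists f => //.
  by exists A.
have mU : measurable_fun [set: TG] (U i : TG -> R).
  rewrite /U; case: ltnP => // i1; apply: (measurableT_comp (measurable_standardize mu sigma)).
  by apply: mf; left.
have mV : measurable_fun [set: TG] (V i : TG -> R).
  rewrite /V; case: ltnP => // i2; apply: (measurableT_comp (measurable_standardize mu sigma)).
  by apply: mf; right.
have : measurable_fun [set: TG] ((fun w => al * U i w + be * V i w) : TG -> R).
  by apply: measurable_funD; exact: measurable_funM.
by move=> /(_ measurableT B mB); rewrite setTI.
Qed.

Let mU i : measurable_fun setT (U i).
Proof. by rewrite /U; case: ltnP. Qed.

Let mV i : measurable_fun setT (V i).
Proof. by rewrite /V; case: ltnP. Qed.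

(** Coefficients (1, 0) and (0, 1) give the independence within each sample; those of
    [panel_cf_bound] give it for the joint contributions of the items. *)
Lemma panel_indic_independent (al be : nat -> R) :
  indic_independent P (fun i w => al i * U i w + be i * V i w).
Proof.
apply: (@mutually_independent_indic _ _ _ _ _ _ _ (panel_items panel)).
  by move=> i; apply: measurable_funD; exact: measurable_funM.
by move=> i B mB; exact: panel_lin_measurable.
Qed.

Let U_mean0 i : \int[P]_w U i w = 0.
Proof.
rewrite /U; case: ltnP => i1; last by rewrite Rintegral_prob_cst.
by rewrite mean0//; exact: (panel_cdf1 panel).
Qed.

Let V_mean0 i : \int[P]_w V i w = 0.
Proof.
rewrite /V; case: ltnP => i1; last by rewrite Rintegral_prob_cst.
by rewrite mean0//; exact: (panel_cdf2 panel).
Qed.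

Let int0 : P.-integrable setT (EFin \o (fun _ : T => 0 ^+ 4)).
Proof. by rewrite expr0n; exact: integrable_cst. Qed.

Let U4 i : P.-integrable setT (EFin \o (fun w => U i w ^+ 4)).
Proof.
by rewrite /U; case: ltnP => i1 //; apply: int4; exact: (panel_cdf1 panel).
Qed.

Let V4 i : P.-integrable setT (EFin \o (fun w => V i w ^+ 4)).
Proof.
by rewrite /V; case: ltnP => i1 //; apply: int4; exact: (panel_cdf2 panel).
Qed.

Let U_mom4 i : \int[P]_w U i w ^+ 4 <= K.
Proof.
rewrite /U; case: ltnP => i1; first by rewrite mom4//; exact: (panel_cdf1 panel).
by rewrite expr0n Rintegral_prob_cst kurtosis_ge0.
Qed.

Let V_mom4 i : \int[P]_w V i w ^+ 4 <= K.
Proof.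
rewrite /V; case: ltnP => i1; first by rewrite mom4//; exact: (panel_cdf2 panel).
by rewrite expr0n Rintegral_prob_cst kurtosis_ge0.
Qed.

Let U_var1 i : (i < n1)%N -> \int[P]_w U i w ^+ 2 = 1.
Proof.
by move=> i1; rewrite /U i1 var1//; exact: (panel_cdf1 panel).
Qed.

Let V_var1 i : (i < n2)%N -> \int[P]_w V i w ^+ 2 = 1.
Proof.
by move=> i1; rewrite /V i1 var1//; exact: (panel_cdf2 panel).
Qed.

Let std_meanE n (X : nat -> T -> R) w : (0 < n)%N ->
  std_mean mu sigma n X w = (Num.sqrt n%:R)^-1 * \sum_(j < n) u (X j w).
Proof.
move=> n0; rewrite /std_mean /standardize.
have s0 : Num.sqrt n%:R != 0 :> R by rewrite gt_eqF// sqrtr_gt0 ltr0n.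
have nE : n%:R = Num.sqrt n%:R * Num.sqrt n%:R :> R by rewrite -expr2 sqr_sqrtr.
have key (x y S : R) : x != 0 -> y = x * x ->
    x * (S / y - mu) / sigma = x^-1 * ((S + y * - mu) / sigma).
  by move=> x0 ->; field; rewrite x0 gt_eqF.
rewrite (key (Num.sqrt n%:R) n%:R)// (mulr_natl (- mu)).
by rewrite -mulr_suml big_split/= sumr_const card_ord.
Qed.

Let std_mean1E w : std_mean mu sigma n1 (fun i => X1 i : T -> R) w =
  (Num.sqrt n1%:R)^-1 * \sum_(j < n1) U j w.
Proof.
by rewrite std_meanE//; congr (_ * _); apply: eq_bigr => j _; rewrite /U ltn_ord.
Qed.

Let std_mean2E w : std_mean mu sigma n2 (fun i => X2 i : T -> R) w =
  (Num.sqrt n2%:R)^-1 * \sum_(j < n2) V j w.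
Proof.
by rewrite std_meanE//; congr (_ * _); apply: eq_bigr => j _; rewrite /V ltn_ord.
Qed.

Let U_uncor i j : i != j -> \int[P]_w (U i w * U j w) = 0.
Proof.
move=> ij; apply: uncorrelated_of_independent => // g h bg bh.
have ind := panel_indic_independent (fun=> 1) (fun=> 0).
rewrite (_ : (fun _ _ => _) = U) in ind; last first.
  by apply/funext => k; apply/funext => w; rewrite mul1r mul0r addr0.
exact: Rintegral_pair_independent.
Qed.

Let V_uncor i j : i != j -> \int[P]_w (V i w * V j w) = 0.
Proof.
move=> ij; apply: uncorrelated_of_independent => // g h bg bh.
have ind := panel_indic_independent (fun=> 0) (fun=> 1).
rewrite (_ : (fun _ _ => _) = V) in ind; last first.
  by apply/funext => k; apply/funext => w; rewrite mul1r mul0r add0r.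
exact: Rintegral_pair_independent.
Qed.

Lemma panel_std_mean1_moment2 :
  P.-integrable setT (EFin \o (fun w => std_mean mu sigma n1 (fun i => X1 i : T -> R) w ^+ 2)) /\
  \int[P]_w std_mean mu sigma n1 (fun i => X1 i : T -> R) w ^+ 2 = 1.
Proof.
have [int2 E2] := normalized_sum2 mU U4 (fun i j _ _ => @U_uncor i j) U_var1 n1_gt0.
split; last by under eq_Rintegral do rewrite std_mean1E.
by rewrite (_ : _ \o _ = EFin \o (fun w => ((Num.sqrt n1%:R)^-1 * \sum_(j < n1) U j w) ^+ 2))//;
  apply/funext => w /=; rewrite std_mean1E.
Qed.

Lemma panel_std_mean2_moment2 :
  P.-integrable setT (EFin \o (fun w => std_mean mu sigma n2 (fun i => X2 i : T -> R) w ^+ 2)) /\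
  \int[P]_w std_mean mu sigma n2 (fun i => X2 i : T -> R) w ^+ 2 = 1.
Proof.
have [int2 E2] := normalized_sum2 mV V4 (fun i j _ _ => @V_uncor i j) V_var1 n2_gt0.
split; last by under eq_Rintegral do rewrite std_mean2E.
by rewrite (_ : _ \o _ = EFin \o (fun w => ((Num.sqrt n2%:R)^-1 * \sum_(j < n2) V j w) ^+ 2))//;
  apply/funext => w /=; rewrite std_mean2E.
Qed.

(** Lindeberg's bound for one row, each item being replaced by a normal variable with its own
    variance [v i]. The number of items is max (n1, n2), yet the error is governed by the minimum:
    the majorants [s i] have sum a^2 + b^2, and each is at most (a^2 + b^2) / min (n1, n2). *)
Lemma panel_cf_bound (C a b c : R) : 0 <= C ->
  (forall s, 0 <= s -> `|gauss_cf s - (1 - s / 2)| <= C * s ^+ 2) ->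
  `|\int[P]_w cos (a * std_mean mu sigma n1 (fun i => X1 i : T -> R) w
                    + b * std_mean mu sigma n2 (fun i => X2 i : T -> R) w + c)
    - gauss_cf (a ^+ 2 + b ^+ 2 + 2 * a * b *
        ((minn n1 n2)%:R / (Num.sqrt n1%:R * Num.sqrt n2%:R) * r)) * cos c|
  <= (a ^+ 2 + b ^+ 2) * ((K / 3 + 4 * C) * (a ^+ 2 + b ^+ 2) + 2 + 8 * K * (a ^+ 2 + b ^+ 2))
     / Num.sqrt (minn n1 n2)%:R.
Proof.
move=> C0 HC; have [YF1 YF2] := panel_cdf_pair.
have r1 : `|r| <= 1 by exact: std_cov_norm_le1.
have K0 : 0 <= K := kurtosis_ge0 F mu sigma.
have := min_gt0; set m := minn n1 n2 => m0.
pose q : R := (Num.sqrt m%:R)^-1.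
have q0 : 0 < q by rewrite invr_gt0 sqrtr_gt0 ltr0n.
have q2 : q ^+ 2 = m%:R^-1 by rewrite exprVn sqr_sqrtr.
have q1 : q <= 1 by rewrite invf_le1 ?sqrtr_gt0 ?ltr0n// -[X in X <= _]sqrtr1 ler_wsqrtr// ler1n.
have sqn n : (Num.sqrt (n%:R : R)) ^+ 2 = n%:R by rewrite sqr_sqrtr.
pose al i : R := if (i < n1)%N then a / Num.sqrt n1%:R else 0.
pose be i : R := if (i < n2)%N then b / Num.sqrt n2%:R else 0.
pose s i := al i ^+ 2 + be i ^+ 2.
pose v i := al i ^+ 2 + be i ^+ 2 + 2 * (al i * be i) * r.
have al2 i : al i ^+ 2 = if (i < n1)%N then a ^+ 2 / n1%:R else 0.
  by rewrite /al; case: ifP; rewrite ?expr0n// expr_div_n sqn.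
have be2 i : be i ^+ 2 = if (i < n2)%N then b ^+ 2 / n2%:R else 0.
  by rewrite /be; case: ifP; rewrite ?expr0n// expr_div_n sqn.
have albe i : al i * be i = if (i < m)%N then a * b / (Num.sqrt n1%:R * Num.sqrt n2%:R) else 0.
  rewrite /al /be /m leq_min; case: ifP => _ /=; last by rewrite mul0r.
  by case: ifP => _; rewrite ?mulr0// mulf_div.
have sum_al2 : \sum_(i < maxn n1 n2) al i ^+ 2 = a ^+ 2.
  under eq_bigr do rewrite al2.
  by rewrite sum_initial ?leq_maxl// mulrC divfK// pnatr_eq0 -lt0n.
have sum_be2 : \sum_(i < maxn n1 n2) be i ^+ 2 = b ^+ 2.
  under eq_bigr do rewrite be2.
  by rewrite sum_initial ?leq_maxr// mulrC divfK// pnatr_eq0 -lt0n.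
have sum_albe : \sum_(i < maxn n1 n2) al i * be i =
    m%:R * (a * b / (Num.sqrt n1%:R * Num.sqrt n2%:R)).
  under eq_bigr do rewrite albe.
  by rewrite sum_initial// /m; lia.
have s0 i : 0 <= s i by rewrite addr_ge0 ?sqr_ge0.
have vs i : 0 <= v i /\ v i <= 2 * s i.
  have h1 := sqr_ge0 (al i + be i); have h2 := sqr_ge0 (al i - be i).
  have : `|2 * (al i * be i)| <= s i by rewrite ler_norml /s; lra.
  move=> h; have : `|2 * (al i * be i) * r| <= s i.
    by rewrite normrM; apply: le_trans h; rewrite ler_piMr.
  by rewrite ler_norml /v -/(s i) => /andP[]; split; lra.
have sS i : s i <= (a ^+ 2 + b ^+ 2) * q ^+ 2.
  rewrite /s al2 be2 q2 mulrDl.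
  have le_inv (x : R) n k : (m <= n)%N ->
      (if (k < n)%N then x ^+ 2 / n%:R else 0) <= x ^+ 2 * m%:R^-1.
    move=> mn; case: ifP => _; last by rewrite mulr_ge0 ?sqr_ge0// invr_ge0.
    by rewrite ler_wpM2l ?sqr_ge0// lef_pV2 ?ler_nat// posrE ltr0n//; lia.
  by rewrite lerD// le_inv// /m; lia.
have mxi i : measurable_fun setT (fun w => al i * U i w + be i * V i w).
  by apply: measurable_funD; exact: measurable_funM.
have cosE w : a * std_mean mu sigma n1 (fun i => X1 i : T -> R) w
     + b * std_mean mu sigma n2 (fun i => X2 i : T -> R) w + c =
    \sum_(i < maxn n1 n2) (al i * U i w + be i * V i w) + c.
  rewrite std_mean1E std_mean2E big_split/= !mulrA !mulr_sumr.
  congr (_ + _ + _).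
    rewrite (big_ord_widen (maxn n1 n2) (fun i => a / Num.sqrt n1%:R * U i w)) ?leq_maxl//.
    by rewrite big_mkcond; apply: eq_bigr => i _; rewrite /al; case: ifP; rewrite ?mul0r.
  rewrite (big_ord_widen (maxn n1 n2) (fun i => b / Num.sqrt n2%:R * V i w)) ?leq_maxr//.
  by rewrite big_mkcond; apply: eq_bigr => i _; rewrite /be; case: ifP; rewrite ?mul0r.
under eq_Rintegral do rewrite cosE.
have sum_v : \sum_(i < maxn n1 n2) v i = a ^+ 2 + b ^+ 2 + 2 * a * b *
    (m%:R / (Num.sqrt n1%:R * Num.sqrt n2%:R) * r).
  rewrite big_split/= big_split/= sum_al2 sum_be2 -mulr_suml -mulr_sumr sum_albe.
  by congr (_ + _); ring.
rewrite -sum_v -gauss_cf_sum; last by move=> i; have [] := vs i.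
(* Error of one item. The cosine gives (K/3 + 4C) s_i^2, from 8K/24 and from v_i <= 2 s_i; the sine
   with dl = q gives 2 q s_i and 8K s_i (a^2 + b^2) q. Each is at most s_i q times a term of [D], by
   s_i <= (a^2 + b^2) q^2 and q <= 1. *)
set D := (K / 3 + 4 * C) * (a ^+ 2 + b ^+ 2) + 2 + 8 * K * (a ^+ 2 + b ^+ 2).
have -> : (a ^+ 2 + b ^+ 2) * D / Num.sqrt m%:R = \sum_(i < maxn n1 n2) s i * (D * q).
  by rewrite -mulr_suml big_split/= sum_al2 sum_be2 mulrA.
apply: (@Rintegral_cos_sum_dist _ _ _ _ _ mxi _ _ (fun i => gauss_cf (v i))
  (fun i => s i * (D * q))).
- exact: panel_indic_independent.
- by move=> i; exact: gauss_cf_le1.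
move=> i iN; have [v0 v2s] := vs i.
have xi4 := integrable_lin4 (al i) (be i) (mU i) (mV i) (U4 i) (V4 i).
have xi1 := Rintegral_lin (al i) (be i) (mU i) (mV i) (U4 i) (V4 i) (U_mean0 i) (V_mean0 i).
have xi2 : \int[P]_w (al i * U i w + be i * V i w) ^+ 2 = v i.
  apply: (Rintegral_lin2 (mU i) (mV i) (U4 i) (V4 i)).
  - by rewrite al2; case: ifP => [i1|]; rewrite ?mul0r// U_var1// mulr1.
  - by rewrite be2; case: ifP => [i1|]; rewrite ?mul0r// V_var1// mulr1.
  - rewrite albe; case: ifP => [im|]; rewrite ?mul0r//; congr (_ * _).
    rewrite -(panel_pair_cov im); apply: eq_Rintegral => w _.
    by move: im; rewrite /m leq_min /U /V => /andP[-> ->].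
have xi4le := Rintegral_lin4 (al i) (be i) (mU i) (mV i) (U4 i) (V4 i) (U_mom4 i) (V_mom4 i).
have cosb := Rintegral_cos_bound (mxi i) xi4.
have sinb := Rintegral_sin_bound q0 (mxi i) xi4 xi1.
rewrite xi2 in cosb sinb.
set k4 := \int[P]_w (_ ^+ 4) in xi4le cosb sinb.
rewrite -/(s i) in xi4le.
set Ic := \int[P]_w cos _ in cosb *.
set Is := \int[P]_w sin _ in sinb *.
have tri : `|Ic - gauss_cf (v i)| <= k4 / 24 + C * v i ^+ 2.
  have -> : Ic - gauss_cf (v i) = (Ic - (1 - v i / 2)) - (gauss_cf (v i) - (1 - v i / 2)) by ring.
  by apply: (le_trans (ler_normB _ _)); apply: lerD => //; exact: HC.
have vv : v i ^+ 2 <= 4 * s i ^+ 2.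
  have -> : 4 * s i ^+ 2 = (2 * s i) ^+ 2 by ring.
  by rewrite ler_sqr// nnegrE; lra.
have k4q : k4 / q <= 8 * K * (s i * (a ^+ 2 + b ^+ 2)) * q.
  rewrite ler_pdivrMr//; apply: (le_trans xi4le).
  have -> : 8 * K * (s i * (a ^+ 2 + b ^+ 2)) * q * q =
    8 * K * (s i * ((a ^+ 2 + b ^+ 2) * q ^+ 2)) by ring.
  by rewrite ler_wpM2l ?mulr_ge0// expr2 ler_wpM2l.
have ss : s i ^+ 2 <= s i * (a ^+ 2 + b ^+ 2) * q.
  rewrite expr2 -mulrA ler_wpM2l//; apply: (le_trans (sS i)).
  by rewrite ler_wpM2l ?addr_ge0 ?sqr_ge0// expr2 ler_piMl// ltW.
have Cv : C * v i ^+ 2 <= C * (4 * (s i * (a ^+ 2 + b ^+ 2) * q)) by rewrite ler_wpM2l//; lra.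
have Ks : K * s i ^+ 2 <= K * (s i * (a ^+ 2 + b ^+ 2) * q) by rewrite ler_wpM2l.
have qv : q * v i <= q * (2 * s i) by rewrite ler_wpM2l// ltW.
have -> : s i * (D * q) = K * (s i * (a ^+ 2 + b ^+ 2) * q) / 3
  + C * (4 * (s i * (a ^+ 2 + b ^+ 2) * q)) + q * (2 * s i)
  + 8 * K * (s i * (a ^+ 2 + b ^+ 2)) * q by rewrite /D; field.
lra.
Qed.

End panel.

(** * The covariance factor and the conclusion *)

Section size_ratio.
Context {R : realType}.

(** The value of min (n1, n2) / sqrt (n1 n2) when n1/n2 = x. With n1 > n2 only n2 items are paired,
    so the factor is the inverse of sqrt x. *)
Definition size_ratio (x : R) : R := if x <= 1 then Num.sqrt x else (Num.sqrt x)^-1.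

Lemma size_ratioE (x : R) : size_ratio x = Num.sqrt (Num.min x 1) / Num.sqrt (Num.max x 1).
Proof.
by rewrite /size_ratio; case: leP => _; rewrite sqrtr1 ?divr1// mul1r.
Qed.

Lemma size_ratio_itv x : 0 <= size_ratio x <= 1.
Proof.
rewrite /size_ratio; case: (leP x 1) => x1.
  by rewrite sqrtr_ge0 -[X in _ <= X]sqrtr1 ler_wsqrtr.
rewrite invr_ge0 sqrtr_ge0 invf_le1 ?sqrtr_gt0 ?(lt_trans _ x1)//.
by rewrite -[X in X <= _]sqrtr1 ler_wsqrtr// ltW.
Qed.

(** The branches agree at 1. The form with min and max shows the continuity, its denominator being
    at least 1. *)
Lemma size_ratio_continuous : continuous size_ratio.
Proof.
rewrite (_ : size_ratio = fun x => Num.sqrt (Num.min x 1) / Num.sqrt (Num.max x 1)); last first.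
  by apply/funext => x; rewrite size_ratioE.
move=> x; apply: cvgM.
  apply: (@continuous_comp _ _ _ (fun x : R => Num.min x 1) Num.sqrt).
    by apply: continuous_min; [exact: cvg_id|exact: cvg_cst].
  exact: sqrt_continuous.
apply: cvgV.
  by rewrite gt_eqF// sqrtr_gt0 lt_max ltr01 orbT.
apply: (@continuous_comp _ _ _ (fun x : R => Num.max x 1) Num.sqrt).
  by apply: continuous_max; [exact: cvg_id|exact: cvg_cst].
exact: sqrt_continuous.
Qed.

Lemma size_ratio_minn (n1 n2 : nat) : (0 < minn n1 n2)%N ->
  (minn n1 n2)%:R / (Num.sqrt n1%:R * Num.sqrt n2%:R) = size_ratio (n1%:R / n2%:R).
Proof.
rewrite leq_min => /andP[n10 n20].
have s1 : Num.sqrt n1%:R != 0 :> R by rewrite gt_eqF// sqrtr_gt0 ltr0n.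
have s2 : Num.sqrt n2%:R != 0 :> R by rewrite gt_eqF// sqrtr_gt0 ltr0n.
have nE n : n%:R = Num.sqrt n%:R * Num.sqrt n%:R :> R by rewrite -expr2 sqr_sqrtr.
rewrite /size_ratio ler_pdivrMr ?ltr0n// mul1r ler_nat sqrtrM// sqrtrV//.
case: leqP => _.
  by rewrite {1}(nE n1); field; rewrite s1 s2.
by rewrite {1}(nE n2); field; rewrite s1 s2.
Qed.

End size_ratio.

Theorem proposition2
  (R : realType) (d : measure_display) (T : measurableType d)
  (P : probability T R)
  (F G : cumulativeBounded (0 : R) (1 : R)) (mu sigma : R)
  (sigma_gt0 : 0 < sigma)
  (F_moment4 : (\int[lebesgue_stieltjes_measure F]_x (x ^+ 4)%:E < +oo)%E)
  (F_mean : (\int[lebesgue_stieltjes_measure F]_x x%:E = mu%:E)%E)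
  (F_variance :
    (\int[lebesgue_stieltjes_measure F]_x ((x - mu) ^+ 2)%:E
      = (sigma ^+ 2)%:E)%E)
  (G_mean : (\int[lebesgue_stieltjes_measure G]_x x%:E = 0)%E)
  (G_variance : (\int[lebesgue_stieltjes_measure G]_x (x ^+ 2)%:E = 1)%E)
  (F_G : forall x : R, F x = G ((x - mu) / sigma))
  (* additional sample *)
  (Delta : R) (X0 : nat -> {RV P >-> R})
  (X0_cdf : forall j, has_cdf (X0 j) (fun x => F (x - Delta)))
  (* panel samples, along a sequence of pairs of sample sizes *)
  (Y1 Y2 : {RV P >-> R}) (cor_neq0 : correlation P Y1 Y2 != 0)
  (n1 n2 : nat -> nat) (X1 X2 : nat -> nat -> {RV P >-> R})
  (panel : forall k, panel_scheme F Y1 Y2 (n1 k) (n2 k) (X1 k) (X2 k))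
  (X0_indep : forall k, indep_of_panel X0 (n1 k) (n2 k) (X1 k) (X2 k))
  (lambda : R)
  (n_infty : minn (n1 k) (n2 k) @[k --> \oo] --> \oo)
  (n_ratio : ((n1 k)%:R / (n2 k)%:R : R) @[k --> \oo] --> lambda)
  (* quantile estimators *)
  (Gm Fm : quantile_estimator R) (p : R) (p01 : 0 < p < 1)
  (HQ : iid_sample (fun x => F (x - Delta)) X0 /\
          assumption_Q G (fun x => F (x - Delta)) X0 Gm Fm p
        \/ assumption_Q' (fun x => F (x - Delta)) X0 Fm) :
  (* limit of Cov = sqrt (min(n1, n2) / max(n1, n2)) * Cor(Y1, Y2) *)
  let rho := (if lambda <= 1 then Num.sqrt lambda else (Num.sqrt lambda)^-1)
               * correlation P Y1 Y2 in
  exists2 nu : probability (R * R)%type R,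
    is_binormal nu (0, 0) (\matrix_(i < 2, j < 2) if i == j then 1 else rho)
    & cvg_in_dist P
        (fun k w => (std_mean mu sigma (n1 k) (X1 k) w,
                     std_mean mu sigma (n2 k) (X2 k) w))
        nu id.
Proof.
move=> rho.
have minn_ge N : \forall k \near \oo, (N <= minn (n1 k) (n2 k))%N.
  by have /cvgnyPge := n_infty; apply.
have minn_gt0 := minn_ge 1%N.
(* A single row with a doubly measured item fixes the marginals of the reference pair, which belongs
   to no row. *)
have [k0 k0gt0] : exists k, (0 < minn (n1 k) (n2 k))%N.
  by have [N _ HN] := minn_gt0; exists N; exact: (HN N (leqnn N)).
have [Y1F Y2F] := panel_cdf_pair (panel k0) k0gt0.
pose r := std_cov P mu sigma Y1 Y2.
have r1 : `|r| <= 1.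
  exact: (std_cov_norm_le1 sigma_gt0 F_moment4 F_variance Y1F Y2F).
have rhoE : rho = size_ratio lambda * r.
  by rewrite /rho (correlation_std_cov sigma_gt0 F_moment4 F_mean F_variance Y1F Y2F).
have ratio_le1 x : `|size_ratio x * r| <= 1.
  have /andP[x0 x1] := size_ratio_itv x.
  by rewrite normrM ger0_norm// mulr_ile1.
have rho1 : `|rho| <= 1 by rewrite rhoE.
have [nu [nuN nui nu2 nucf]] := binormal_exists rho1.
exists nu => //.
have mY (X : {RV P >-> R}) : measurable_fun setT (X : T -> R) by exact: measurable_funPT.
have mean_measurable n (X : nat -> {RV P >-> R}) :
    measurable_fun setT (std_mean mu sigma n (fun i => X i : T -> R)).
  apply: measurable_funM => //; apply: measurable_funM => //; apply: measurable_funB => //.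
  by apply: measurable_funM => //; exact: measurable_sum.
(* The bound 2 is the sum of the second moments of the two standardized means, equal to 1 each, both
   in the rows and in the limit. *)
apply: (@cvg_in_dist_trig _ _ _ _ _ _ 2) => //.
- by move=> k; apply/measurable_fun_pairP; split; exact: mean_measurable.
- near=> k; have k_gt0 : (0 < minn (n1 k) (n2 k))%N by near: k.
  have [i1 E1] := panel_std_mean1_moment2 sigma_gt0 F_moment4 F_mean F_variance (panel k) k_gt0.
  have [i2 E2] := panel_std_mean2_moment2 sigma_gt0 F_moment4 F_mean F_variance (panel k) k_gt0.
  by split; [exact: integrableRD|rewrite RintegralD// E1 E2].
- by rewrite nu2.
move=> a b c; rewrite nucf.
have form_ge0 t : `|t| <= 1 -> 0 <= a ^+ 2 + b ^+ 2 + 2 * a * b * t.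
  move=> t1; have h1 := sqr_ge0 (a + b); have h2 := sqr_ge0 (a - b).
  have : `|2 * a * b * t| <= a ^+ 2 + b ^+ 2.
    rewrite normrM (@le_trans _ _ `|2 * a * b|)// ?ler_piMr//.
    by rewrite ler_norml; apply/andP; split; lra.
  by rewrite ler_norml => /andP[]; lra.
(* The exact variance of the linear form in row k, once both samples are nonempty. Row k is compared
   with it first, and only then does [v k] pass to its limit. *)
pose v k := a ^+ 2 + b ^+ 2 + 2 * a * b * (size_ratio ((n1 k)%:R / (n2 k)%:R) * r).
have vcvg : v k @[k --> \oo] --> a ^+ 2 + b ^+ 2 + 2 * a * b * rho.
  rewrite rhoE; apply: cvgD; first exact: cvg_cst.
  apply: cvgM; first exact: cvg_cst.
  apply: cvgM; last exact: cvg_cst.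
  exact: (cvg_comp _ _ n_ratio (@size_ratio_continuous R lambda)).
have cfcvg : gauss_cf (v k) * cos c @[k --> \oo] -->
    gauss_cf (a ^+ 2 + b ^+ 2 + 2 * a * b * rho) * cos c.
  apply: cvgM; last exact: cvg_cst.
  by apply: gauss_cf_cvg => // [k|]; exact: form_ge0.
have [C C0 HC] := @gauss_cf_taylor R.
set Z := fun k => \int[P]_w _.
set l := gauss_cf _ * _ in cfcvg *.
pose D := (a ^+ 2 + b ^+ 2) * ((kurtosis F mu sigma / 3 + 4 * C) * (a ^+ 2 + b ^+ 2) + 2
  + 8 * kurtosis F mu sigma * (a ^+ 2 + b ^+ 2)).
have bound : \forall k \near \oo, `|Z k - gauss_cf (v k) * cos c|
    <= D / Num.sqrt (minn (n1 k) (n2 k))%:R.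
  near=> k; have k_gt0 : (0 < minn (n1 k) (n2 k))%N by near: k.
  have := panel_cf_bound sigma_gt0 F_moment4 F_mean F_variance (panel k) k_gt0 a b c C0 HC.
  by rewrite size_ratio_minn.
have bound0 : D / Num.sqrt (minn (n1 k) (n2 k))%:R @[k --> \oo] --> 0.
  rewrite -[X in _ --> X](mulr0 D); apply: cvgM; first exact: cvg_cst.
  apply: (cvg_comp _ _ n_infty (_ : (Num.sqrt n%:R)^-1 @[n --> \oo] --> 0)).
  rewrite (_ : (fun n => _) = (fun n : nat => Num.sqrt (n%:R^-1) : R)); last first.
    by apply/funext => n; rewrite sqrtrV.
  rewrite -[X in _ --> X]sqrtr0; apply: continuous_cvg; first exact: sqrt_continuous.
  apply/gtr0_cvgV0; last exact: cvgr_idn.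
  by near=> n; rewrite ltr0n; near: n; exact: nbhs_infty_gt.
have diff0 : Z k - gauss_cf (v k) * cos c @[k --> \oo] --> 0.
  apply: norm_cvg0; apply: (squeeze_cvgr _ (@cvg_cst _ 0 _ _ _) bound0).
  by apply: filterS bound => k ->; rewrite normr_ge0.
rewrite -[l]add0r (_ : Z = fun k => Z k - gauss_cf (v k) * cos c + gauss_cf (v k) * cos c).
  exact: cvgD.
by apply/funext => k; rewrite subrK.
Unshelve. all: by end_near.
Qed.
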